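(* Let $T$ be as in the context and assume that, for the integer $k\ge1$ with $(A-\mathrm{Id})^k\ne0$, $(A-\mathrm{Id})^{k+1}=0$, the image $\{\mathbf y(A-\mathrm{Id})^k:\mathbf y\in\mathbb R^d\}$ equals $\mathbb R\mathbf e_d$. Let $\Psi$ be an everywhere positive trigonometric polynomial on $\mathbb T^d$ which is not measurably cohomologous to a constant with respect to $T$, and suppose that the function $\psi_{d-1}$ on $\mathbb T^{d-1}$ defined by $\psi_{d-1}(x_1,\dots,x_{d-1})=\int_0^1\Psi(x_1,\dots,x_d)\,dx_d$ is smoothly cohomologous to a constant with respect to $T_{d-1}$. Then the suspension flow $\{T^\Psi_t\}$ is mixing.
   Context: Let $d\ge 2$, $\mathbb T^d=\mathbb R^d/\mathbb Z^d$ with points as row vectors, $\lambda_d$ Lebesgue probability measure, $\mathbf e_d$ last standard basis vector. $A=(a_{i,j})$ is a $d\times d$ upper triangular unipotent integer matrix, $A\ne\mathrm{Id}$, $\mathbf b\in\mathbb T^d$, $T\mathbf x=\mathbf xA+\mathbf b$, uniquely ergodic. $T_{d-1}$ is the factor on $\mathbb T^{d-1}$: $T_{d-1}\mathbf y=\mathbf y(a_{i,j})_{1\le i,j\le d-1}+(b_1,\dots,b_{d-1})$. $\Psi$ is measurably (resp. smoothly) cohomologous to a constant w.r.t. a map $S$ if $\Psi-\int\Psi=u\circ S-u$ for a measurable (resp. $C^\infty$) $u$. For continuous $\Psi>0$ the suspension flow $\{T^\Psi_t\}$ is the unit-speed vertical flow on $(\mathbb T^d\times\mathbb R)/\sim_\Psi$,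 with $(\mathbf x,\Psi(\mathbf x))\sim(T\mathbf x,0)$; mixing is with respect to the normalized Lebesgue measure on $\{0\le r<\Psi(\mathbf x)\}$. *)

(* Defs.v *)
From HB Require Import structures.
From mathcomp Require Import all_boot all_order all_algebra.
From mathcomp Require Import all_classical all_reals all_analysis.
Set Implicit Arguments. Unset Strict Implicit. Unset Printing Implicit Defensive.
Import Order.TTheory GRing.Theory Num.Theory.
Import numFieldNormedType.Exports.
Local Open Scope classical_set_scope.
Local Open Scope ring_scope.

Section Defs.
Variable R : realType.

(** Points of R^n: row vectors (for the linear algebra) and tuples (for the
    canonical product Borel sigma-algebra of mathcomp-analysis). *)
Definition rv n (t : n.-tuple R) : 'rV[R]_n := \row_i tnth t i.
Definition tp n (r : 'rV[R]_n) : n.-tuple R := [tuple r 0 i | i < n].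

(** The torus T^n is represented by the fundamental domain [0,1)^n. *)
Definition frac (x : R) : R := x - (Num.floor x)%:~R.
Definition fracT n (t : n.-tuple R) : n.-tuple R := map_tuple frac t.
Definition unit_cube n : set (n.-tuple R) :=
  [set t | forall i : 'I_n, 0 <= tnth t i /\ tnth t i < 1].

(** Iterated Lebesgue integral over [0,1)^n (= integral w.r.t. the Haar
    probability lambda_n on T^n, by Tonelli, for Borel functions). *)
Fixpoint iint n : (n.-tuple R -> \bar R) -> \bar R :=
  match n return (n.-tuple R -> \bar R) -> \bar R with
  | 0 => fun f => f [tuple]
  | n'.+1 => fun f =>
      (\int[lebesgue_measure]_(x in [set x : R | (0 <= x < 1)%R])
          iint (fun t : n'.-tuple R => f (cons_tuple x t)))%E
  end.

Definition lam n (S : set (n.-tuple R)) : \bar R := iint (fun t => (\1_S t)%:E).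

Definition intT n (f : n.-tuple R -> R) : R := fine (iint (fun t => (f t)%:E)).

Definition Tlift n (A : 'M[int]_n) (b : 'rV[R]_n) (x : 'rV[R]_n) : 'rV[R]_n :=
  x *m map_mx (fun z : int => z%:~R) A + b.
Definition Tcube n (A : 'M[int]_n) (b : 'rV[R]_n) (t : n.-tuple R) : n.-tuple R :=
  fracT (tp (Tlift A b (rv t))).

Definition upper_unipotent n (A : 'M[int]_n) :=
  (forall i j : 'I_n, (j < i)%N -> A i j = 0) /\ (forall i : 'I_n, A i i = 1).

(** Unique ergodicity: any two T-invariant Borel probability measures on T^n
    coincide (an invariant one always exists, e.g. Lebesgue). Borel
    probability measures on T^n = measures on R^n of total mass one carried by
    the fundamental domain. *)
Definition torus_invariant_prob n (A : 'M[int]_n) (b : 'rV[R]_n)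
    (P : {measure set (n.-tuple R) -> \bar R}) :=
  P setT = 1%E /\ P (@unit_cube n) = 1%E /\
  forall S, measurable S -> S `<=` @unit_cube n ->
    P (Tcube A b @^-1` S `&` @unit_cube n) = P S.

Definition uniquely_ergodic n (A : 'M[int]_n) (b : 'rV[R]_n) :=
  forall P Q : {measure set (n.-tuple R) -> \bar R},
    torus_invariant_prob A b P -> torus_invariant_prob A b Q ->
    forall S, measurable S -> P S = Q S.

Definition trig_poly n (f : 'rV[R]_n -> R) :=
  exists s : seq ('rV[int]_n * R * R), forall x : 'rV[R]_n,
    f x = \sum_(c <- s)
      (c.1.2 * cos (2 * pi * \sum_(i < n) (c.1.1 0 i)%:~R * x 0 i)
       + c.2 * sin (2 * pi * \sum_(i < n) (c.1.1 0 i)%:~R * x 0 i)).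

Definition meas_cohom_const n (A : 'M[int]_n) (b : 'rV[R]_n)
    (f : n.-tuple R -> R) :=
  exists u : n.-tuple R -> R, measurable_fun (@unit_cube n) u /\
    exists N : set (n.-tuple R), measurable N /\ lam N = 0%E /\
      forall x, unit_cube x -> ~ N x ->
        f x - intT f = u (Tcube A b x) - u x.

Definition e_ n (i : 'I_n) : 'rV[R]_n := delta_mx 0 i.
Fixpoint pder n (s : seq 'I_n) (f : 'rV[R]_n -> R) : 'rV[R]_n -> R :=
  match s with
  | [::] => f
  | i :: s' => fun y => derive1 (fun t : R => pder s' f (y + t *: e_ i)) 0
  end.
Definition smooth n (f : 'rV[R]_n -> R) :=
  forall s : seq 'I_n, continuous (pder s f) /\
    forall (i : 'I_n) (y : 'rV[R]_n),
      derivable (fun t : R => pder s f (y + t *: e_ i)) 0 1.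

Definition smooth_cohom_const n (A : 'M[int]_n) (b : 'rV[R]_n)
    (f : 'rV[R]_n -> R) :=
  exists u : 'rV[R]_n -> R, smooth u /\
    (forall (y : 'rV[R]_n) (m : 'rV[int]_n),
        u (y + map_mx (fun z : int => z%:~R) m) = u y) /\
    forall y, f y - intT (f \o @rv n) = u (Tlift A b y) - u y.

Definition factor_mat n (A : 'M[int]_n.+1) : 'M[int]_n :=
  \matrix_(i, j) A (widen_ord (leqnSn n) i) (widen_ord (leqnSn n) j).
Definition factor_vec n (b : 'rV[R]_n.+1) : 'rV[R]_n :=
  \row_j b 0 (widen_ord (leqnSn n) j).
Definition extend n (y : 'rV[R]_n) (t : R) : 'rV[R]_n.+1 :=
  \row_j (if unlift ord_max j is Some k then y 0 k else t).
Definition fiber_avg n (Psi : 'rV[R]_n.+1 -> R) (y : 'rV[R]_n) : R :=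
  fine (\int[lebesgue_measure]_(t in [set t : R | (0 <= t < 1)%R])
          (Psi (extend y t))%:E)%E.

Definition susp n (Psi : n.-tuple R -> R) : set (n.-tuple R * R) :=
  [set p | unit_cube p.1 /\ 0 <= p.2 /\ p.2 < Psi p.1].

Definition bsum n (A : 'M[int]_n) (b : 'rV[R]_n) (Psi : n.-tuple R -> R)
    (k : nat) (x : n.-tuple R) : R :=
  \sum_(j < k) Psi (iter j (Tcube A b) x).

(** preimage of E under the time-t map (t >= 0): T_t (x, r) = (T^k x,
    r + t - S_k Psi(x)) for the unique k with S_k <= r + t < S_{k+1}. *)
Definition flow_preimage n (A : 'M[int]_n) (b : 'rV[R]_n)
    (Psi : n.-tuple R -> R) (t : R) (E : set (n.-tuple R * R)) :=
  [set p | susp Psi p /\ exists k : nat,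
     bsum A b Psi k p.1 <= p.2 + t < bsum A b Psi k.+1 p.1 /\
     E (iter k (Tcube A b) p.1, p.2 + t - bsum A b Psi k p.1)].

Definition susp_vol n (E : set (n.-tuple R * R)) : \bar R :=
  iint (fun x => lebesgue_measure [set r : R | E (x, r)]).
Definition susp_mu n (Psi : n.-tuple R -> R) (E : set (n.-tuple R * R)) :=
  (susp_vol (E `&` susp Psi) * ((intT Psi)^-1)%:E)%E.

Definition mixing_susp n (A : 'M[int]_n) (b : 'rV[R]_n) (Psi : n.-tuple R -> R) :=
  forall E F : set (n.-tuple R * R), measurable E -> measurable F ->
    E `<=` susp Psi -> F `<=` susp Psi ->
    susp_mu Psi (flow_preimage A b Psi t E `&` F) @[t --> +oo]
      --> (susp_mu Psi E * susp_mu Psi F)%E.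

End Defs.

(* Main.v *)
Require Import Defs.
From HB Require Import structures.
From mathcomp Require Import all_boot all_order all_algebra.
From mathcomp Require Import all_classical all_reals all_analysis.
From mathcomp Require Import ring lra measurable_realfun zify.
From mathcomp Require complex.
Set Implicit Arguments. Unset Strict Implicit. Unset Printing Implicit Defensive.
Import Order.TTheory GRing.Theory Num.Theory.
Import numFieldNormedType.Exports.
Local Open Scope classical_set_scope.
Local Open Scope ring_scope.


(** Let [S_m] denote the Birkhoff sums of [Psi] and [e_d] the last basis vector;
    [T] commutes with the translations along [e_d].  On a fibre [x + s e_d], [S_m] is
    its fibre average, which is [m * intT Psi + O(1)] because [psi_{d-1}] is smoothly
    cohomologous to a constant, plus a trigonometric polynomial in [s] whose degree does
    not depend on [m].

    Since [Psi] is not cohomologous to a constant, [S_m - m * intT Psi] is unbounded in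
    measure for most [m] (otherwise Hopf's maximal inequality for the skew product on
    [X * R] produces a measurable transfer function).  This holds in fact for all large
    [m]: if [|S_m - m * intT Psi| <= C] on a set of measure at least [d], then for many
    small [j] the points [x] and [T^j x] both lie in it, so that [S_j] nearly agrees at [x]
    and at [T^m x]; translating [x] by [s w / 'C(m, k)], where [w N^k = e_d], barely moves
    [x] but moves [T^m x] by about [s e_d], so [S_j] is nearly constant on fibres,
    contradicting its growth on average.  Hence the coefficients of the trigonometric
    polynomial above tend to infinity in measure.

    The flow therefore shears vertical segments: an integration by parts in [s] shows that
    the correlation of two rectangles at a large time [t] is close to its average over a
    long window of times near [t], which is controlled by uniform equidistribution.
    Dynkin's theorem extends the conclusion from rectangles to all measurable sets. *)

(** The integration by parts has to divide by the vertical derivative of [S_k], which meets two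
    obstacles: this derivative vanishes somewhere on every fibre, and [k] varies with the point.
    Against the first, the degree on fibres being fixed, interpolation at separated points gives a
    sublevel estimate uniform in the coefficients: off a small part of the fibre the derivative is
    comparable with the size [H] of the coefficients, and a regularised inverse deals with the rest.
    Against the second, one index [m] close to [t / intT Psi] serves all [k]: since fibre averages
    deviate boundedly, the indices that matter satisfy [|k - m| = O(H)], and since the vertical
    derivative of [Psi] has mean zero, uniform equidistribution makes the derivatives of [S_k] and
    [S_m] differ by [o(H)]. So growth of [H] in measure, without any rate, is enough. Integration by
    parts also needs a kernel with compactly supported primitive. The kernel of two rectangles, an
    overlap length, is not of this kind; subtracting a wide tent of the same integral makes it so,
    and that tent is the long window of times. *)

Local Notation frac := (@Defs.frac _).

(** * Lebesgue measure on the torus *)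

Section frac.
Variable R : realType.
Implicit Types (x c : R).
Notation mu := (@lebesgue_measure R).

Lemma measurable_frac : measurable_fun [set: R] (frac : R -> R).
Proof.
apply: measurable_funB => //; apply: nondecreasing_measurable => // x y xy.
by rewrite ler_int; exact: le_floor.
Qed.

Lemma frac_ge0 x : 0 <= frac x.
Proof. by rewrite /frac subr_ge0 floor_le_tmp. Qed.

Lemma frac_lt1 x : frac x < 1.
Proof. by rewrite /frac ltrBlDl -[X in _ + X]/(1%:~R) -intrD; exact: floorD1_gt. Qed.

Lemma frac_addz x (z : int) : frac (x + z%:~R) = frac x.
Proof. by rewrite /frac floorDrz ?intr_int// intrKfloor intrD; ring. Qed.

Lemma frac_id x : 0 <= x < 1 -> frac x = x.
Proof.
by move=> x01; rewrite /frac (@floor_def _ x 0) ?add0r ?subr0.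
Qed.

Lemma fracE x : exists z : int, frac x = x + z%:~R.
Proof. by exists (- Num.floor x); rewrite mulrNz. Qed.

Lemma lebesgue_measure_shift c (B : set R) : measurable B ->
  mu B = pushforward mu (fun x => x + c) B.
Proof.
move=> mB.
have mf : measurable_fun [set: R] (fun x => x + c : R) by exact: measurable_funD.
apply: (@lebesgue_measure_unique R
  [the {measure set (measurableTypeR R) -> \bar R}
    of pushforward mu (fun x : measurableTypeR R => x + c : measurableTypeR R)]) => //= X [[a b] _ <-].
rewrite /pushforward.
have -> : (fun x => x + c) @^-1` `]a, b] = `]a - c, b - c]%classic.
  by apply/seteqP; split=> x /=; rewrite !in_itv/=; lra.
rewrite !lebesgue_measure_itv/= !lte_fin ltrD2r.
by case: ifP => // _; rewrite -!EFinB; congr EFin; ring.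
Qed.

Lemma ge0_integral_shift c (D : set R) (f : R -> \bar R) : measurable D ->
  measurable_fun D f -> (forall x, D x -> 0 <= f x)%E ->
  (\int[mu]_(x in (fun x : R => (x + c)%R) @^-1` D) f (x + c)%R = \int[mu]_(x in D) f x)%E.
Proof.
move=> mD mf f0.
have mc : measurable_fun [set: measurableTypeR R] (fun x : measurableTypeR R => x + c : measurableTypeR R).
  exact: measurable_funD.
rewrite -[LHS](ge0_integral_pushforward mc (@lebesgue_measure R) mD mf); last by move=> x /set_mem; exact: f0.
apply: eq_measure_integral => B mB _; apply/esym.
by rewrite [LHS](lebesgue_measure_shift c).
Qed.

Lemma ge0_integral_frac_shift c (f : R -> \bar R) :
  measurable_fun [set: R] f -> (forall x, 0 <= f x)%E ->
  (\int[mu]_(x in [set x | (0 <= x < 1)%R]) f (frac (x + c)) =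
   \int[mu]_(x in [set x | (0 <= x < 1)%R]) f x)%E.
Proof.
move=> mf f0.
have [z cE] : exists z : int, c = frac c + z%:~R.
  by exists (Num.floor c); rewrite /frac subrK.
set c' := frac c in cE.
have c'01 : 0 <= c' < 1 by rewrite frac_ge0 frac_lt1.
have cE' x : frac (x + c) = frac (x + c') by rewrite {1}cE addrA frac_addz.
have -> : [set x : R | (0 <= x < 1)%R] = `[0, 1[%classic by apply/seteqP; split=> x /=; rewrite in_itv.
(* The rotation exchanges the two arcs cut at [1 - c']; on each of them it is a plain
   translation. *)
have e1 : `[0, 1[%classic = `[0, 1 - c'[ `|` `[1 - c', 1[ :> set R.
  by apply/seteqP; split=> x /=; rewrite !in_itv/=; [|case]; lra.
have e2 : `[0, 1[%classic = `[c', 1[ `|` `[0, c'[ :> set R.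
  by apply/seteqP; split=> x /=; rewrite !in_itv/=; [|case]; lra.
rewrite [in RHS]e2 ge0_integral_setU//=; last 2 first.
  exact: measurable_funTS.
  by apply/disj_setPS => x /=; rewrite !in_itv/=; lra.
rewrite e1 ge0_integral_setU//=; last 2 first.
  apply: measurable_funTS; apply: measurableT_comp => //.
  by apply: measurableT_comp => //; [exact: measurable_frac|exact: measurable_funD].
  by apply/disj_setPS => x /=; rewrite !in_itv/=; lra.
congr (_ + _)%E.
  rewrite -(@ge0_integral_shift c' _ f)//; last exact: measurable_funTS.
  have -> : (fun x => x + c') @^-1` `[c', 1[ = `[0, 1 - c'[%classic.
    by apply/seteqP; split=> x /=; rewrite !in_itv/=; lra.
  apply: eq_integral => x; rewrite inE/= in_itv/= => x1.
  by rewrite cE' frac_id//; lra.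
rewrite -(@ge0_integral_shift (c' - 1) _ f)//; last exact: measurable_funTS.
have -> : (fun x => x + (c' - 1)) @^-1` `[0, c'[ = `[1 - c', 1[%classic.
  by apply/seteqP; split=> x /=; rewrite !in_itv/=; lra.
apply: eq_integral => x; rewrite inE/= in_itv/= => x1.
rewrite cE'; congr f.
rewrite -[x + c'](subrK 1%:~R) frac_addz frac_id//; first by ring.
by rewrite (_ : 1%:~R = 1)//; lra.
Qed.
End frac.

Section Lam.
Variable R : realType.

Lemma integral_uniform01 (f : R -> \bar R) : measurable_fun [set: R] f ->
  (forall x, 0 <= f x)%E ->
  (\int[uniform_prob (@ltr01 R)]_x f x =
   \int[lebesgue_measure]_(x in [set x : R | (0 <= x < 1)%R]) f x)%E.
Proof.
move=> mf f0; rewrite integral_uniform// subr0 invr1 mul1e.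
have -> : [set x : R | (0 <= x < 1)%R] = `[0, 1[%classic by apply/seteqP; split=> x /=; rewrite in_itv.
rewrite integral_itv_bndo_bndc//.
exact: measurable_funTS.
Qed.

Definition consp n (p : R * n.-tuple R) : n.+1.-tuple R := cons_tuple p.1 p.2.

Lemma measurable_consp n : measurable_fun [set: R * n.-tuple R] (@consp n).
Proof. by apply: (@measurable_cons _ _ _ _ fst n snd). Qed.

(** [iint] is only a nested integral. A probability behind it, built coordinate by coordinate as the
    image of a product measure under [consp], gives access to Fubini, dominated convergence and
    continuity of measures. *)
Lemma Lam_exists n : exists P : probability (n.-tuple R) R,
  forall f : n.-tuple R -> \bar R, measurable_fun [set: n.-tuple R] f ->
    (forall x, 0 <= f x)%E -> iint f = (\int[P]_x f x)%E.
Proof.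
elim: n => [|n [P IH]].
  exists (\d_([tuple] : 0.-tuple R)) => f mf f0 /=.
  by rewrite integral_dirac//= diracT mul1e.
have mc : measurable_fun [set: measurableTypeR R * n.-tuple R] (@consp n).
  exact: (@measurable_consp n).
pose nu' : {measure set (n.+1.-tuple R) -> \bar R} := pushforward (uniform_prob (@ltr01 R) \x P)%E (@consp n).
pose nu := nu' mc.
have nuT : nu setT = 1%E.
  rewrite /nu /nu' /= /pushforward preimage_setT -setXTT product_measure1E//.
  transitivity (uniform_prob (@ltr01 R) setT * P setT)%E; first by [].
  by rewrite !probability_setT mule1.
pose nuP : probability (n.+1.-tuple R) R := HB.pack (nu : set _ -> _) (Measure.on nu) (Measure_isProbability.Build _ _ _ nu nuT).
exists nuP => f mf f0.
have mfc : measurable_fun [set: R * n.-tuple R] (f \o @consp n).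
  by apply: measurableT_comp => //; exact: measurable_consp.
rewrite [RHS](ge0_integral_pushforward mc (uniform_prob (@ltr01 R) \x P)%E measurableT mf)//.
rewrite preimage_setT fubini_tonelli1//; last by move=> x /=; exact: f0.
rewrite integral_uniform01; last 2 first.
- by apply: measurable_fun_fubini_tonelli_F => // x /=; exact: f0.
- by move=> x; apply: integral_ge0 => y _ /=; exact: f0.
rewrite [LHS]/=; apply: eq_integral => x _; rewrite IH//.
by apply: (@measurable_fun_pair2 _ _ _ R _ _ (f \o @consp n) x).
Qed.

Definition Lam n : probability (n.-tuple R) R := projT1 (cid (Lam_exists n)).

Lemma iintE n (f : n.-tuple R -> \bar R) : measurable_fun [set: n.-tuple R] f ->
  (forall x, 0 <= f x)%E -> iint f = (\int[Lam n]_x f x)%E.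
Proof. by rewrite /Lam; case: cid => P /= H; exact: H. Qed.

Lemma measurable_iint n (f : R * n.-tuple R -> \bar R) :
  measurable_fun [set: R * n.-tuple R] f -> (forall x, 0 <= f x)%E ->
  measurable_fun [set: R] (fun x => iint (fun t => f (x, t))).
Proof.
move=> mf f0.
rewrite (_ : (fun x => _) = fubini_F (Lam n) f); first exact: measurable_fun_fubini_tonelli_F.
apply/funext => x; rewrite iintE//.
exact: measurable_fun_pair2.
Qed.

Lemma Tcube_tnth n (A : 'M[int]_n) (b : 'rV[R]_n) (t : n.-tuple R) i :
  tnth (Tcube A b t) i = frac (\sum_k tnth t k * (A k i)%:~R + b 0 i).
Proof.
rewrite /Tcube /fracT tnth_map tnth_mktuple /Tlift !mxE; congr (frac (_ + _)).
by apply: eq_bigr => k _; rewrite !mxE.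
Qed.

Lemma measurable_Tcube n (A : 'M[int]_n) (b : 'rV[R]_n) :
  measurable_fun [set: n.-tuple R] (Tcube A b).
Proof.
apply/measurable_fun_tnthP => i.
rewrite (_ : _ \o _ = frac \o (fun t : n.-tuple R => \sum_k tnth t k * (A k i)%:~R + b 0 i)); last first.
  by apply/funext => t /=; rewrite Tcube_tnth.
apply: measurableT_comp; first exact: measurable_frac.
apply: measurable_funD => //; apply: measurable_sum => k.
by apply: measurable_funM => //; exact: measurable_tnth.
Qed.

(** By triangularity the first coordinate undergoes a rotation, and for each value of it the others
    undergo a unipotent affine map whose translation part depends on that value; hence an induction
    on the dimension. *)
Lemma iint_Tcube n (A : 'M[int]_n) (b : 'rV[R]_n) (f : n.-tuple R -> \bar R) :
  upper_unipotent A -> measurable_fun [set: n.-tuple R] f ->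
  (forall x, 0 <= f x)%E -> iint (f \o Tcube A b) = iint f.
Proof.
elim: n A b f => [|n IH] A b f [Au A1] mf f0.
  by rewrite /= [X in f X]tuple0.
pose A' : 'M[int]_n := \matrix_(i, j) A (lift ord0 i) (lift ord0 j).
pose b' (x : R) : 'rV[R]_n := \row_j (x * (A 0 (lift ord0 j))%:~R + b 0 (lift ord0 j)).
have A'u : upper_unipotent A'.
  by split=> [i j ij|i]; rewrite mxE ?A1// Au.
have TE x (t : n.-tuple R) : Tcube A b (cons_tuple x t) = cons_tuple (frac (x + b 0 0)) (Tcube A' (b' x) t).
  apply: eq_from_tnth => i; rewrite Tcube_tnth big_ord_recl tnth0.
  have [->|i0] := eqVneq i ord0.
    rewrite tnth0 A1 mulr1 big1 ?addr0// => k _.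
    by rewrite Au// mulr0.
  have [j ->] : exists j, i = lift ord0 j.
    by case: (unliftP ord0 i) i0 => [j -> _|->]; [exists j|rewrite eqxx].
  rewrite tnthS Tcube_tnth; congr frac; rewrite /b' !mxE addrCA !addrA; congr (_ + _).
  congr (_ + _).
  by apply: eq_bigr => k _; rewrite tnthS mxE.
have mfc : measurable_fun [set: R * n.-tuple R] (f \o @consp n).
  by apply: measurableT_comp => //; exact: measurable_consp.
have mfx x : measurable_fun [set: n.-tuple R] (fun t : n.-tuple R => f (cons_tuple x t)).
  by apply: (@measurable_fun_pair2 _ _ _ R _ _ (f \o @consp n) x).
pose g x := iint (fun t : n.-tuple R => f (cons_tuple x t)).
rewrite [RHS]/= [LHS]/=.
transitivity (\int[lebesgue_measure]_(x in [set x : R | (0 <= x < 1)%R]) g (frac (x + b ord0 ord0)%R))%E.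
  apply: eq_integral => x _.
  rewrite /g -(IH A' (b' x) (fun t => f (cons_tuple (frac (x + b ord0 ord0)%R) t)))//.
  by congr iint; apply/funext => t /=; rewrite TE.
rewrite ge0_integral_frac_shift//.
- by apply: (@measurable_iint n (f \o @consp n)) => // x /=; exact: f0.
- by move=> x; rewrite /g iintE//; apply: integral_ge0.
Qed.

Lemma integral_Tcube n (A : 'M[int]_n) (b : 'rV[R]_n) (f : n.-tuple R -> \bar R) :
  upper_unipotent A -> measurable_fun [set: n.-tuple R] f ->
  (forall x, 0 <= f x)%E ->
  (\int[Lam n]_x f (Tcube A b x) = \int[Lam n]_x f x)%E.
Proof.
move=> Au mf f0; rewrite -!iintE//; first exact: (iint_Tcube b Au mf).
by apply: measurableT_comp => //; exact: measurable_Tcube.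
Qed.

Lemma measurable_unit_cube n : measurable (@unit_cube R n).
Proof.
rewrite (_ : unit_cube (n:=n) = \bigcap_(i in [set: 'I_n]) ((fun t : n.-tuple R => tnth t i) @^-1` `[0, 1[)).
  apply: fin_bigcap_measurable => // i _.
  by rewrite -[X in measurable X]setTI; apply: measurable_tnth.
apply/seteqP; split=> t /= H i; [move=> _|]; move: (H i); rewrite /= in_itv/=.
  by move=> /andP.
by move=> /(_ I)/andP.
Qed.

Lemma unit_cube_Tcube n (A : 'M[int]_n) (b : 'rV[R]_n) (t : n.-tuple R) :
  unit_cube (Tcube A b t).
Proof. by move=> i; rewrite Tcube_tnth frac_ge0 frac_lt1. Qed.

Lemma upper_unipotent1 n : upper_unipotent (1%:M : 'M[int]_n).
Proof.
split=> [i j ij|i]; rewrite !mxE ?eqxx//.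
by case: eqP ij => // ->; rewrite ltnn.
Qed.

(** Reduction modulo one is the measure-preserving map with identity matrix and zero translation,
    and it sends every point into the cube. *)
Lemma Lam_unit_cube n : Lam n (@unit_cube R n) = 1%E.
Proof.
have mU := @measurable_unit_cube n.
rewrite -(setIT (@unit_cube R n)) -integral_indic//.
have <- : (\int[Lam n]_x (\1_(@unit_cube R n) (Tcube 1%:M 0 x))%:E = \int[Lam n]_x (\1_(@unit_cube R n) x)%:E)%E.
  apply: (integral_Tcube _ (@upper_unipotent1 n) (f := fun x => (\1_(@unit_cube R n) x)%:E)) => //.
  by apply/measurable_EFinP; exact: measurable_indic.
under eq_integral do rewrite indicE (mem_set (@unit_cube_Tcube _ _ _ _)).
by rewrite integral_cst// mul1e; exact: probability_setT.
Qed.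

Lemma Lam_unit_cubeC n : Lam n (~` @unit_cube R n) = 0%E.
Proof. by rewrite probability_setC ?Lam_unit_cube ?subee//; exact: measurable_unit_cube. Qed.
End Lam.

(** * Expectations of bounded measurable functions *)

Section bounded_measurable.
Context d (T : measurableType d) (R : realType).
Implicit Types (f g : T -> R).

(** A class stable under the operations used later and integrable for every probability: real
    expectations [Ex] can then be computed with no separate integrability or finiteness
    conditions. *)
Definition bm f := measurable_fun [set: T] f /\ exists M, forall x, `|f x| <= M.

Lemma bm_cst r : bm (fun=> r).
Proof. by split => //; exists `|r|. Qed.

Lemma bmD f g : bm f -> bm g -> bm (fun x => f x + g x).
Proof.
move=> [mf [M fM]] [mg [N gN]]; split; first exact: measurable_funD.
by exists (M + N) => x; rewrite (le_trans (ler_normD _ _))// lerD.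
Qed.

Lemma bmM f g : bm f -> bm g -> bm (fun x => f x * g x).
Proof.
move=> [mf [M fM]] [mg [N gN]]; split; first exact: measurable_funM.
by exists (M * N) => x; rewrite normrM ler_pM.
Qed.

Lemma bmN f : bm f -> bm (fun x => - f x).
Proof.
move=> [mf [M fM]]; split; first exact: measurableT_comp.
by exists M => x; rewrite normrN.
Qed.

Lemma bmB f g : bm f -> bm g -> bm (fun x => f x - g x).
Proof. by move=> bf bg; apply: bmD => //; exact: bmN. Qed.

Lemma bmZ r f : bm f -> bm (fun x => r * f x).
Proof. by move=> bf; apply: bmM => //; exact: bm_cst. Qed.

Lemma bm_abs f : bm f -> bm (fun x => `|f x|).
Proof.
move=> [mf [M fM]]; split; first exact: measurableT_comp.
by exists M => x; rewrite normr_id.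
Qed.

Lemma bm_sum (I : Type) (s : seq I) (F : I -> T -> R) : (forall i, bm (F i)) ->
  bm (fun x => \sum_(i <- s) F i x).
Proof.
move=> bF; elim: s => [|i s IH].
  by under eq_fun do rewrite big_nil; exact: bm_cst.
by under eq_fun do rewrite big_cons; exact: bmD.
Qed.

Lemma bm_indic (A : set T) : measurable A -> bm (\1_A : T -> R).
Proof.
move=> mA; split; first exact: measurable_indic.
by exists 1 => x; rewrite indicE; case: (_ \in _); rewrite ?normr1 ?normr0.
Qed.

Lemma bm_measurable f : bm f -> measurable_fun [set: T] f. Proof. by case. Qed.

End bounded_measurable.

Lemma bm_comp d d' (T : measurableType d) (T' : measurableType d') (R : realType)
  (h : T' -> T) (f : T -> R) : measurable_fun [set: T'] h -> bm f -> bm (f \o h).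
Proof.
move=> mh [mf [M fM]]; split; first exact: measurableT_comp.
by exists M => x; exact: fM.
Qed.

Section expectation.
Context d (T : measurableType d) (R : realType) (P : probability T R).
Implicit Types (f g : T -> R).

Definition Ex f : R := (\int[P]_x f x)%R.

Lemma bm_integrable f : bm f -> P.-integrable setT (EFin \o f).
Proof.
move=> [mf [M fM]]; apply: measurable_bounded_integrable => //.
  by rewrite [X in (X < _)%E]probability_setT ltry.
by exists M; split; [rewrite num_real|move=> N MN x _ /=; rewrite (le_trans (fM x)) ?ltW].
Qed.

Lemma ExE f : bm f -> (Ex f)%:E = (\int[P]_x (f x)%:E)%E.
Proof. by move=> bf; rewrite fineK//; apply: integrable_fin_num => //; exact: bm_integrable. Qed.

Lemma Ex_cst r : Ex (fun=> r) = r.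
Proof.
rewrite /Ex /Rintegral integral_cst//.
by rewrite [X in (_ * X)%E](probability_setT P) mule1.
Qed.

Lemma ExD f g : bm f -> bm g -> Ex (fun x => f x + g x) = Ex f + Ex g.
Proof. by move=> bf bg; rewrite /Ex RintegralD//; exact: bm_integrable. Qed.

Lemma ExB f g : bm f -> bm g -> Ex (fun x => f x - g x) = Ex f - Ex g.
Proof. by move=> bf bg; rewrite /Ex RintegralB//; exact: bm_integrable. Qed.

Lemma ExZ r f : bm f -> Ex (fun x => r * f x) = r * Ex f.
Proof. by move=> bf; rewrite /Ex RintegralZl//; exact: bm_integrable. Qed.

Lemma Ex_sum (I : Type) (s : seq I) (F : I -> T -> R) : (forall i, bm (F i)) ->
  Ex (fun x => \sum_(i <- s) F i x) = \sum_(i <- s) Ex (F i).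
Proof.
move=> bF; elim: s => [|i s IH].
  by under eq_fun do rewrite big_nil; rewrite big_nil Ex_cst.
under eq_fun do rewrite big_cons; rewrite big_cons ExD// ?IH//.
exact: bm_sum.
Qed.

Lemma Ex_le f g : bm f -> bm g -> (forall x, f x <= g x) -> Ex f <= Ex g.
Proof. by move=> bf bg fg; apply: le_Rintegral => //; exact: bm_integrable. Qed.

Lemma Ex_ge0 f : (forall x, 0 <= f x) -> 0 <= Ex f.
Proof. by move=> f0; apply: Rintegral_ge0 => x _; exact: f0. Qed.

Lemma Ex_abs f : bm f -> `|Ex f| <= Ex (fun x => `|f x|).
Proof. by move=> bf; apply: le_normr_Rintegral => //; exact: bm_integrable. Qed.

Lemma Ex_indic A : measurable A -> Ex (\1_A : T -> R) = fine (P A).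
Proof. by move=> mA; rewrite /Ex /Rintegral integral_indic// setIT. Qed.

Lemma Ex_le_cst f M : bm f -> (forall x, f x <= M) -> Ex f <= M.
Proof. by move=> bf fM; rewrite -(Ex_cst M); apply: Ex_le => //; exact: bm_cst. Qed.

Lemma Ex_norm_le f M : bm f -> (forall x, `|f x| <= M) -> `|Ex f| <= M.
Proof.
move=> bf fM; apply: le_trans (Ex_abs bf) _.
by apply: Ex_le_cst => //; exact: bm_abs.
Qed.

End expectation.

Section Fubini.
Context d d' (T : measurableType d) (T' : measurableType d') (R : realType).
Variables (P : probability T R) (Q : probability T' R).

Lemma bm_pair (f : T * T' -> R) : bm f -> forall x, bm (fun y => f (x, y)).
Proof.
move=> [mf [M fM]] x; split; first exact: measurable_fun_pair2.
by exists M => y.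
Qed.

Lemma bm_pair' (f : T * T' -> R) : bm f -> forall y, bm (fun x => f (x, y)).
Proof.
move=> [mf [M fM]] x; split; first exact: measurable_fun_pair1.
by exists M => y.
Qed.

Lemma prod_integrable (f : T * T' -> R) : bm f -> (P \x Q)%E.-integrable setT (EFin \o f).
Proof.
move=> [mf [M fM]]; apply: measurable_bounded_integrable => //.
  rewrite (_ : [set: _] = [set: T] `*` [set: T']); last by rewrite setXTT.
  rewrite [X in (X < _)%E](product_measure1E P Q measurableT measurableT).
  by rewrite [X in (X * _ < _)%E](probability_setT P) [X in (_ * X < _)%E](probability_setT Q) mule1 ltry.
by exists M; split; [rewrite num_real|move=> N MN x _ /=; rewrite (le_trans (fM x)) ?ltW].
Qed.

Lemma bm_Ex (f : T * T' -> R) : bm f -> bm (fun x => Ex Q (fun y => f (x, y))).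
Proof.
move=> bf; split; last first.
  have [_ [M fM]] := bf; exists M => x.
  by apply: Ex_norm_le => //; exact: bm_pair.
have mF := measurable_fubini_F (prod_integrable bf).
apply/measurable_EFinP; apply: eq_measurable_fun mF => x _.
by rewrite /= ExE//; exact: bm_pair.
Qed.

Lemma bm_Ex' (f : T * T' -> R) : bm f -> bm (fun y => Ex P (fun x => f (x, y))).
Proof.
move=> bf; split; last first.
  have [_ [M fM]] := bf; exists M => x.
  by apply: Ex_norm_le => //; exact: (bm_pair' bf).
have mF := measurable_fubini_G (prod_integrable bf).
apply/measurable_EFinP; apply: eq_measurable_fun mF => x _.
by rewrite /= ExE//; exact: (bm_pair' bf).
Qed.

Lemma Ex_Fubini (f : T * T' -> R) : bm f ->
  Ex P (fun x => Ex Q (fun y => f (x, y))) = Ex Q (fun y => Ex P (fun x => f (x, y))).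
Proof.
move=> bf; apply: EFin_inj; rewrite !ExE; [|exact: bm_Ex'|exact: bm_Ex].
under eq_integral => x _ do rewrite (ExE Q (bm_pair bf x)).
under [RHS]eq_integral => y _ do rewrite (ExE P (bm_pair' bf y)).
exact: (Fubini (prod_integrable bf)).
Qed.
End Fubini.

(** * Weyl sums *)

Section trigo1.
Variable R : realType.
Implicit Types (x y : R).

Definition costau x : R := cos (2 * pi * x).
Definition sintau x : R := sin (2 * pi * x).

Lemma costauD x y : costau (x + y) = costau x * costau y - sintau x * sintau y.
Proof. by rewrite /costau mulrDr cosD. Qed.
Lemma costauB x y : costau (x - y) = costau x * costau y + sintau x * sintau y.
Proof. by rewrite /costau mulrBr cosB. Qed.
Lemma sintauD x y : sintau (x + y) = sintau x * costau y + costau x * sintau y.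
Proof. by rewrite /sintau mulrDr sinD. Qed.
Lemma costauN x : costau (- x) = costau x.
Proof. by rewrite /costau mulrN cosN. Qed.
Lemma sintauN x : sintau (- x) = - sintau x.
Proof. by rewrite /sintau mulrN sinN. Qed.
Lemma costau0 : costau 0 = 1.
Proof. by rewrite /costau mulr0 cos0. Qed.
Lemma sintau0 : sintau 0 = 0.
Proof. by rewrite /sintau mulr0 sin0. Qed.
Lemma costau1 : costau 1 = 1.
Proof. by rewrite /costau mulr1 mulrC mulr_natr cos2pi. Qed.
Lemma sintau1 : sintau 1 = 0.
Proof. by rewrite /sintau mulr1 mulrC mulr_natr sin2pi. Qed.

Lemma cos_sintau_nat (n : nat) : (costau n%:R = 1) /\ (sintau n%:R = 0).
Proof.
elim: n => [|n [IHc IHs]]; first by rewrite costau0 sintau0.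
by rewrite -natr1 costauD sintauD IHc IHs costau1 sintau1; split; ring.
Qed.

Lemma costau_int (z : int) : costau z%:~R = 1.
Proof.
case: z => n; first by rewrite -pmulrn (cos_sintau_nat n).1.
by rewrite NegzE mulrNz costauN -pmulrn (cos_sintau_nat _).1.
Qed.

Lemma sintau_int (z : int) : sintau z%:~R = 0.
Proof.
case: z => n; first by rewrite -pmulrn (cos_sintau_nat n).2.
by rewrite NegzE mulrNz sintauN -pmulrn (cos_sintau_nat _).2 oppr0.
Qed.

Lemma costauDz x (z : int) : costau (x + z%:~R) = costau x.
Proof. by rewrite costauD costau_int sintau_int; ring. Qed.

Lemma sintauDz x (z : int) : sintau (x + z%:~R) = sintau x.
Proof. by rewrite sintauD costau_int sintau_int; ring. Qed.

Lemma costau_le1 x : `|costau x| <= 1.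
Proof. exact: cos_max. Qed.

Lemma sintau_le1 x : `|sintau x| <= 1.
Proof. exact: sin_max. Qed.

Lemma costau2Dsintau2 x : costau x ^+ 2 + sintau x ^+ 2 = 1.
Proof. exact: cos2Dsin2. Qed.

Lemma sin_pi_neq0 x : (forall z : int, x != z%:~R) -> sin (pi * x) != 0.
Proof.
move=> xz; set f := frac x.
have f0 : 0 < f by rewrite lt_neqAle frac_ge0 andbT eq_sym /f subr_eq0; exact: xz.
have f1 : f < 1 := frac_lt1 x.
have [z zE] := fracE x.
have p0 := pi_gt0 R.
have sf : 0 < sin (pi * f).
  apply: sin_gt0_pi; rewrite mulr_gt0//= -[X in _ < X]mulr1 ltr_pM2l//.
have E : costau f = costau x by rewrite /f zE costauDz.
have dbl y : costau y = 1 - 2 * sin (pi * y) ^+ 2.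
  have -> : costau y = cos (pi * y + pi * y) by rewrite /costau; congr cos; ring.
  by rewrite cosD; have := cos2Dsin2 (pi * y); nra.
apply/negP => /eqP s0; move: E; rewrite !dbl s0; nra.
Qed.

End trigo1.

Section Weyl.
Variable R : realType.
Implicit Types (Q : nat -> R) (b : R).

Definition fdiff Q j : R := Q j.+1 - Q j.

Lemma fdiff_iter_shift D Q h j : iter D fdiff (fun j => Q (j + h)%N) j = iter D fdiff Q (j + h)%N.
Proof. by elim: D j => // D IH j; rewrite !iterS /fdiff !IH. Qed.

Lemma fdiff_iterB D Q Q' j :
  iter D fdiff (fun j => Q j - Q' j) j = iter D fdiff Q j - iter D fdiff Q' j.
Proof. by elim: D j => // D IH j; rewrite !iterS /fdiff !IH; ring. Qed.

Lemma fdiff_iter_eq D Q Q' : Q =1 Q' -> iter D fdiff Q =1 iter D fdiff Q'.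
Proof. by move=> QQ; elim: D => // D IH j; rewrite !iterS /fdiff !IH. Qed.

Lemma fdiff_cst Q b : (forall j, fdiff Q j = b) -> forall j, Q j = Q 0%N + j%:R * b.
Proof.
move=> H; elim=> [|j IH]; first by rewrite mul0r addr0.
by rewrite -[Q j.+1](subrK (Q j)) -/(fdiff Q j) H IH -natr1; ring.
Qed.

(* Telescoping: [2 sin (pi b) cos (2 pi (a + j b))] is a difference of consecutive sines *)
Lemma sum_cos_arith (a b : R) l :
  2 * sin (pi * b) * (\sum_(j < l) costau (a + j%:R * b)) =
  sin (2 * pi * (a + l%:R * b) - pi * b) - sin (2 * pi * a - pi * b).
Proof.
elim: l => [|l IH]; first by rewrite big_ord0 mul0r addr0; ring.
rewrite big_ord_recr/= mulrDr IH.
have -> : 2 * pi * (a + l.+1%:R * b) - pi * b = 2 * pi * (a + l%:R * b) + pi * b.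
  by rewrite -natr1; ring.
rewrite [sin (2 * pi * (a + l%:R * b) - pi * b)]sinB [sin (2 * pi * (a + l%:R * b) + pi * b)]sinD /costau; ring.
Qed.

(** The constant depends on [b] alone. As [Q] will be a phase along an orbit, this is the source of
    the uniformity in the starting point. *)
Lemma weyl_base b : (forall z : int, b != z%:~R) ->
  exists C, forall Q, (forall j, fdiff Q j = b) -> forall l,
    `|\sum_(j < l) costau (Q j)| <= C.
Proof.
move=> bz; have s0 := sin_pi_neq0 bz.
exists `|sin (pi * b)|^-1 => Q HQ l.
have := sum_cos_arith (Q 0%N) b l.
under eq_bigr => j _ do rewrite -(fdiff_cst HQ).
move=> /(congr1 Num.norm); rewrite !normrM (ger0_norm (x := 2))// => E.
have : 2 * `|sin (pi * b)| * `|\sum_(j < l) costau (Q j)| <= 2.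
  rewrite E (le_trans (ler_normB _ _))// (_ : 2 = 1 + 1)// lerD//; exact: sin_max.
rewrite -mulrA -[X in _ <= X]mulr1 ler_pM2l// mulrC -ler_pdivlMr ?normr_gt0//.
by rewrite mul1r.
Qed.

Lemma sqr_sum_le (l : nat) (F : nat -> R) :
  (\sum_(j < l) F j) ^+ 2 <= l%:R * \sum_(j < l) F j ^+ 2.
Proof.
elim: l => [|l IH]; first by rewrite !big_ord0 expr2 !mul0r.
rewrite !big_ord_recr/= -natr1.
set s := \sum_(i < l) F i in IH *; set q := \sum_(i < l) F i ^+ 2 in IH *.
have q0 : 0 <= q by apply: sumr_ge0 => i _; exact: sqr_ge0.
case: l @s @q IH q0 => [|l] s q IH q0.
  by rewrite /s /q !big_ord0 !add0r mul1r.
have l0 : 0 < l.+1%:R :> R by rewrite ltr0n.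
have : 0 <= (s - l.+1%:R * F l.+1) ^+ 2 by exact: sqr_ge0.
rewrite sqrrB => H.
have H2 : 2 * s * F l.+1 * l.+1%:R <= s ^+ 2 + (l.+1%:R * F l.+1) ^+ 2 by lra.
have H3 : 2 * s * F l.+1 <= q + l.+1%:R * F l.+1 ^+ 2.
  rewrite -(ler_pM2r l0); apply: le_trans H2 _.
  rewrite mulrDl [q * _]mulrC exprMn; have -> : l.+1%:R * F l.+1 ^+ 2 * l.+1%:R = l.+1%:R ^+ 2 * F l.+1 ^+ 2 by ring.
  by rewrite lerD2r.
rewrite sqrrD; lra.
Qed.

Lemma sum_shift_le (F : nat -> R) l h : (forall j, `|F j| <= 1) ->
  `|\sum_(j < l) F (j + h)%N - \sum_(j < l) F j| <= 2 * h%:R.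
Proof.
move=> F1; elim: h => [|h IH].
  by under eq_bigr => j _ do rewrite addn0; rewrite subrr normr0 mulr0.
have E : \sum_(j < l) F (j + h.+1)%N = \sum_(j < l) F (j + h)%N + F (l + h)%N - F h.
  have -> : \sum_(j < l) F (j + h)%N + F (l + h)%N = \sum_(j < l.+1) F (j + h)%N by rewrite big_ord_recr.
  by rewrite big_ord_recl/= add0n addrC addKr; apply: eq_bigr => j _; rewrite /bump/= add1n addSnnS.
rewrite E -natr1.
have -> : \sum_(j < l) F (j + h)%N + F (l + h)%N - F h - \sum_(j < l) F j =
  (\sum_(j < l) F (j + h)%N - \sum_(j < l) F j) + (F (l + h)%N - F h) by ring.
have := ler_normD (\sum_(j < l) F (j + h)%N - \sum_(j < l) F j) (F (l + h)%N - F h).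
have := ler_normB (F (l + h)%N) (F h); have := F1 (l + h)%N; have := F1 h; lra.
Qed.

(** Van der Corput's method: after averaging over [H] shifts and Cauchy-Schwarz, the off-diagonal
    phases [Q (j + h) - Q (j + h')] have order one less and leading difference [(h - h') b], which
    inherits the irrationality of [b]. *)
Lemma weyl D b : (forall q z : int, q != 0 -> q%:~R * b != z%:~R) ->
  forall e, 0 < e -> exists C, forall Q, (forall j, iter D.+1 fdiff Q j = b) ->
  forall l, `|\sum_(j < l) costau (Q j)| <= e * l%:R + C.
Proof.
elim: D b => [|D IH] b irr e e0.
  have [|C HC] := @weyl_base b.
    by move=> z; rewrite -[b]mul1r -[1]/(1%:~R); exact: irr.
  by exists C => Q HQ l; rewrite (le_trans (HC Q HQ l))// lerDr mulr_ge0// ltW.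
(* The diagonal terms contribute a proportion [1 / H], made at most [e ^+ 2 / 2]; the off-diagonal
   terms get the other half. *)
pose H := (Num.truncn (2 / e ^+ 2)).+1.
have H0 : 0 < H%:R :> R by rewrite ltr0n.
have He : H%:R^-1 <= e ^+ 2 / 2.
  rewrite -[e ^+ 2 / 2]invrK lef_pV2 ?posrE ?invr_gt0 ?divr_gt0 ?exprn_gt0//.
  by rewrite invf_div ltW// truncnS_gt.
(* There are finitely many pairs of shifts, so one constant serves them all. *)
have [C HC] : exists C, forall (h h' : 'I_H) Q, h != h' -> (forall j, iter D.+2 fdiff Q j = b) ->
    forall l, `|\sum_(j < l) costau (Q (j + h)%N - Q (j + h')%N)| <= e ^+ 2 / 2 * l%:R + C.
  have /choice [c Hc] : forall p : 'I_H * 'I_H, exists C, p.1 != p.2 -> forall Q, (forall j, iter D.+2 fdiff Q j = b) ->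
    forall l, `|\sum_(j < l) costau (Q (j + p.1)%N - Q (j + p.2)%N)| <= e ^+ 2 / 2 * l%:R + C.
    move=> [h h'] /=; have [->|hh] := eqVneq h h'; first by exists 0.
    have [||C HC] := IH ((h%:Z - h'%:Z)%:~R * b) _ (e ^+ 2 / 2).
    - move=> q z q0; rewrite mulrA -intrM; apply: irr.
      by rewrite mulf_neq0// subr_eq0; apply: contra hh => /eqP[/val_inj->].
    - by rewrite divr_gt0 ?exprn_gt0.
    exists C => _ Q HQ l; apply: (HC (fun j => Q (j + h)%N - Q (j + h')%N)) => j.
    rewrite fdiff_iterB !fdiff_iter_shift.
    have E := @fdiff_cst (iter D.+1 fdiff Q) b HQ.
    by rewrite (E (j + h)%N) (E (j + h')%N) intrB !natrD -!pmulrn; ring.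
  exists (\sum_p `|c p|) => h h' Q hh HQ l.
  apply: le_trans (Hc (h, h') hh Q HQ l) _.
  rewrite lerD2l (bigD1 (h, h'))//= (le_trans (ler_norm _))// lerDl.
  by apply: sumr_ge0.
have C0 : 0 <= `|C| by [].
(* Completes the square: [2 * (e * l) * K] is the linear term [|C| * l]. *)
pose K := `|C| / (2 * e).
exists (K + 2 * H%:R) => Q HQ l.
set X := \sum_(j < l) costau (Q j).
pose Y := \sum_(j < l) \sum_(h < H) costau (Q (j + h)%N).
have XY : `|H%:R * X - Y| <= 2 * H%:R * H%:R.
  have -> : H%:R * X - Y = \sum_(h < H) (X - \sum_(j < l) costau (Q (j + h)%N)).
    rewrite sumrB sumr_const card_ord mulr_natl; congr (_ - _).
    by rewrite /Y exchange_big.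
  apply: le_trans (ler_norm_sum _ _ _) _.
  have -> : 2 * H%:R * H%:R = \sum_(h < H) (2 * H%:R : R) by rewrite sumr_const card_ord mulr_natr.
  apply: ler_sum => h _; rewrite distrC.
  apply: le_trans (sum_shift_le (F := fun j => costau (Q j)) l h _) _ => [j|]; first exact: costau_le1.
  by rewrite ler_pM2l// ler_nat ltnW.
have Y2 : Y ^+ 2 <= (H%:R * (e * l%:R + K)) ^+ 2.
  apply: le_trans (@sqr_sum_le l (fun j => \sum_(h < H) costau (Q (j + h)%N))) _.
  (* Adding the square of the sine sum gives the squared modulus of an exponential sum, which
     expands into cosines of differences. *)
  have S1 j : (\sum_(h < H) costau (Q (j + h)%N)) ^+ 2 <=
      \sum_(h < H) \sum_(h' < H) costau (Q (j + h)%N - Q (j + h')%N).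
    rewrite -[X in X <= _]addr0.
    have := sqr_ge0 (\sum_(h < H) sintau (Q (j + h)%N)) => /(lerD (lexx ((\sum_(h < H) costau (Q (j + h)%N)) ^+ 2))).
    move=> /le_trans; apply.
    rewrite !expr2 !mulr_suml -big_split/=; apply: ler_sum => h _.
    rewrite !mulr_sumr -big_split/=; apply: ler_sum => h' _.
    by rewrite costauB.
  have S2 : \sum_(j < l) (\sum_(h < H) costau (Q (j + h)%N)) ^+ 2 <=
      H%:R * l%:R + H%:R ^+ 2 * (e ^+ 2 / 2 * l%:R + `|C|).
    apply: (@le_trans _ _ (\sum_(j < l) \sum_(h < H) \sum_(h' < H) costau (Q (j + h)%N - Q (j + h')%N))).
      by apply: ler_sum => j _; exact: S1.
    rewrite exchange_big/=; under eq_bigr => h _ do rewrite exchange_big/=.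
    have T1 (h h' : 'I_H) : \sum_(j < l) costau (Q (j + h)%N - Q (j + h')%N) <=
       (h == h')%:R * l%:R + (e ^+ 2 / 2 * l%:R + `|C|).
      have [->|hh] := eqVneq h h'.
        rewrite mul1r; under eq_bigr => j _ do rewrite subrr costau0.
        rewrite sumr_const card_ord lerDl addr_ge0// mulr_ge0// divr_ge0// sqr_ge0//.
      rewrite mul0r add0r (le_trans (ler_norm _))// (le_trans (HC _ _ _ hh HQ l))// lerD2l.
      exact: ler_norm.
    apply: (@le_trans _ _ (\sum_(h < H) \sum_(h' < H) ((h == h')%:R * l%:R + (e ^+ 2 / 2 * l%:R + `|C|)))).
      by apply: ler_sum => h _; apply: ler_sum => h' _; exact: T1.
    have R1 (h : 'I_H) (c : R) : \sum_(h' < H) ((h == h')%:R * l%:R + c) = l%:R + c * H%:R.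
      rewrite big_split/= sumr_const card_ord mulr_natr; congr (_ + _).
      rewrite (bigD1 h)//= eqxx mul1r big1 ?addr0// => i /negbTE ih.
      by rewrite eq_sym ih mul0r.
    under eq_bigr => h _ do rewrite R1.
    rewrite sumr_const card_ord -mulr_natl expr2; lra.
  apply: le_trans (ler_wpM2l (ler0n _ l) S2) _.
  rewrite exprMn.
  have -> : l%:R * (H%:R * l%:R + H%:R ^+ 2 * (e ^+ 2 / 2 * l%:R + `|C|)) =
    H%:R ^+ 2 * (H%:R^-1 * l%:R ^+ 2 + e ^+ 2 / 2 * l%:R ^+ 2 + `|C| * l%:R).
    by field; rewrite gt_eqF.
  rewrite ler_pM2l ?exprn_gt0// sqrrD.
  have -> : e * l%:R * K *+ 2 = `|C| * l%:R by rewrite /K; field; rewrite gt_eqF.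
  rewrite exprMn -addrA -lerBrDr.
  have := ler_wpM2r (sqr_ge0 (l%:R : R)) He; have := sqr_ge0 K; lra.
have HK : 0 <= H%:R * (e * l%:R + K).
  have e0' := ltW e0; apply: mulr_ge0 => //; apply: addr_ge0; first exact: mulr_ge0.
  by apply: divr_ge0 => //; exact: mulr_ge0.
have YH : `|Y| <= H%:R * (e * l%:R + K).
  by rewrite -(ger0_norm HK) -ler_sqr ?nnegrE// !real_normK ?num_real.
have : `|H%:R * X| <= H%:R * (e * l%:R + (K + 2 * H%:R)).
  rewrite -[H%:R * X](subrK Y) (le_trans (ler_normD _ _))//; lra.
by rewrite normrM (ger0_norm (ltW H0)) ler_pM2l.
Qed.

End Weyl.

(** * Trigonometric polynomials *)

Section measurable_trigo.
Variable R : realType.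
Lemma measurable_costau : measurable_fun [set: R] (@costau R).
Proof.
apply: (@measurableT_comp _ _ _ _ _ _ (@cos R)); last exact: measurable_funM.
by apply: continuous_measurable_fun => x; exact: continuous_cos.
Qed.
Lemma measurable_sintau : measurable_fun [set: R] (@sintau R).
Proof.
apply: (@measurableT_comp _ _ _ _ _ _ (@sin R)); last exact: measurable_funM.
by apply: continuous_measurable_fun => x; exact: continuous_sin.
Qed.
End measurable_trigo.

Section trig_poly.
Variables (R : realType) (n : nat).
Notation V := 'rV[R]_n.
Implicit Types (x y : V) (m : 'rV[int]_n) (f g : V -> R).

Definition zv m : V := map_mx (fun z : int => z%:~R) m.
Definition dot m x : R := \sum_(i < n) (m 0 i)%:~R * x 0 i.

Lemma dotD m x y : dot m (x + y) = dot m x + dot m y.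
Proof. by rewrite -big_split/=; apply: eq_bigr => i _; rewrite mxE mulrDr. Qed.

Lemma dotZ m c x : dot m (c *: x) = c * dot m x.
Proof. by rewrite mulr_sumr; apply: eq_bigr => i _; rewrite mxE mulrCA. Qed.

Lemma dot0l x : dot 0 x = 0.
Proof. by rewrite /dot big1// => i _; rewrite mxE mul0r. Qed.

Lemma dotDl m m' x : dot (m + m') x = dot m x + dot m' x.
Proof. by rewrite -big_split/=; apply: eq_bigr => i _; rewrite mxE intrD mulrDl. Qed.

Lemma dotBl m m' x : dot (m - m') x = dot m x - dot m' x.
Proof. by rewrite /dot -sumrB; apply: eq_bigr => i _; rewrite !mxE intrB mulrBl. Qed.

Lemma dotZl (q : int) m x : dot (q *: m) x = q%:~R * dot m x.
Proof. by rewrite mulr_sumr; apply: eq_bigr => i _; rewrite mxE intrM mulrA. Qed.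

Lemma dot_zv m z : exists k : int, dot m (zv z) = k%:~R.
Proof.
exists (\sum_i m 0 i * z 0 i); rewrite rmorph_sum/=.
by apply: eq_bigr => i _; rewrite mxE intrM.
Qed.

Lemma dot_delta m i : dot m (delta_mx 0 i) = (m 0 i)%:~R.
Proof.
rewrite /dot (bigD1 i)//= !mxE !eqxx mulr1 big1 ?addr0// => j ji.
by rewrite mxE (negbTE ji) andbF mulr0.
Qed.

Lemma dot_eq0 m : (forall x, dot m x = 0) -> m = 0.
Proof.
move=> H; apply/rowP => i; rewrite mxE; apply/eqP.
by have := H (delta_mx 0 i); rewrite dot_delta => /eqP; rewrite intr_eq0.
Qed.

Definition norm1 x : R := \sum_i `|x 0 i|.

Lemma norm1_ge0 x : 0 <= norm1 x. Proof. exact: sumr_ge0. Qed.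

Lemma dot_norm1 m : exists L, 0 <= L /\ forall x, `|dot m x| <= L * norm1 x.
Proof.
exists (\sum_i `|(m 0 i)%:~R : R|); split; first exact: sumr_ge0.
move=> x; apply: le_trans (ler_norm_sum _ _ _) _; rewrite mulr_sumr.
apply: ler_sum => i _; rewrite normrM ler_wpM2r//.
by rewrite (bigD1 i)//= lerDl sumr_ge0.
Qed.

(** Adding one frequency at a time replaces reasoning on the list of terms. *)
Lemma tp_ind (P : (V -> R) -> Prop) : P (fun=> 0) ->
  (forall m a b f, trig_poly f -> P f -> P (fun x => a * costau (dot m x) + b * sintau (dot m x) + f x)) ->
  forall f, trig_poly f -> P f.
Proof.
move=> P0 PS f [s fE]; have -> : f = fun x => \sum_(c <- s) (c.1.2 * costau (dot c.1.1 x) + c.2 * sintau (dot c.1.1 x)).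
  by apply/funext => x; rewrite fE.
elim: s {f fE} => [|[[m a] b] s IH].
  by under eq_fun do rewrite big_nil.
by under eq_fun do rewrite big_cons/=; apply: PS => //; exists s.
Qed.

Lemma tpD f g : trig_poly f -> trig_poly g -> trig_poly (fun x => f x + g x).
Proof. by move=> [s fE] [s' gE]; exists (s ++ s') => x; rewrite big_cat fE gE. Qed.

Lemma tp_cs m a b : trig_poly (fun x : V => a * costau (dot m x) + b * sintau (dot m x)).
Proof. by exists [:: (m, a, b)] => x; rewrite big_seq1. Qed.

Lemma tp_cst c : trig_poly (fun _ : V => c).
Proof. by have := tp_cs 0 c 0; under eq_fun do rewrite mul0r addr0 dot0l costau0 mulr1. Qed.

Lemma tpZ c f : trig_poly f -> trig_poly (fun x => c * f x).
Proof.
move: f; apply: tp_ind => [|m a b f _ IH].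
  by under eq_fun do rewrite mulr0; exact: tp_cst.
under eq_fun do rewrite !mulrDr !mulrA.
by apply: tpD => //; exact: tp_cs.
Qed.

Lemma tpN f : trig_poly f -> trig_poly (fun x => - f x).
Proof. by move=> /(tpZ (-1)); under eq_fun do rewrite mulN1r. Qed.

Lemma tpB f g : trig_poly f -> trig_poly g -> trig_poly (fun x => f x - g x).
Proof. by move=> tf tg; apply: tpD => //; exact: tpN. Qed.

Lemma tp_sum (I : Type) (s : seq I) (F : I -> V -> R) : (forall i, trig_poly (F i)) ->
  trig_poly (fun x => \sum_(i <- s) F i x).
Proof.
move=> tF; elim: s => [|i s IH].
  by under eq_fun do rewrite big_nil; exact: tp_cst.
by under eq_fun do rewrite big_cons; exact: tpD.
Qed.

Lemma tpM f g : trig_poly f -> trig_poly g -> trig_poly (fun x => f x * g x).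
Proof.
move=> + tg; move: f; apply: tp_ind => [|m a b f _ IH].
  by under eq_fun do rewrite mul0r; exact: tp_cst.
under eq_fun do rewrite mulrDl; apply: tpD => //.
move: g tg {f IH}; apply: tp_ind => [|m' a' b' g _ IH].
  by under eq_fun do rewrite mulr0; exact: tp_cst.
under eq_fun do rewrite mulrDr; apply: tpD => //.
have -> : (fun x => (a * costau (dot m x) + b * sintau (dot m x)) * (a' * costau (dot m' x) + b' * sintau (dot m' x)))
  = (fun x => ((a * a' - b * b') / 2 * costau (dot (m + m') x) + (a * b' + b * a') / 2 * sintau (dot (m + m') x)) +
    ((a * a' + b * b') / 2 * costau (dot (m - m') x) + (b * a' - a * b') / 2 * sintau (dot (m - m') x))).
  apply/funext => x; rewrite dotDl dotBl costauB costauD !sintauD costauN sintauN; by field.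
by apply: tpD; exact: tp_cs.
Qed.

Lemma tp_exp k f : trig_poly f -> trig_poly (fun x => f x ^+ k).
Proof.
move=> tf; elim: k => [|k IH]; first by under eq_fun do rewrite expr0; exact: tp_cst.
by under eq_fun do rewrite exprS; exact: tpM.
Qed.

Lemma tp_periodic f : trig_poly f -> forall x z, f (x + zv z) = f x.
Proof.
move: f; apply: tp_ind => // m a b f _ IH x z.
by have [k kE] := dot_zv m z; rewrite IH dotD kE costauDz sintauDz.
Qed.

Lemma tp_bounded f : trig_poly f -> exists M, 0 <= M /\ forall x, `|f x| <= M.
Proof.
move: f; apply: tp_ind => [|m a b f _ [M [M0 IH]]].
  by exists 0; split=> // x; rewrite normr0.
exists (`|a| + `|b| + M); split=> [|x]; first by rewrite !addr_ge0.
have H1 : `|a * costau (dot m x)| <= `|a| by rewrite normrM ler_piMr// costau_le1.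
have H2 : `|b * sintau (dot m x)| <= `|b| by rewrite normrM ler_piMr// sintau_le1.
by rewrite (le_trans (ler_normD _ _))// lerD// (le_trans (ler_normD _ _))// lerD.
Qed.

Lemma bm_tp f : trig_poly f -> bm (f \o @rv R n).
Proof.
move=> tf; split; last by have [M [_ fM]] := tp_bounded tf; exists M => x; exact: fM.
have md m : measurable_fun [set: n.-tuple R] (fun t => dot m (rv t)).
  apply: measurable_sum => i; apply: measurable_funM => //.
  by under eq_fun do rewrite mxE; exact: measurable_tnth.
move: f tf; apply: tp_ind => [|m a b f _ IH]; first exact: measurable_cst.
apply: measurable_funD => //; apply: measurable_funD; apply: measurable_funM => //.
- by apply: measurableT_comp => //; exact: measurable_costau.
- by apply: measurableT_comp => //; exact: measurable_sintau.
Qed.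

End trig_poly.

Section lipschitz.
Variable R : realType.
Lemma deriv_lip (f df : R -> R) (M : R) : (forall x : R, is_derive x (1 : R) f (df x)) ->
  (forall x, `|df x| <= M) -> forall a b, `|f a - f b| <= M * `|a - b|.
Proof.
move=> fd dM.
have H (x y : R) : x <= y -> `|f y - f x| <= M * `|y - x|.
  move=> xy.
  have [c _ ->] := @MVT_segment R f df x y xy (fun x _ => fd x)
    (continuous_subspaceT (fun x => differentiable_continuous (proj1 (derivable1_diffP _ _) (@ex_derive _ _ _ _ _ _ _ (fd x))))).
  by rewrite normrM ler_wpM2r.
move=> a b; have [ab|ba] := leP a b; last by rewrite H// ltW.
by rewrite distrC (distrC a) H.
Qed.

Lemma cos_lip (a b : R) : `|cos a - cos b| <= `|a - b|.
Proof.
rewrite -[X in _ <= X]mul1r; apply: (@deriv_lip _ (fun x => - sin x)) => x.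
by rewrite normrN sin_max.
Qed.

Lemma sin_lip (a b : R) : `|sin a - sin b| <= `|a - b|.
Proof.
rewrite -[X in _ <= X]mul1r; apply: (@deriv_lip _ cos) => x.
exact: cos_max.
Qed.

Variable n : nat.
Lemma tp_lip (f : 'rV[R]_n -> R) : trig_poly f -> exists L, 0 <= L /\ forall x y, `|f x - f y| <= L * norm1 (x - y).
Proof.
move: f; apply: tp_ind => [|m a b f _ [L [L0 IH]]].
  by exists 0; split=> // x y; rewrite subrr normr0 mul0r.
have [K [K0 HK]] := @dot_norm1 R n m.
exists ((`|a| + `|b|) * (2 * pi * K) + L); split=> [|x y].
  by apply: addr_ge0 => //; apply: mulr_ge0; [exact: addr_ge0|apply: mulr_ge0 => //; apply: mulr_ge0 => //; exact: pi_ge0].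
have HK' : 2 * pi * `|dot m x - dot m y| <= 2 * pi * K * norm1 (x - y).
  have -> : dot m x - dot m y = dot m (x - y) by rewrite dotD -[- y]scaleN1r dotZ mulN1r.
  by rewrite -[X in _ <= X]mulrA ler_wpM2l// mulr_ge0// pi_ge0.
have p0 : 0 <= 2 * pi :> R by rewrite mulr_ge0// pi_ge0.
have E : 2 * pi * `|dot m x - dot m y| = `|2 * pi * dot m x - 2 * pi * dot m y|.
  by rewrite -mulrBr [RHS]normrM (ger0_norm p0).
have H1 : `|a * costau (dot m x) - a * costau (dot m y)| <= `|a| * (2 * pi * K * norm1 (x - y)).
  by rewrite -mulrBr normrM ler_wpM2l// (le_trans _ HK')// E cos_lip.
have H2 : `|b * sintau (dot m x) - b * sintau (dot m y)| <= `|b| * (2 * pi * K * norm1 (x - y)).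
  by rewrite -mulrBr normrM ler_wpM2l// (le_trans _ HK')// E sin_lip.
have H3 := IH x y.
have -> : a * costau (dot m x) + b * sintau (dot m x) + f x - (a * costau (dot m y) + b * sintau (dot m y) + f y) =
  (a * costau (dot m x) - a * costau (dot m y)) + (b * sintau (dot m x) - b * sintau (dot m y)) + (f x - f y) by ring.
rewrite (le_trans (ler_normD _ _))// mulrDl lerD// (le_trans (ler_normD _ _))//.
by rewrite !mulrDl -!mulrA !mulrA; lra.
Qed.
End lipschitz.

(** * Uniform Birkhoff averages of trigonometric polynomials *)

Section uniform_birkhoff.
Variables (R : realType) (n : nat) (A : 'M[int]_n) (b : 'rV[R]_n).
Notation V := 'rV[R]_n.
Implicit Types (x y : V) (m : 'rV[int]_n) (f g : V -> R).
Notation T := (Tlift A b).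

Definition mxN : 'M[R]_n := map_mx (fun z : int => z%:~R) A - 1%:M.
(** The dual action on frequencies: composing the character of frequency [m] with the map multiplies
    it by the character of frequency [nu m] and by a constant. *)
Definition nu m : 'rV[int]_n := m *m (A - 1%:M)^T.

Lemma dot_nu m x : dot (nu m) x = dot m (x *m mxN).
Proof.
rewrite /dot; under eq_bigr => i _ do rewrite mxE rmorph_sum/= mulr_suml.
rewrite exchange_big/=; apply: eq_bigr => i _; rewrite mxE mulr_sumr.
apply: eq_bigr => j _; rewrite !mxE intrM intrB mulrAC -mulrA; congr (_ * (_ * (_ - _))).
by case: (j == i).
Qed.

Lemma Tlift_mxN x : T x = x + (x *m mxN + b).
Proof. by rewrite /Tlift /mxN mulmxBr mulmx1; apply/rowP => i; rewrite !mxE; ring. Qed.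

Lemma dot_Tlift m x : dot m (T x) = dot m x + (dot (nu m) x + dot m b).
Proof. by rewrite Tlift_mxN !dotD dot_nu. Qed.

(** The phase of a character along an orbit is a polynomial in time: its successive differences are
    phases of the frequencies [iter i nu m], which die out by nilpotency. *)
Lemma fdiff_dot_Tlift m x i j : iter i.+1 (@fdiff R) (fun j => dot m (iter j T x)) j =
  dot (iter i.+1 nu m) (iter j T x) + dot (iter i nu m) b.
Proof.
elim: i j => [|i IH] j; first by rewrite /fdiff /= dot_Tlift; ring.
by rewrite iterS /fdiff !IH [iter j.+1 T x]iterS dot_Tlift -!iterS; ring.
Qed.

(** [nu m = 0] says that the character of frequency [m] is an eigenfunction, with eigenvalue of
    phase [dot m b]; the condition excludes nontrivial invariant characters. Applied to the
    multiples of [m], it makes [dot m b] irrational. *)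
Definition irrational_invariants := forall m, m != 0 -> nu m = 0 -> forall z : int, dot m b != z%:~R.
Definition nu_nilpotent := exists K, forall m, iter K nu m = 0.

Definition bsumT f (l : nat) x : R := \sum_(j < l) f (iter j T x).

(** Uniform convergence of Birkhoff averages, in a form valid for all [l] that also compares sums
    over different stretches of one orbit. *)
Definition unif_avg f c := forall e, 0 < e -> exists C, forall x l,
  `|bsumT f l x - l%:R * c| <= e * l%:R + C.

Hypothesis irr : irrational_invariants.
Hypothesis nil : nu_nilpotent.

Lemma nu_scale q m : nu (q *: m) = q *: nu m.
Proof. by rewrite /nu scalemxAl. Qed.

Lemma unif_avg_char m (phi : R) : m != 0 -> unif_avg (fun x => costau (dot m x + phi)) 0.
Proof.
move=> m0 e e0; have [K HK] := nil.
have exK : exists K, iter K nu m == 0 by exists K; rewrite HK.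
(* By minimality [iter i nu m] is a nonzero invariant frequency, so the difference of order [i + 1]
   of the phase is a constant of the kind required by [weyl]. *)
case: (ex_minnP exK) => -[|i] /eqP Hi mini; first by rewrite /= in Hi; rewrite Hi eqxx in m0.
have Hi0 : iter i nu m != 0 by apply/negP => /mini; rewrite ltnn.
have [||C HC] := @weyl R i (dot (iter i nu m) b) _ e => //.
  move=> q z q0; rewrite -dotZl; apply: irr; first by rewrite scalemx_eq0 negb_or q0.
  by rewrite nu_scale -iterS Hi scaler0.
exists C => x l; rewrite mulr0 subr0; apply: (HC (fun j => dot m (iter j T x) + phi)) => j.
rewrite -[RHS]add0r -(dot0l (iter j T x)) -Hi -fdiff_dot_Tlift !iterSr.
by apply: fdiff_iter_eq => j'; rewrite /fdiff; ring.
Qed.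

Lemma unif_avgD f g c c' : unif_avg f c -> unif_avg g c' -> unif_avg (fun x => f x + g x) (c + c').
Proof.
move=> Hf Hg e e0; have e20 : 0 < e / 2 by rewrite divr_gt0.
have [C HC] := Hf _ e20; have [C' HC'] := Hg _ e20.
exists (C + C') => x l; rewrite /bsumT big_split/=.
have := HC x l; have := HC' x l; rewrite /bsumT => h1 h2.
have := ler_normD (\sum_(j < l) f (iter j T x) - l%:R * c) (\sum_(j < l) g (iter j T x) - l%:R * c').
have -> : \sum_(j < l) f (iter j T x) - l%:R * c + (\sum_(j < l) g (iter j T x) - l%:R * c') =
 \sum_(j < l) f (iter j T x) + \sum_(j < l) g (iter j T x) - l%:R * (c + c') by ring.
lra.
Qed.

Lemma unif_avgZ a f c : unif_avg f c -> unif_avg (fun x => a * f x) (a * c).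
Proof.
move=> Hf e e0.
have [|C HC] := Hf (e / (`|a| + 1)); first by rewrite divr_gt0// ltr_wpDl.
exists (`|a| * `|C|) => x l.
have -> : bsumT (fun x => a * f x) l x - l%:R * (a * c) = a * (bsumT f l x - l%:R * c).
  by rewrite /bsumT -mulr_sumr; ring.
rewrite normrM (le_trans (ler_wpM2l _ (HC x l)))// mulrDr lerD//; last by rewrite ler_wpM2l// ler_norm.
by rewrite mulrA ler_wpM2r// mulrA ler_pdivrMr ?ltr_wpDl// mulrC ler_pM2l// lerDl.
Qed.

Lemma unif_avg_cst c : unif_avg (fun=> c) c.
Proof.
move=> e e0; exists 0 => x l; rewrite /bsumT sumr_const card_ord mulr_natl subrr normr0.
by rewrite addr0 mulr_ge0// ltW.
Qed.

Lemma unif_avg_tp f : trig_poly f -> exists c, unif_avg f c.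
Proof.
move: f; apply: tp_ind => [|m a c f _ [d IH]]; first by exists 0; exact: unif_avg_cst.
suff [d' Hd'] : exists d', unif_avg (fun x => a * costau (dot m x) + c * sintau (dot m x)) d'.
  by exists (d' + d); exact: unif_avgD.
have [->|m0] := eqVneq m 0.
  by exists a; under eq_fun do rewrite dot0l costau0 sintau0 mulr1 mulr0 addr0; exact: unif_avg_cst.
exists (a * 0 + c * 0); apply: unif_avgD; apply: unif_avgZ.
  by have := unif_avg_char 0 m0; under eq_fun do rewrite addr0.
(* A shift by a quarter period turns the cosine into a sine; this is the use of the free phase
   [phi]. *)
have := unif_avg_char (- (4^-1)) m0; rewrite (_ : (fun _ => _) = (fun x => sintau (dot m x)))//.
apply/funext => x; rewrite /costau /sintau.
have -> : 2 * pi * (dot m x - 4^-1) = 2 * pi * dot m x - pi / 2 by field.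
by rewrite cosBpihalf.
Qed.

End uniform_birkhoff.

Section iterates.
Variables (R : realType) (n : nat) (A : 'M[int]_n) (b : 'rV[R]_n).
Hypothesis Au : upper_unipotent A.
Notation V := 'rV[R]_n.
Notation T := (Tlift A b).
Notation X := (n.-tuple R).

Lemma rv_tp (x : V) : rv (tp x) = x.
Proof. by apply/rowP => i; rewrite mxE tnth_mktuple. Qed.

Lemma rv_fracT (t : X) : exists z, rv (fracT t) = rv t + zv R z.
Proof.
have /choice[z zE] : forall i : 'I_n, exists z : int, frac (tnth t i) = tnth t i + z%:~R by move=> i; exact: fracE.
by exists (\row_i z i); apply/rowP => i; rewrite !mxE tnth_map zE.
Qed.

(** Functions on the torus are handled as periodic functions on [R^n], where the affine map [Tlift]
    needs no reduction modulo one; [periodic_Tcube] passes from one to the other. *)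
Definition periodic (f : V -> R) := forall x z, f (x + zv R z) = f x.

Lemma Tlift_zv x z : exists z', T (x + zv R z) = T x + zv R z'.
Proof.
exists (z *m A); rewrite /Tlift mulmxDl addrAC; congr (_ + _).
by rewrite /zv map_mxM.
Qed.

Lemma iter_Tlift_zv k x z : exists z', iter k T (x + zv R z) = iter k T x + zv R z'.
Proof.
elim: k => [|k [z' IH]]; first by exists z.
by rewrite !iterS IH; exact: Tlift_zv.
Qed.

Lemma rv_Tcube (t : X) : exists z, rv (Tcube A b t) = T (rv t) + zv R z.
Proof. by have [z zE] := rv_fracT (tp (T (rv t))); exists z; rewrite /Tcube zE rv_tp. Qed.

Lemma rv_iter_Tcube k (t : X) : exists z, rv (iter k (Tcube A b) t) = iter k T (rv t) + zv R z.
Proof.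
elim: k => [|k [z IH]]; first by exists 0; apply/rowP => i; rewrite !mxE addr0.
rewrite iterS; have [z' ->] := rv_Tcube (iter k (Tcube A b) t).
rewrite IH; have [z'' ->] := Tlift_zv (iter k T (rv t)) z.
by exists (z'' + z'); rewrite iterS -addrA /zv map_mxD.
Qed.

Lemma periodic_Tcube f k (t : X) : periodic f -> f (rv (iter k (Tcube A b) t)) = f (iter k T (rv t)).
Proof. by move=> pf; have [z ->] := rv_iter_Tcube k t; rewrite pf. Qed.

Lemma periodic_iter f k : periodic f -> periodic (fun x => f (iter k T x)).
Proof. by move=> pf x z; have [z' ->] := iter_Tlift_zv k x z; rewrite pf. Qed.

Lemma periodic_bsumT f k : periodic f -> periodic (bsumT A b f k).
Proof. by move=> pf x z; apply: eq_bigr => j _; exact: (periodic_iter j pf). Qed.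

Lemma measurable_iter_Tcube k : measurable_fun [set: X] (iter k (Tcube A b)).
Proof.
elim: k => [|k IH]; first exact: measurable_id.
by apply: (measurableT_comp (measurable_Tcube A b)).
Qed.

Lemma bm_iter f k : periodic f -> bm (f \o @rv R n) -> bm ((fun x => f (iter k T x)) \o @rv R n).
Proof.
move=> pf bf; have := bm_comp (measurable_iter_Tcube k) bf.
by congr bm; apply/funext => t /=; rewrite periodic_Tcube.
Qed.

Lemma bm_bsumT f k : periodic f -> bm (f \o @rv R n) -> bm (bsumT A b f k \o @rv R n).
Proof. by move=> pf bf; apply: bm_sum => j; exact: bm_iter. Qed.

Notation E := (Ex (Lam R n)).

Lemma Ex_Tcube (f : X -> R) : bm f -> E (f \o Tcube A b) = E f.
Proof.
move=> bf; have [mf [M fM]] := bf.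
(* Invariance is available for nonnegative functions, hence the shift by the bound [M]. *)
suff: E (fun t => f (Tcube A b t) + M) = E (fun t => f t + M).
  rewrite !ExD//; try exact: bm_cst; first by move=> /addIr.
  by apply: (bm_comp _ bf); exact: measurable_Tcube.
have bfM : bm (fun t => f t + M) by apply: bmD => //; exact: bm_cst.
apply: EFin_inj; rewrite !ExE//; last by apply: (bm_comp _ bfM); exact: measurable_Tcube.
apply: (integral_Tcube b Au (f := fun t => (f t + M)%:E)).
  by apply/measurable_EFinP; exact: bm_measurable.
by move=> x; rewrite lee_fin; move: (fM x); rewrite ler_norml; lra.
Qed.

Lemma Ex_iter_Tcube (f : X -> R) k : bm f -> E (f \o iter k (Tcube A b)) = E f.
Proof.
move=> bf; elim: k => [|k IH]; first by [].
rewrite -[RHS]IH -[RHS]Ex_Tcube; first by congr (Ex _ _); apply/funext => t /=; rewrite -iterSr.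
by apply: bm_comp => //; exact: measurable_iter_Tcube.
Qed.

(** Integrating the Birkhoff sum of length [l] against the invariant measure gives [l] times the
    mean; compare with the uniform estimate for [l] beyond [2 C / e]. *)
Lemma Ex_unif_avg f c : periodic f -> bm (f \o @rv R n) -> unif_avg A b f c -> E (f \o @rv R n) = c.
Proof.
move=> pf bf H; apply/eqP; rewrite -subr_eq0 -normr_le0; apply/ler_addgt0Pr => e e0.
have e20 : 0 < e / 2 by rewrite divr_gt0.
have [C HC] := H _ e20.
pose l := (Num.truncn (C * 2 / e)).+1.
have l0 : 0 < l%:R :> R by rewrite ltr0n.
have lC : C * 2 / e < l%:R by exact: truncnS_gt.
rewrite add0r -(ler_pM2l l0) -[X in X * _ <= _](ger0_norm (ltW l0)) -normrM.
have -> : l%:R * (E (f \o @rv R n) - c) = E (fun t => bsumT A b f l (rv t) - l%:R * c).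
  rewrite ExB ?Ex_cst; [|exact: bm_bsumT|exact: bm_cst].
  rewrite mulrBr; congr (_ - _); rewrite Ex_sum; last by move=> j; exact: bm_iter.
  under eq_bigr => j _.
    rewrite (_ : Ex _ _ = E (f \o @rv R n)); first over.
    rewrite -(Ex_iter_Tcube j bf); congr (Ex _ _); apply/funext => t /=.
    by rewrite periodic_Tcube.
  by rewrite sumr_const card_ord mulr_natl.
apply: le_trans (_ : e / 2 * l%:R + C <= _); last by move: lC; rewrite ltr_pdivrMr//; lra.
apply: Ex_norm_le => [|t]; last exact: HC.
by apply: bmB; [exact: bm_bsumT|exact: bm_cst].
Qed.

End iterates.

(** * From unique ergodicity to irrational eigenvalues *)

Section unique_ergodicity.
Variables (R : realType) (n : nat) (A : 'M[int]_n) (b : 'rV[R]_n).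
Hypothesis Au : upper_unipotent A.
Notation X := (n.-tuple R).
Notation L := (Lam R n).

Lemma measurable_preimage_Tcube (A' : 'M[int]_n) (b' : 'rV[R]_n) (S : set X) :
  measurable S -> measurable (Tcube A' b' @^-1` S).
Proof. by move=> mS; rewrite -[X in measurable X]setTI; exact: measurable_Tcube. Qed.

Lemma Lam_Tcube (S : set X) : measurable S -> L (Tcube A b @^-1` S) = L S.
Proof.
move=> mS; rewrite -[in RHS](setIT S) -(setIT (_ @^-1` _)) -!integral_indic//; last exact: measurable_preimage_Tcube.
apply: (integral_Tcube b Au (f := fun t => (\1_S t)%:E)).
  by apply/measurable_EFinP; exact: measurable_indic.
by move=> x; rewrite lee_fin.
Qed.

Lemma Lam_setIcube (S : set X) : measurable S -> L (S `&` @unit_cube R n) = L S.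
Proof.
move=> mS; have mU := @measurable_unit_cube R n.
rewrite -[in RHS](setIT S) -(setUv (@unit_cube R n)) setIUr measureU//; first last.
- by rewrite setIACA setICr setI0.
- by apply: measurableI => //; exact: measurableC.
- exact: measurableI.
rewrite [X in (_ + X)%E](_ : _ = 0%E) ?adde0//.
apply: subset_measure0 (Lam_unit_cubeC R n) => //; [|exact: measurableC].
by apply: measurableI => //; exact: measurableC.
Qed.

Lemma Lam_invariant : torus_invariant_prob A b L.
Proof.
split; first exact: probability_setT.
split; first exact: Lam_unit_cube.
move=> S mS _; transitivity (L (Tcube A b @^-1` S)); last exact: Lam_Tcube.
by apply: Lam_setIcube; exact: measurable_preimage_Tcube.
Qed.

End unique_ergodicity.

Section irrational.
Variables (R : realType) (n : nat) (A : 'M[int]_n) (b : 'rV[R]_n).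
Hypothesis Au : upper_unipotent A.
Notation X := (n.-tuple R).
Notation L := (Lam R n).

Lemma frac_half (x : R) : (frac (x + 2^-1) < 2^-1) = ~~ (frac x < 2^-1).
Proof.
have [z zE] := fracE x; have f0 := frac_ge0 x; have f1 := frac_lt1 x.
have -> : frac (x + 2^-1) = frac (frac x + 2^-1) by rewrite zE addrAC frac_addz.
have [fh|fh] := ltP (frac x) 2^-1.
  by rewrite frac_id; [apply/negbTE; rewrite -leNgt|]; lra.
rewrite (_ : frac x + 2^-1 = (frac x - 2^-1) + 1%:~R); last by rewrite (_ : 1%:~R = 1)//; lra.
by rewrite frac_addz frac_id; lra.
Qed.

(** A translation that adds one half to the phase exchanges the set with its complement. *)
Lemma half_space_measure (m : 'rV[int]_n) : m != 0 ->
  let I := [set t : X | frac (dot m (rv t)) < 2^-1] in measurable I /\ L I = (2^-1)%:E.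
Proof.
move=> m0 I.
have mI : measurable I.
  rewrite (_ : I = (fun t : X => frac (dot m (rv t))) @^-1` `]-oo, 2^-1[); last first.
    by apply/seteqP; split=> t /=; rewrite in_itv.
  rewrite -[X in measurable X]setTI.
  suff mf : measurable_fun [set: X] (fun t : X => frac (dot m (rv t))) by apply: mf.
  apply: measurableT_comp; first exact: measurable_frac.
  apply: measurable_sum => i; apply: measurable_funM => //.
  by under eq_fun do rewrite mxE; exact: measurable_tnth.
split=> //.
have [i mi] : exists i, m 0 i != 0.
  apply/existsP; apply: contraNT m0; rewrite negb_exists => /forallP H.
  by apply/eqP/rowP => i; rewrite mxE; apply/eqP; move: (H i); rewrite negbK.
pose v : 'rV[R]_n := (2 * (m 0 i)%:~R)^-1 *: delta_mx 0 i.
have dv : dot m v = 2^-1.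
  by rewrite dotZ dot_delta; field; rewrite intr_eq0.
have E : L (~` I) = L I.
  rewrite -[RHS](Lam_Tcube v (@upper_unipotent1 n))//; congr (L _).
  have IT (t : X) : I (Tcube 1%:M v t) <-> ~ I t.
    have [z zE] := rv_Tcube 1%:M v t.
    rewrite /I/= zE dotD; have [k ->] := dot_zv R m z.
    by rewrite frac_addz /Tlift map_mx1 mulmx1 dotD dv frac_half; split=> /negP.
  by apply/seteqP; split=> t /IT.
have := probability_setC L mI; rewrite E.
have := fin_num_measure L I mI; case: (L I) => // r _ [] H.
congr EFin; lra.
Qed.

(** A nontrivial invariant character would make the half-period set [I] invariant, and twice the
    restriction of [Lam] to [I] would be a second invariant probability. *)
Lemma uniquely_ergodic_irrational : uniquely_ergodic A b -> irrational_invariants A b.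
Proof.
move=> ue m m0 num z; apply/negP => /eqP dz.
have [mI LI] := half_space_measure m0; set I := [set t : X | _] in mI LI.
have TI (t : X) : I (Tcube A b t) <-> I t.
  have [z' zE] := rv_Tcube A b t.
  rewrite /I/= zE dotD; have [k ->] := dot_zv R m z'.
  by rewrite frac_addz dot_Tlift num dot0l add0r dz frac_addz.
pose Q : {measure set X -> \bar R} := mscale (NngNum (ler0n R 2)) (mrestr L mI).
have QE S : Q S = (2%:E * L (S `&` I))%E by [].
have Qinv : torus_invariant_prob A b Q.
  split; first by rewrite QE setTI LI -EFinM mulfV.
  split; first by rewrite QE setIC Lam_setIcube// LI -EFinM mulfV.
  move=> S mS _; rewrite !QE; congr (_ * _)%E.
  rewrite -setIA (setIC (@unit_cube R n)) setIA Lam_setIcube; last first.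
    by apply: measurableI => //; exact: measurable_preimage_Tcube.
  rewrite -(Lam_Tcube b Au (S := S `&` I)); last exact: measurableI.
  by congr (L _); apply/seteqP; split=> t /= [H1 H2]; split => //; apply/TI.
have E := ue _ _ (Lam_invariant b Au) Qinv I mI.
have : (2^-1 : R) = 2 * 2^-1 by apply: EFin_inj; rewrite EFinM -LI [LHS]E QE setIid.
lra.
Qed.
End irrational.

(** * Sublevel sets of trigonometric polynomials in one variable *)

Section interpolation.
Variable C : numFieldType.

(* Newton's divided differences: peel off one node at a time *)
Lemma coef_bound_of_values M (kappa : C) : 0 < kappa ->
  exists K, 0 <= K /\ forall (z : nat -> C) (P : {poly C}) (eta : C),
    (forall j, `|z j| = 1) -> (forall i j, (i < j < M)%N -> kappa <= `|z i - z j|) ->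
    (size P <= M)%N -> 0 <= eta -> (forall j, (j < M)%N -> `|P.[z j]| <= eta) ->
    forall k, `|P`_k| <= K * eta.
Proof.
move=> k0; elim: M => [|M [K [K0 IH]]].
  exists 0; split=> // z P eta _ _; rewrite leqn0 size_poly_eq0 => /eqP-> _ _ k.
  by rewrite coef0 normr0 mul0r.
exists (1 + K * (2 / kappa) + K * (2 / kappa)); split.
  by rewrite !addr_ge0// mulr_ge0// divr_ge0// ltW.
move=> z P eta z1 zk sP e0 Pe k.
have [Q PQ] : exists Q, P - P.[z M]%:P = Q * ('X - (z M)%:P).
  by apply/factor_theorem; rewrite rootE !hornerE subrr.
have sQ : (size Q <= M)%N.
  have [->|Q0] := eqVneq Q 0; first by rewrite size_poly0.
  have : (size (Q * ('X - (z M)%:P))%R <= M.+1)%N.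
    rewrite -PQ (leq_trans (size_polyD _ _))// geq_max sP size_polyN.
    by rewrite (leq_trans (size_polyC_leq1 _)).
  by rewrite size_Mmonic ?monicXsubC// size_XsubC addn2.
have Qe j : (j < M)%N -> `|Q.[z j]| <= 2 / kappa * eta.
  move=> jM; have H : Q.[z j] * (z j - z M) = P.[z j] - P.[z M].
    by have := congr1 (fun p => p.[z j]) PQ; rewrite !hornerE.
  have zjM : kappa <= `|z j - z M| by rewrite zk// jM/=.
  have zp : 0 < `|z j - z M| by exact: lt_le_trans zjM.
  have : `|Q.[z j]| * kappa <= 2 * eta.
    rewrite (le_trans (ler_wpM2l _ zjM))// -normrM H (le_trans (ler_normB _ _))//.
    by rewrite mulr_natl mulr2n lerD// Pe// ltnW.
  by rewrite -ler_pdivlMr// mulrAC.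
have Qk := IH z Q _ z1 (fun i j ij => zk i j ltac:(case/andP: ij => -> /ltnW)) sQ _ Qe.
have {Qk} Qk i : `|Q`_i| <= K * (2 / kappa) * eta.
  by rewrite -mulrA Qk// mulr_ge0// divr_ge0// ltW.
have PE : P`_k = (k == 0%N)%:R * P.[z M] + ((if (k == 0)%N then 0 else Q`_k.-1) - Q`_k * z M).
  rewrite -[P in LHS](subrK P.[z M]%:P) PQ mulrBr coefD coefB coefMX coefMC coefC addrC; congr (_ + _).
  by case: (k == 0%N); rewrite ?mul1r ?mul0r.
rewrite PE (le_trans (ler_normD _ _))// -addrA mulrDl mul1r lerD//.
  by case: (k == 0%N); rewrite ?mul1r ?mul0r ?normr0// Pe.
rewrite (le_trans (ler_normB _ _))// mulrDl lerD//; last by rewrite normrM z1 mulr1.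
case: (k == 0%N) => //; rewrite normr0; apply: mulr_ge0 => //; apply: mulr_ge0 => //.
by apply: divr_ge0 => //; exact: ltW.
Qed.
End interpolation.

Section level_sets.
Variable R : realType.
Import complex.
Local Open Scope complex_scope.
Notation mu := (@lebesgue_measure R).

Definition unitc (s : R) : R[i] := (costau s) +i* (sintau s).

Lemma unitcD s s' : unitc (s + s') = unitc s * unitc s'.
Proof. by rewrite /unitc costauD sintauD; apply/eqP; rewrite eq_complex/= eqxx/=; apply/eqP; ring. Qed.

Lemma unitcX s k : unitc s ^+ k = unitc (k%:R * s).
Proof.
elim: k => [|k IH]; first by rewrite mul0r /unitc costau0 sintau0.
by rewrite exprS IH -unitcD -natr1 mulrDl mul1r addrC.
Qed.

Lemma norm_unitc s : `|unitc s| = 1.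
Proof. by rewrite normc_def/= costau2Dsintau2 sqrtr1. Qed.

Lemma norm_unitcB s s' : `|unitc s - unitc s'| = (Num.sqrt (2 - 2 * costau (s - s')))%:C.
Proof.
rewrite normc_def/=; congr (Num.sqrt _)%:C.
rewrite costauB; have := costau2Dsintau2 s; have := costau2Dsintau2 s'; nra.
Qed.

(** Through [norm_unitcB] this bounds from below the chord between points at distance at least [rho]
    on the circle. *)
Lemma costau_far (rho x : R) : 0 < rho -> rho <= 2^-1 -> rho <= `|x| <= 1 - rho ->
  costau x <= costau rho /\ costau rho < 1.
Proof.
move=> r0 r12 xr; have p0 := pi_gt0 R.
have E : costau x = costau `|x| by have [x0|x0] := leP 0 x; [rewrite ger0_norm|rewrite ltr0_norm// costauN].
rewrite E; move: xr; set y := `|x| => yr.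
have mono (u v : R) : 0 <= u -> u <= v -> v <= 2^-1 -> costau v <= costau u.
  move=> u0 uv v2; rewrite /costau leNgt ltr_cos ?in_itv/=; [by rewrite -leNgt ler_pM2l// mulr_gt0|nra|nra].
split; last first.
  have i0 : (0 : R) \in `[0, pi] by rewrite in_itv/= lexx ltW.
  have ir : 2 * pi * rho \in `[0, pi] by rewrite in_itv/=; apply/andP; split; nra.
  rewrite /costau -[X in _ < X](cos0 R) ltr_cos//; apply: mulr_gt0 => //; exact: mulr_gt0.
have [y2|y2] := leP y 2^-1; first by apply: mono; lra.
have -> : costau y = costau (1 - y) by rewrite -costauN -[RHS](costauDz _ (-1)) ; congr costau; rewrite mulrN1z; ring.
apply: mono; lra.
Qed.

Definition trigp (D : nat) (g : R) (a b : nat -> R) (s : R) : R :=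
  g + \sum_(q < D) (a q * costau (q.+1%:R * s) + b q * sintau (q.+1%:R * s)).
Definition trigp_norm (D : nat) (a b : nat -> R) : R := \sum_(q < D) (`|a q| + `|b q|).

(** Multiplication by [2 z ^ D] turns the real trigonometric polynomial into an algebraic one of
    degree at most [2 D] and does not affect moduli on the unit circle, up to the factor two. *)
Lemma trigp_complex D g a b : exists P : {poly R[i]}, [/\ (size P <= D + D.+1)%N,
  forall s, `|P.[unitc s]| = (2 * `|trigp D g a b s|)%:C &
  forall q, (q < D)%N -> P`_(D + q.+1) = (a q) -i* (b q)].
Proof.
pose P := ((2 * g)%:C)%:P * 'X^D + \sum_(q < D) (((a q) -i* (b q))%:P * 'X^(D + q.+1) + ((a q) +i* (b q))%:P * 'X^(D - q.+1)).
exists P; split.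
- rewrite (leq_trans (size_polyD _ _))// geq_max; apply/andP; split.
    rewrite (leq_trans (size_polyMleq _ _))// size_polyXn.
    rewrite -subn1 leq_subLR (leq_trans (leq_add (size_polyC_leq1 _) (leqnn _)))//. lia.
  apply: leq_trans (size_sum _ _ _) _; apply/bigmax_leqP => q _.
  have qD := ltn_ord q.
  rewrite (leq_trans (size_polyD _ _))// geq_max; apply/andP; split;
    rewrite (leq_trans (size_polyMleq _ _))// size_polyXn -subn1 leq_subLR (leq_trans (leq_add (size_polyC_leq1 _) (leqnn _)))//; lia.
- move=> s; have -> : P.[unitc s] = unitc (D%:R * s) * (2 * trigp D g a b s)%:C.
    rewrite /P hornerD hornerM hornerC hornerXn horner_sum.
    have T (q : 'I_D) : (((a q) -i* (b q))%:P * 'X^(D + q.+1) + ((a q) +i* (b q))%:P * 'X^(D - q.+1)).[unitc s]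
      = unitc (D%:R * s) * (2 * (a q * costau (q.+1%:R * s) + b q * sintau (q.+1%:R * s)))%:C.
      rewrite hornerD !hornerM !hornerC !hornerXn !unitcX natrD natrB// mulrDl mulrBl !unitcD mulrCA [X in _ + X]mulrCA -mulrDr; congr (_ * _).
      by rewrite /unitc costauN sintauN; apply/eqP; rewrite eq_complex/=; apply/andP; split; apply/eqP; ring.
    under eq_bigr => q _ do rewrite T.
    rewrite -mulr_sumr -rmorph_sum/= unitcX mulrC -mulrDr -rmorphD/= /trigp; congr (_ * _%:C).
    by rewrite mulrDr mulr_sumr.
  rewrite normrM norm_unitc mul1r normc_def/= expr0n addr0 sqrtr_sqr normrM ger0_norm//.
- move=> q qD; rewrite coefD coefCM coefXn coef_sum (bigD1 (Ordinal qD))//= big1 ?addr0; last first.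
    move=> i iq; rewrite coefD !coefCM !coefXn eqn_add2l eqSS.
    rewrite (_ : (q == i) = false) ?mulr0 ?add0r; last by apply/negbTE; rewrite eq_sym; apply: contra iq => /eqP h; apply/eqP/val_inj.
    by rewrite (_ : (_ == _) = false) ?mulr0//; have := ltn_ord i; lia.
  rewrite coefD !coefCM !coefXn eqxx mulr1.
  have -> : ((D + q.+1)%N == D) = false by apply/negbTE; rewrite -{2}[D]addn0 eqn_add2l.
  have -> : ((D + q.+1)%N == (D - q.+1)%N) = false.
    apply/negbTE; rewrite neq_ltn; apply/orP; right.
    by apply: leq_ltn_trans (leq_subr _ _) _; rewrite addnS ltnS leq_addr.
  by rewrite !mulr0 addr0 add0r.
Qed.

Lemma mu_itv_le (a b : R) : (mu `]a, b[ <= (`|b - a|)%:E)%E.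
Proof.
rewrite lebesgue_measure_itv/= lte_fin; case: ifP => ab; rewrite -?EFinB lee_fin//.
exact: ler_norm.
Qed.

(* Greedy choice: a set of measure [> 4 rho M] contains [M] points separated on the circle *)
Lemma separated_points (S : set R) M (rho : R) : measurable S -> S `<=` [set s | 0 <= s < 1] ->
  0 < rho -> ((4 * rho * M%:R)%:E < mu S)%E ->
  exists s : nat -> R, (forall j, (j < M)%N -> S (s j)) /\
    forall i j, (i < j < M)%N -> rho <= `|s i - s j| <= 1 - rho.
Proof.
move=> mS S01 r0; elim: M => [|M IH] Smu.
  by exists (fun=> 0); split=> // i j; rewrite ltn0 andbF.
have [|s [sS sd]] := IH.
  by apply: le_lt_trans Smu; rewrite lee_fin ler_wpM2l// ?ler_nat ?mulr_ge0// ltW.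
(* Covers the points closer than [rho] to [s i] on the circle, in three pieces because of the
   wrap-around; total length at most [4 rho]. *)
pose bad (i : nat) : set R := `]s i - rho, s i + rho[ `|` (`]s i + 1 - rho, s i + 1[ `|` `]s i - 1, s i - 1 + rho[).
have mbad i : measurable (bad i) by apply: measurableU => //; exact: measurableU.
have mubad i : (mu (bad i) <= (4 * rho)%:E)%E.
  apply: le_trans (measureU2 _ _ _) _ => //; first exact: measurableU.
  rewrite (_ : 4 * rho = 2 * rho + (rho + rho)); last by ring.
  rewrite EFinD; apply: leeD.
    by apply: (le_trans (mu_itv_le _ _)); rewrite lee_fin ger0_norm; lra.
  apply: le_trans (measureU2 _ _ _) _ => //; rewrite EFinD; apply: leeD;
    by apply: (le_trans (mu_itv_le _ _)); rewrite lee_fin ger0_norm; lra.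
pose B := \big[setU/set0]_(i < M) bad i.
have mB : measurable B by apply: bigsetU_measurable => i _; exact: mbad.
have muB : (mu B <= (4 * rho * M%:R)%:E)%E.
  apply: (@le_trans _ _ (\sum_(i < M) mu (bad i))%E); first by apply: content_subadditive => // i _; exact: mbad.
  apply: (@le_trans _ _ (\sum_(i < M) (4 * rho)%:E)%E); first by apply: lee_sum => i _.
  by rewrite sumEFin sumr_const card_ord -[_ *+ M]mulr_natr.
have [x [Sx Bx]] : exists x, S x /\ ~ B x.
  apply: contrapT => H; have SB : S `<=` B.
    by move=> x Sx; apply: contrapT => Bx; apply: H; exists x.
  have := le_trans (le_measure mu _ _ SB) muB; rewrite !inE => /(_ mS mB).
  rewrite leNgt => /negP; apply; apply: le_lt_trans Smu.
  by rewrite lee_fin ler_wpM2l// ?ler_nat ?mulr_ge0// ltW.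
exists (fun j => if j == M then x else s j); split=> [j|i j /andP[ij]].
  by rewrite ltnS leq_eqVlt; case: eqP => //= _; exact: sS.
rewrite ltnS leq_eqVlt => /orP[/eqP jE|jM]; last first.
  by rewrite !ltn_eqF//; [apply: sd; rewrite ij|exact: ltn_trans jM].
rewrite {j}jE in ij *; rewrite eqxx (ltn_eqF ij).
have si : 0 <= s i < 1 by apply: S01; exact: sS.
have xi : 0 <= x < 1 by exact: S01.
have nb : ~ bad i x.
  move=> bx; apply: Bx; by rewrite /B -bigcup_mkord; exists i.
move: nb; rewrite /bad/= !in_itv/= => /not_orP[n1 /not_orP[n2 n3]].
have {}n1 : ~ (s i - rho < x /\ x < s i + rho) by move=> /andP.
have {}n2 : ~ (s i + 1 - rho < x /\ x < s i + 1) by move=> /andP.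
have {}n3 : ~ (s i - 1 < x /\ x < s i - 1 + rho) by move=> /andP.
have [sx|sx] := leP (s i) x.
  rewrite distrC ger0_norm ?subr_ge0//; apply/andP; split; rewrite leNgt; apply/negP => h.
    by apply: n1; split; lra.
  by apply: n2; split; lra.
rewrite gtr0_norm ?subr_gt0//; apply/andP; split; rewrite leNgt; apply/negP => h.
  by apply: n1; split; lra.
by apply: n3; split; lra.
Qed.

Lemma measurable_trigp D g a b : measurable_fun [set: R] (trigp D g a b).
Proof.
apply: measurable_funD => //; apply: measurable_sum => q.
by apply: measurable_funD; apply: measurable_funM => //; apply: measurableT_comp;
  rewrite ?[X in measurable_fun _ X]/(fun _ => _); try exact: measurable_funM; [exact: measurable_costau|exact: measurable_sintau].
Qed.

(** A sublevel set of measure more than [e] contains [2 D + 1] separated points; interpolation there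
    bounds every coefficient by a multiple of [eta] times the norm, which is absurd for small [eta].
    Only the degree and [e] enter [eta], so that one [eta] serves all Birkhoff sums on all
    fibres. *)
Lemma level_set_small D (e : R) : 0 < e -> exists eta, 0 < eta /\
  forall g a b, 0 < trigp_norm D a b ->
  (mu [set s | (0 <= s < 1) /\ `|trigp D g a b s| <= eta * trigp_norm D a b]%R <= e%:E)%E.
Proof.
move=> e0; pose M := (D + D.+1)%N.
have M0 : 0 < M%:R :> R by rewrite ltr0n /M addnS.
pose rho := Num.min (e / (8 * M%:R)) 4^-1.
have r0 : 0 < rho by rewrite lt_min invr_gt0 ltr0n andbT divr_gt0// mulr_gt0.
have r4 : rho <= 4^-1 by rewrite ge_min lexx orbT.
have re : 4 * rho * M%:R < e.
  have : rho * (8 * M%:R) <= e by rewrite -ler_pdivlMr ?mulr_gt0// ge_min lexx.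
  nra.
have [_ cr1] : costau rho <= costau rho /\ costau rho < 1.
  by apply: (@costau_far rho) => //; rewrite ?gtr0_norm//; lra.
pose kap := Num.sqrt (2 - 2 * costau rho).
have kap0 : 0 < kap by rewrite sqrtr_gt0; lra.
have [K [K0 HK]] := @coef_bound_of_values R[i] M kap%:C ltac:(by rewrite ltcR).
have [k kE] : exists k, K = k%:C by exists (Re K); rewrite RRe_real// ger0_real.
have k0 : 0 <= k by rewrite -ler0c -kE.
(* Chosen so that [D * (4 * k * eta) < 1]: the [D] coefficient bounds then add up to less than the
   norm. *)
pose eta := (4 * D.+1%:R * (k + 1))^-1.
have eta0 : 0 < eta by rewrite invr_gt0 !mulr_gt0// ltr_wpDl.
exists eta; split=> // g a b H0; set H := trigp_norm D a b in H0 *.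
set S := (X in mu X).
have mS : measurable S.
  rewrite (_ : S = `[0, 1[%classic `&` (fun s => `|trigp D g a b s|) @^-1` `]-oo, eta * H]); last first.
    by apply/seteqP; split=> s; rewrite /S/= !in_itv/=.
  apply: measurableI => //; rewrite -[X in measurable X]setTI.
  suff mf : measurable_fun [set: R] (fun s => `|trigp D g a b s|) by exact: mf.
  by apply: measurableT_comp => //; exact: measurable_trigp.
rewrite leNgt; apply/negP => Se.
have [||s [sS sd]] := @separated_points S M rho mS _ r0.
- by move=> s [].
- by apply: lt_trans Se; rewrite lte_fin.
have [P [sP Pu Pc]] := trigp_complex D g a b.
have PB q : (q < D)%N -> `|P`_(D + q.+1)| <= K * (2 * (eta * H))%:C.
  move=> qD; apply: (HK (fun j => unitc (s j))) => //.
  - by move=> j; exact: norm_unitc.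
  - move=> i j ij; rewrite norm_unitcB lecR; apply: ler_wsqrtr.
    have [+ _] := @costau_far rho (s i - s j) r0 ltac:(lra) (sd i j ij); lra.
  - by rewrite ler0c !mulr_ge0// ltW.
  - by move=> j jM; rewrite Pu lecR ler_pM2l//; case: (sS j jM).
have cb q : (q < D)%N -> `|a q| + `|b q| <= 4 * k * eta * H.
  move=> qD; have := PB q qD; rewrite Pc// kE -rmorphM/= normc_def/= lecR sqrrN => h.
  have ha : `|a q| <= Num.sqrt (a q ^+ 2 + b q ^+ 2) by rewrite -sqrtr_sqr ler_wsqrtr// lerDl sqr_ge0.
  have hb : `|b q| <= Num.sqrt (a q ^+ 2 + b q ^+ 2) by rewrite -sqrtr_sqr ler_wsqrtr// lerDr sqr_ge0.
  lra.
have : H <= D%:R * (4 * k * eta * H).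
  apply: (@le_trans _ _ (\sum_(q < D) (4 * k * eta * H))); first by apply: ler_sum => q _; exact: cb.
  by rewrite sumr_const card_ord -[_ *+ D]mulr_natl.
have : 4 * D.+1%:R * (k + 1) * eta = 1 by rewrite /eta mulfV// gt_eqF// !mulr_gt0// ltr_wpDl.
rewrite -[D.+1%:R]natr1; have := ler0n R D; set d := D%:R => d0 E1.
have E2 : d * (4 * k * eta) < 1.
  rewrite -E1; have : 0 <= d * eta by rewrite mulr_ge0// ltW.
  have : 0 <= k * eta by rewrite mulr_ge0// ltW.
  nra.
have : d * (4 * k * eta) * H < 1 * H by rewrite ltr_pM2r.
nra.
Qed.
End level_sets.

(** * Density of trigonometric polynomials *)

Section dominated.
Context d (T : measurableType d) (R : realType) (P : probability T R).

Lemma Ex_cvg (F : nat -> T -> R) (f : T -> R) M : (forall n, bm (F n)) -> bm f ->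
  (forall n x, `|F n x| <= M) -> (forall x, F n x @[n --> \oo] --> f x) ->
  Ex P (F n) @[n --> \oo] --> Ex P f.
Proof.
move=> bF bf FM Ff.
have bM : P.-integrable setT (EFin \o cst M) by apply: bm_integrable; exact: bm_cst.
have H1 n : measurable_fun setT (fun x => (F n x)%:E).
  by apply/measurable_EFinP; exact: bm_measurable.
have H2 x : setT x -> (F n x)%:E @[n --> \oo] --> (f x)%:E.
  by move=> _; apply: cvg_EFin; [exact: nearW|exact: Ff].
have H3 (n : nat) x : setT x -> (`|(F n x)%:E| <= M%:E)%E by move=> _; rewrite lee_fin.
have H := @dominated_cvg _ _ _ P setT measurableT (fun n x => (F n x)%:E) (fun x => (f x)%:E) (fun=> M%:E) H1 H2 (fun x _ => isT) bM H3.
by have := H; rewrite -(ExE P bf); exact: fine_cvg.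
Qed.

Lemma Ex_cvg_abs (F : nat -> T -> R) (f : T -> R) M : (forall n, bm (F n)) -> bm f ->
  (forall n x, `|F n x| <= M) -> (forall x, F n x @[n --> \oo] --> f x) ->
  forall e, 0 < e -> exists n, Ex P (fun x => `|F n x - f x|) < e.
Proof.
move=> bF bf FM Ff e e0; have [_ [M' fM']] := bf.
have : Ex P (fun x => `|F n x - f x|) @[n --> \oo] --> Ex P (fun=> 0).
  apply: (@Ex_cvg _ _ (M + M')).
  - by move=> n; apply: bm_abs; exact: bmB.
  - exact: bm_cst.
  - by move=> n x; rewrite normr_id (le_trans (ler_normB _ _))// lerD.
  - move=> x; rewrite -(normr0 R); apply: cvg_norm; rewrite -(subrr (f x)).
    by apply: cvgB => //; exact: cvg_cst.
rewrite Ex_cst => /cvgrPdist_lt/(_ _ e0)[n _ /(_ n (leqnn n))]/=.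
by rewrite sub0r normrN ger0_norm; [exists n|exact: Ex_ge0].
Qed.
End dominated.

Section threshold.
Variable R : realType.

Lemma bernoulli_ineq (x : R) m : -1 <= x -> 1 + m%:R * x <= (1 + x) ^+ m.
Proof.
move=> x1; elim: m => [|m IH]; first by rewrite mul0r addr0 expr0.
rewrite exprS; have := @ler_wpM2l _ (1 + x) _ _ _ IH => /(_ ltac:(lra)).
by apply: le_trans; rewrite -natr1; have := sqr_ge0 x; have := ler0n R m; nra.
Qed.

(* [threshold n f -> 1_{f >= 1/2}] pointwise on [0,1] *)
Definition threshold (n : nat) (f : R) : R := 1 - (1 - f ^+ (n ^ 2)) ^+ (n * 2 ^ (n ^ 2)).

Lemma threshold01 n f : 0 <= f <= 1 -> 0 <= threshold n f <= 1.
Proof.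
move=> /andP[f0 f1]; have H : 0 <= f ^+ (n ^ 2) <= 1 by rewrite exprn_ge0//= exprn_ile1.
have : 0 <= (1 - f ^+ (n ^ 2)) ^+ (n * 2 ^ (n ^ 2)) <= 1.
  by apply/andP; split; [apply: exprn_ge0|apply: exprn_ile1]; lra.
rewrite /threshold; lra.
Qed.

Lemma expr_subr_le (x : R) m : 0 <= x <= 1 -> (1 - x) ^+ m * (1 + m%:R * x) <= 1.
Proof.
move=> x01; apply: (@le_trans _ _ ((1 - x) ^+ m * (1 + x) ^+ m)).
  by apply: ler_wpM2l; [apply: exprn_ge0; lra|apply: bernoulli_ineq; lra].
by rewrite -exprMn exprn_ile1//; nra.
Qed.

(** With [N = n ^ 2], [m = n * 2 ^ N] and [x = f ^ N] one has [m x = n (2 f) ^ N], which is at least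
    [n] if [f] is at least one half and tends to zero otherwise. Bernoulli's inequality settles both
    cases. *)
Lemma threshold_rate f : 0 <= f <= 1 -> exists c, forall n,
  `|threshold n f - (2^-1 <= f)%R%:R| <= c / n.+1%:R.
Proof.
move=> f01; have /andP[f0 f1] := f01.
have [fh|fh] := leP 2^-1 f.
  exists 1 => n; rewrite mul1r /threshold; set x := f ^+ (n ^ 2); set m := (n * 2 ^ (n ^ 2))%N.
  have x01 : 0 <= x <= 1 by rewrite exprn_ge0//= exprn_ile1.
  have y0 : 0 <= (1 - x) ^+ m by apply: exprn_ge0; lra.
  rewrite (_ : 1 - (1 - x) ^+ m - 1 = - (1 - x) ^+ m); last by ring.
  rewrite normrN ger0_norm// -[_^-1]mul1r ler_pdivlMr ?ltr0n//.
  apply: le_trans (expr_subr_le m x01); apply: ler_wpM2l => //.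
  rewrite -natr1 addrC lerD2l /m natrM natrX -mulrA ler_peMr// -exprMn.
  by apply: exprn_ege1; lra.
have d0 : 0 < 1 - 2 * f by lra.
exists (2 / (1 - 2 * f)) => n; rewrite subr0.
have /andP[t0 t1] := threshold01 n f01; rewrite ger0_norm//.
rewrite /threshold; set x := f ^+ (n ^ 2); set m := (n * 2 ^ (n ^ 2))%N.
have x01 : 0 <= x <= 1 by rewrite exprn_ge0//= exprn_ile1.
have B : 1 - (1 - x) ^+ m <= m%:R * x.
  by have := @bernoulli_ineq (- x) m; rewrite mulrN; lra.
apply: le_trans B _.
have -> : m%:R * x = n%:R * (1 - (1 - 2 * f)) ^+ (n ^ 2).
  by rewrite /m /x natrM natrX -mulrA -exprMn; congr (_ * _ ^+ _); ring.
set dl := 1 - 2 * f in d0 *.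
have := @expr_subr_le dl (n ^ 2) ltac:(rewrite /dl; lra); set y := (1 - dl) ^+ (n ^ 2) => Hy.
have y0 : 0 <= y by apply: exprn_ge0; rewrite /dl; lra.
rewrite ler_pdivlMr ?ltr0n// ler_pdivlMr// -natr1; rewrite natrX in Hy.
have n0 := ler0n R n; set N := n%:R in n0 Hy *.
have NN : N <= N ^+ 2.
  by rewrite /N -natrX ler_nat; case: (n) => // k; rewrite expnS expn1 leq_pmulr.
have E : N * y * (N + 1) * dl <= 2 * (y * (N ^+ 2 * dl)).
  rewrite (_ : N * y * (N + 1) * dl = (y * dl) * (N ^+ 2 + N)); last by ring.
  rewrite (_ : 2 * (y * (N ^+ 2 * dl)) = (y * dl) * (N ^+ 2 + N ^+ 2)); last by ring.
  by apply: ler_wpM2l; [rewrite mulr_ge0// ltW|rewrite lerD2l].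
apply: le_trans E _; rewrite mulrDr mulr1 in Hy; lra.
Qed.

Lemma cvg_threshold f : 0 <= f <= 1 -> threshold n f @[n --> \oo] --> ((2^-1 <= f)%R%:R : R).
Proof.
move=> f01; have [c Hc] := threshold_rate f01.
have : (c / n.+1%:R) @[n --> \oo] --> (0 : R).
  by rewrite -(mulr0 c); apply: cvgM; [exact: cvg_cst|exact: cvg_harmonic].
move=> /cvgrPdist_le H; apply/cvgrPdist_le => e e0.
have [N _ HN] := H _ e0; exists N => // n Nn /=; rewrite distrC.
have := HN _ Nn; rewrite /= sub0r normrN => /(le_trans _); apply.
by apply: le_trans (Hc n) _; exact: ler_norm.
Qed.
End threshold.

Section density.
Variables (R : realType) (n : nat).
Notation X := (n.-tuple R).
Notation E := (Ex (Lam R n)).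
Notation V := 'rV[R]_n.

(** Approximation in mean of the indicator. The sets with this property form a sigma-algebra
    containing the coordinate rays, hence all measurable sets. *)
Definition tp_approx (B : set X) := measurable B /\
  forall e, 0 < e -> exists a : V -> R, trig_poly a /\ E (fun t => `|\1_B t - a (rv t)|) < e.

(** Composing with reduction modulo one changes neither expectation and makes the hypothesis
    available at every point. *)
Lemma Ex_le_cube (f g : X -> R) : bm f -> bm g -> (forall t, unit_cube t -> f t <= g t) -> E f <= E g.
Proof.
move=> bf bg fg; rewrite -(Ex_Tcube 0 (@upper_unipotent1 n) bf) -(Ex_Tcube 0 (@upper_unipotent1 n) bg).
by apply: Ex_le => [| |t]; [exact: (bm_comp (measurable_Tcube _ _))|exact: (bm_comp (measurable_Tcube _ _))|apply: fg; exact: unit_cube_Tcube].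
Qed.

Lemma Ex_eq_cube (f g : X -> R) : bm f -> bm g -> (forall t, unit_cube t -> f t = g t) -> E f = E g.
Proof.
move=> bf bg fg; apply/eqP; rewrite eq_le; apply/andP; split.
  by apply: Ex_le_cube => // t /fg->.
by apply: Ex_le_cube => // t /fg->.
Qed.

Lemma bm_approx (B : set X) (a : V -> R) : measurable B -> trig_poly a -> bm (fun t => `|\1_B t - a (rv t)|).
Proof. by move=> mB ta; apply: bm_abs; apply: bmB; [exact: bm_indic|exact: bm_tp]. Qed.

Lemma tp_approxC B : tp_approx B -> tp_approx (~` B).
Proof.
move=> [mB HB]; split=> [|e e0]; first exact: measurableC.
have [a [ta aB]] := HB e e0; exists (fun x => 1 - a x); split; first by apply: tpB => //; exact: tp_cst.
apply: le_lt_trans aB; apply: Ex_le.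
- by apply: (@bm_approx (~` B) (fun x => 1 - a x)); [exact: measurableC|apply: tpB => //; exact: tp_cst].
- exact: bm_approx.
- move=> t; rewrite !indicE in_setC (_ : (~~ (t \in B))%:R - (1 - a (rv t)) = - ((t \in B)%:R - a (rv t))) ?normrN//.
  by case: (t \in B) => /=; ring.
Qed.

Lemma tp_approxI B C : tp_approx B -> tp_approx C -> tp_approx (B `&` C).
Proof.
move=> [mB HB] [mC HC]; split=> [|e e0]; first exact: measurableI.
have e20 : 0 < e / 2 by rewrite divr_gt0.
have [a [ta aB]] := HB _ e20; have [M [M0 aM]] := tp_bounded ta.
have [|c [tc cC]] := HC (e / 2 / (M + 1)); first by rewrite divr_gt0// ltr_wpDl.
exists (fun x => a x * c x); split; first exact: tpM.
have bB := bm_approx mB ta; have bC := bm_approx mC tc.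
apply: (@le_lt_trans _ _ (E (fun t => `|\1_B t - a (rv t)| + (M + 1) * `|\1_C t - c (rv t)|))).
  apply: Ex_le.
  - by apply: (@bm_approx (B `&` C) (fun x => a x * c x)); [exact: measurableI|exact: tpM].
  - by apply: bmD => //; exact: bmZ.
  - move=> t; rewrite indicI/=.
    rewrite (_ : \1_B t * \1_C t - a (rv t) * c (rv t) = (\1_B t - a (rv t)) * \1_C t + a (rv t) * (\1_C t - c (rv t))); last by ring.
    rewrite (le_trans (ler_normD _ _))// lerD// normrM.
      by rewrite ler_piMr// indicE; case: (_ \in _); rewrite ?normr1 ?normr0.
    by rewrite ler_wpM2r// (le_trans (aM _))// lerDl.
rewrite ExD ?ExZ//; last exact: bmZ.
have : (M + 1) * E (fun t => `|\1_C t - c (rv t)|) < e / 2.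
  by rewrite mulrC -ltr_pdivlMr// ltr_wpDl.
lra.
Qed.

Lemma tp_approxT : tp_approx setT.
Proof.
split=> // e e0; exists (fun=> 1); split; first exact: tp_cst.
by under eq_fun do rewrite indicT subrr normr0; rewrite Ex_cst.
Qed.

Lemma tp_approxU B C : tp_approx B -> tp_approx C -> tp_approx (B `|` C).
Proof.
move=> aB aC; rewrite -[_ `|` _]setCK setCU; apply: tp_approxC; apply: tp_approxI; exact: tp_approxC.
Qed.

Lemma tp_approx_bigcup (F : (set X)^nat) : (forall i, tp_approx (F i)) -> tp_approx (\bigcup_i F i).
Proof.
move=> aF; have mU : measurable (\bigcup_i F i) by apply: bigcup_measurable => i _; case: (aF i).
split=> // e e0.
pose G i := \big[setU/set0]_(j < i) F j.
have aG i : tp_approx (G i).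
  rewrite /G; elim: i => [|i IH]; first by rewrite big_ord0 -setCT; apply: tp_approxC; exact: tp_approxT.
  by rewrite big_ord_recr/=; exact: tp_approxU.
have e20 : 0 < e / 2 by rewrite divr_gt0.
have [|||i Hi] := @Ex_cvg_abs _ _ _ (Lam R n) (fun i => \1_(G i)) (\1_(\bigcup_i F i) : X -> R) 1 _ (bm_indic R mU) _ _ _ e20.
- by move=> i; apply: bm_indic; case: (aG i).
- by move=> i x; rewrite indicE; case: (_ \in _); rewrite ?normr1 ?normr0.
- move=> t; have [Ut|nUt] := pselect ((\bigcup_i F i) t); last first.
    rewrite [X in _ --> X]indicE memNset//.
    under eq_fun => i.
      rewrite indicE memNset; last by move=> Gt; apply: nUt; move: Gt; rewrite /G -bigcup_mkord => -[j _ Fj]; exists j.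
      over.
    exact: cvg_cst.
  rewrite [X in _ --> X]indicE mem_set//; case: Ut => j _ Fj.
  apply: cvg_near_cst; exists j.+1 => // k /= jk.
  by rewrite indicE mem_set// /G -bigcup_mkord; exists j.
have [mG HG] := aG i; have [a [ta Ha]] := HG _ e20.
exists a; split=> //.
apply: (@le_lt_trans _ _ (E (fun t => `|\1_(G i) t - \1_(\bigcup_i F i) t| + `|\1_(G i) t - a (rv t)|))).
  apply: Ex_le.
  - exact: bm_approx.
  - apply: bmD; last exact: bm_approx.
    by apply: bm_abs; apply: bmB; exact: bm_indic.
  - by move=> t; rewrite (distrC (\1_(G i) t)); exact: ler_distD.
rewrite ExD; [lra| |exact: bm_approx].
by apply: bm_abs; apply: bmB; exact: bm_indic.
Qed.

Lemma tp_approx_eq_cube (B C : set X) : measurable C -> (forall t, unit_cube t -> B t <-> C t) -> tp_approx B -> tp_approx C.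
Proof.
move=> mC BC [mB HB]; split=> // e e0; have [a [ta Ha]] := HB _ e0.
exists a; split=> //; apply: le_lt_trans Ha; apply: Ex_le_cube; [exact: bm_approx|exact: bm_approx|].
by move=> t /BC H; rewrite !indicE (_ : (t \in C) = (t \in B))//; apply/idP/idP; rewrite !inE => /H.
Qed.

(* An arc of the circle is a superlevel set of a cosine *)
Lemma tp_approx_ray (i : 'I_n) (q : R) : tp_approx [set t : X | tnth t i <= q].
Proof.
have mB : measurable [set t : X | tnth t i <= q].
  rewrite (_ : [set t : X | _] = (fun t : X => tnth t i) @^-1` `]-oo, q]); last first.
    by apply/seteqP; split=> t /=; rewrite in_itv.
  by rewrite -[X in measurable X]setTI; apply: measurable_tnth.
have [q0|q0] := ltP q 0.
  apply: (@tp_approx_eq_cube set0) => //; last by rewrite -setCT; apply: tp_approxC; exact: tp_approxT.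
  by move=> t /(_ i)[t0 _]; split => //= tq; move: (le_lt_trans (le_trans t0 tq) q0); rewrite ltxx.
have [q1|q1] := leP 1 q.
  apply: (@tp_approx_eq_cube setT) => //; last exact: tp_approxT.
  by move=> t /(_ i)[_ t1]; split => //= _; rewrite ltW// (lt_le_trans t1).
pose f (x : R) : R := 2^-1 + (costau (x - q / 2) - costau (q / 2)) / 4.
have f01 x : 0 <= f x <= 1.
  by have := costau_le1 (x - q / 2); have := costau_le1 (q / 2); rewrite /f !ler_norml; lra.
have fq x : 0 <= x < 1 -> (2^-1 <= f x) = (x <= q).
  move=> x01; rewrite /f lerDl pmulr_lge0 ?invr_gt0// subr_ge0.
  have p0 := pi_gt0 R.
  have mono (u v : R) : 0 <= u <= 2^-1 -> 0 <= v <= 2^-1 -> (costau u <= costau v) = (v <= u).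
    move=> u2 v2; rewrite /costau leNgt ltr_cos ?in_itv/= -?leNgt; [by rewrite ler_pM2l// mulr_gt0|nra|nra].
  have [xq|xq] := leP (q / 2) x; last first.
    by rewrite -[costau (x - _)]costauN mono; [apply/idP/idP; lra|lra|lra].
  have [x2|x2] := leP (x - q / 2) 2^-1; first by rewrite mono; [apply/idP/idP; lra|lra|lra].
  have -> : costau (x - q / 2) = costau (1 - (x - q / 2)).
    by rewrite -[LHS]costauN -[LHS](costauDz _ 1); congr costau; rewrite (_ : 1%:~R = 1)//; ring.
  by rewrite mono; [apply/idP/idP; lra|lra|lra].
pose F k (x : V) : R := threshold k (f (x 0 i)).
have tF k : trig_poly (F k).
  rewrite /F /threshold; apply: tpB; first exact: tp_cst.
  apply: tp_exp; apply: tpB; first exact: tp_cst.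
  apply: tp_exp; rewrite /f; apply: tpD; first exact: tp_cst.
  under eq_fun do rewrite mulrC; apply: tpZ; apply: tpB; last exact: tp_cst.
  have := @tp_cs R n (delta_mx 0 i) (costau (q / 2)) (sintau (q / 2)).
  congr trig_poly; apply/funext => x; rewrite costauB mulrC [sintau _ * _]mulrC.
  have -> // : dot (delta_mx 0 i) x = x 0 i.
  rewrite /dot (bigD1 i)//= !mxE !eqxx mul1r big1 ?addr0// => j ji.
  by rewrite mxE (negbTE ji) andbF mul0r.
pose C := [set t : X | 2^-1 <= f (tnth t i)].
have mf : measurable_fun [set: X] (fun t : X => f (tnth t i)).
  rewrite /f; apply: measurable_funD => //; apply: measurable_funM => //; apply: measurable_funB => //.
  apply: measurableT_comp; first exact: measurable_costau.
  by apply: measurable_funB => //; exact: measurable_tnth.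
have mC : measurable C.
  rewrite (_ : C = (fun t : X => f (tnth t i)) @^-1` `[2^-1, +oo[); last first.
    by apply/seteqP; split=> t; rewrite /C /= in_itv/= andbT.
  by rewrite -[X in measurable X]setTI; exact: mf.
apply: (@tp_approx_eq_cube C) => //.
  by move=> t /(_ i)/andP ti; rewrite /C/= fq.
split=> // e e0.
have [|||k Hk] := @Ex_cvg_abs _ _ _ (Lam R n) (fun k => F k \o @rv R n) (\1_C : X -> R) 1 _ (bm_indic R mC) _ _ _ e0.
- by move=> k; exact: bm_tp.
- by move=> k t; have := @threshold01 R k _ (f01 (rv t 0 i)); rewrite /F /= ler_norml; lra.
- move=> t; rewrite /F /= mxE indicE; have := cvg_threshold (f01 (tnth t i)).
  by rewrite (_ : (t \in C) = (2^-1 <= f (tnth t i)))//; apply/idP/idP; rewrite inE.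
exists (F k); split=> //; apply: le_lt_trans Hk; apply: Ex_le.
- exact: bm_approx.
- by apply: bm_abs; apply: bmB; [exact: bm_tp|exact: bm_indic].
- by move=> t; rewrite distrC.
Qed.

Lemma tp_dense (B : set X) : measurable B -> tp_approx B.
Proof.
have s0 : tp_approx set0 by rewrite -setCT; apply: tp_approxC; exact: tp_approxT.
apply: smallest_sub.
  split => //; last exact: tp_approx_bigcup.
  by move=> C aC; rewrite setTD; exact: tp_approxC.
move=> C; rewrite -bigcup_seq/= => -[i _ [D mD <-]]; rewrite setTI.
suff : (@measurable _ R) `<=` [set D | tp_approx ((@tnth n R)^~ i @^-1` D)] by move=> /(_ _ mD).
have -> : @measurable _ R = (@RGenOInfty.G R).-sigma.-measurable by exact: RGenOInfty.measurableE.
apply: smallest_sub.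
  split.
  - by rewrite /= preimage_set0.
  - by move=> A aA /=; rewrite setTD preimage_setC; exact: tp_approxC.
  - by move=> F aF /=; rewrite preimage_bigcup; exact: tp_approx_bigcup.
move=> A [q ->] /=; rewrite (_ : _ @^-1` _ = ~` [set t : X | tnth t i <= q]).
  by apply: tp_approxC; exact: tp_approx_ray.
by apply/seteqP; split=> t /=; rewrite in_itv/= andbT ltNge => /negP.
Qed.
End density.

(** * Ergodicity and the vertical translation *)

Section ergodicity.
Variables (R : realType) (n : nat) (A : 'M[int]_n) (b : 'rV[R]_n).
Hypothesis Au : upper_unipotent A.
Hypothesis irr : irrational_invariants A b.
Hypothesis nil : nu_nilpotent A.
Notation X := (n.-tuple R).
Notation E := (Ex (Lam R n)).
Notation V := 'rV[R]_n.
Notation T := (Tlift A b).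
Notation Tc := (Tcube A b).

Lemma unit_cube_iter j (t : X) : unit_cube t -> unit_cube (iter j Tc t).
Proof. by case: j => // j _; rewrite iterS; exact: unit_cube_Tcube. Qed.

Section invariant_set.
Variable I : set X.
Hypothesis mI : measurable I.
Hypothesis TI : forall t, unit_cube t -> I (Tc t) <-> I t.

Lemma invariant_iter j t : unit_cube t -> I (iter j Tc t) <-> I t.
Proof.
move=> ut; elim: j => // j IH; rewrite iterS; split=> [/TI|] H.
  by apply/IH; apply: H; exact: unit_cube_iter.
by apply/TI; [exact: unit_cube_iter|apply/IH].
Qed.

(** As [I] and the measure are invariant, replacing [a] by [a] composed with an iterate does not
    change the left side; averaging over the iterates replaces [a] by [c]. *)
Lemma Ex_invariant_tp (a : V -> R) c : trig_poly a -> unif_avg A b a c ->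
  E (fun t => \1_I t * a (rv t)) = E \1_I * c.
Proof.
move=> ta Ha; have pa := tp_periodic ta.
have b1 : bm (\1_I : X -> R) by exact: bm_indic.
have ba := bm_tp ta.
have inv j : E (fun t => \1_I t * a (iter j T (rv t))) = E (fun t => \1_I t * a (rv t)).
  rewrite -(@Ex_iter_Tcube _ _ _ b Au (fun t => \1_I t * a (rv t)) j); last exact: bmM.
  apply: Ex_eq_cube.
  - by apply: bmM => //; exact: (bm_iter A b j pa ba).
  - apply: (@bm_comp _ _ _ _ _ (iter j Tc) (fun t => \1_I t * a (rv t))); [exact: measurable_iter_Tcube|exact: bmM].
  - move=> t ut /=; rewrite periodic_Tcube// !indicE (_ : (iter j Tc t \in I) = (t \in I))//.
    by apply/idP/idP; rewrite !inE => /(invariant_iter j ut).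
apply/eqP; rewrite -subr_eq0 -normr_le0; apply/ler_addgt0Pr => e e0.
have e20 : 0 < e / 2 by rewrite divr_gt0.
have [C HC] := Ha _ e20.
pose l := (Num.truncn (C * 2 / e)).+1.
have l0 : 0 < l%:R :> R by rewrite ltr0n.
have lC : C * 2 / e < l%:R by exact: truncnS_gt.
rewrite add0r -(ler_pM2l l0) -[X in X * _ <= _](ger0_norm (ltW l0)) -normrM.
have -> : l%:R * (E (fun t => \1_I t * a (rv t)) - E \1_I * c) =
    E (fun t => \1_I t * (bsumT A b a l (rv t) - l%:R * c)).
  have -> : (fun t => \1_I t * (bsumT A b a l (rv t) - l%:R * c)) =
    (fun t => \sum_(j < l) (\1_I t * a (iter j T (rv t))) - l%:R * c * \1_I t).
    by apply/funext => t; rewrite mulrBr mulr_sumr [X in _ - X]mulrC.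
  rewrite ExB; last 2 first.
  - by apply: bm_sum => j; apply: bmM => //; exact: (bm_iter A b j pa ba).
  - exact: bmZ.
  rewrite ExZ// Ex_sum; last by move=> j; apply: bmM => //; exact: (bm_iter A b j pa ba).
  under eq_bigr => j _ do rewrite inv.
  by rewrite sumr_const card_ord -[_ *+ l]mulr_natl; ring.
apply: le_trans (_ : e / 2 * l%:R + C <= _); last by move: lC; rewrite ltr_pdivrMr//; lra.
apply: Ex_norm_le => [|t].
  by apply: bmM => //; apply: bmB; [exact: bm_bsumT|exact: bm_cst].
rewrite normrM (le_trans _ (HC (rv t) l))// ler_piMl// indicE.
by case: (_ \in _); rewrite ?normr1 ?normr0.
Qed.

(** Take [a] close to the indicator of [I] in mean, with uniform average [c]. Then [p] is close to
    [c], and also to the expectation of the indicator times [a], which is [p * c]; so [p] is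
    arbitrarily close to [p ^ 2]. *)
Lemma ergodic : E \1_I = 0 \/ E \1_I = 1.
Proof.
set p := E \1_I.
have b1 : bm (\1_I : X -> R) by exact: bm_indic.
have p0 : 0 <= p by apply: Ex_ge0 => t; rewrite indicE.
have p1 : p <= 1 by apply: Ex_le_cst => // t; rewrite indicE; case: (_ \in _).
suff : p * (1 - p) = 0 by move=> /eqP; rewrite mulf_eq0 subr_eq0 => /orP[/eqP|/eqP<-]; [left|right].
apply/eqP; rewrite -normr_le0; apply/ler_addgt0Pr => e e0; rewrite add0r.
have e20 : 0 < e / 2 by rewrite divr_gt0.
have [_ /(_ _ e20)[a [ta Ha]]] := tp_dense mI.
have [c Hc] := unif_avg_tp irr nil ta.
have ba := bm_tp ta.
have Ea : E (a \o @rv R n) = c := Ex_unif_avg Au (tp_periodic ta) ba Hc.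
have h1 : `|p - c| <= e / 2.
  rewrite -Ea -ExB// ltW//; apply: le_lt_trans Ha; apply: Ex_abs; exact: bmB.
have h2 : `|p - p * c| <= e / 2.
  rewrite -(Ex_invariant_tp ta Hc).
  have -> : p = E (fun t => \1_I t * \1_I t).
    by congr (Ex _ _); apply/funext => t; rewrite indicE; case: (_ \in _); rewrite ?mul1r ?mul0r.
  rewrite -ExB; [|exact: bmM|exact: bmM].
  rewrite ltW//; apply: le_lt_trans Ha; apply: le_trans (Ex_abs _ _) _.
    by apply: bmB; exact: bmM.
  apply: Ex_le.
  - by apply: bm_abs; apply: bmB; exact: bmM.
  - exact: bm_approx.
  - move=> t; rewrite -mulrBr normrM ler_piMl// indicE.
    by case: (_ \in _); rewrite ?normr1 ?normr0.
have -> : p * (1 - p) = (p - p * c) - p * (p - c) by ring.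
rewrite (le_trans (ler_normB _ _))// normrM (ger0_norm p0).
have : p * `|p - c| <= `|p - c| by rewrite ler_piMl.
lra.
Qed.
End invariant_set.
End ergodicity.

Section fibre.
Variables (R : realType) (n : nat).
Notation V := 'rV[R]_n.+1.
Notation ed := (@e_ R n.+1 ord_max).

Definition vert (x : V) (s : R) : V := x + s *: ed.

Lemma dot_vert m x s : dot m (vert x s) = dot m x + (m 0 ord_max)%:~R * s.
Proof. by rewrite /vert dotD dotZ dot_delta mulrC. Qed.

Lemma vert0 x : vert x 0 = x. Proof. by rewrite /vert scale0r addr0. Qed.

Lemma vertD x s s' : vert (vert x s) s' = vert x (s + s').
Proof. by rewrite /vert scalerDl addrA. Qed.

Lemma vert1 f x : periodic f -> f (vert x 1) = f x.
Proof.
move=> pf; rewrite /vert scale1r -(pf x (delta_mx 0 ord_max)); congr (f (_ + _)).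
by apply/rowP => i; rewrite !mxE; case: (_ && _).
Qed.

Lemma fibre_decomposition (Psi : V -> R) : trig_poly Psi ->
  exists D Psi0 (a c : nat -> V -> R), [/\ trig_poly Psi0, forall q, trig_poly (a q), forall q, trig_poly (c q),
    forall x s, Psi0 (vert x s) = Psi0 x &
    forall x s, Psi (vert x s) = trigp D (Psi0 x) (a ^~ x) (c ^~ x) s].
Proof.
(* Strengthened to all degrees [D >= D0], so that terms of different degrees can be brought to a
   common one in the induction. *)
suff : trig_poly Psi ->
  exists D0 Psi0 (a c : nat -> V -> R), [/\ trig_poly Psi0, forall q, trig_poly (a q) /\ trig_poly (c q),
    forall x s, Psi0 (vert x s) = Psi0 x &
    forall D x s, (D0 <= D)%N -> Psi (vert x s) = trigp D (Psi0 x) (a ^~ x) (c ^~ x) s].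
  move=> H /H[D [Psi0 [a [c [t0 tac v H2]]]]]; exists D, Psi0, a, c; split=> //.
  - by move=> q; case: (tac q).
  - by move=> q; case: (tac q).
  - by move=> x s; exact: H2.
move: Psi; apply: tp_ind => [|m al be f _ [D0 [Psi0 [a [c [t0 tac v H]]]]]].
  exists 0%N, (fun=> 0), (fun _ _ => 0), (fun _ _ => 0); split=> //; first exact: tp_cst.
    by move=> q; split; exact: tp_cst.
  by move=> D x s _; rewrite /trigp big1 ?addr0// => i _; ring.
set M := fun x => al * costau (dot m x) + be * sintau (dot m x).
have tM : trig_poly M by exact: tp_cs.
(* The companion of [M] under a quarter turn: by the addition formulas the term at [vert x s] is
   [M x] times a cosine plus or minus [Ms x] times a sine. *)
pose Ms := fun x => be * costau (dot m x) - al * sintau (dot m x).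
have tMs : trig_poly Ms.
  have := tp_cs m be (- al); congr trig_poly.
  by apply/funext => x; rewrite /Ms mulNr.
have [md|md] := eqVneq (m 0 ord_max) 0.
  exists D0, (fun x => M x + Psi0 x), a, c; split=> //; first exact: tpD.
    by move=> x s; rewrite v /M dot_vert md mul0r addr0.
  move=> D x s HD; rewrite (H D x s HD) /trigp dot_vert md mul0r addr0 -/(M x); ring.
(* The frequencies in [trigp] are [q + 1], hence the predecessor; a negative vertical frequency only
   changes the sign [sg] of the sine. *)
pose q0 := (absz (m 0 ord_max)).-1.
have q0E : q0.+1 = absz (m 0 ord_max) by rewrite prednK// absz_gt0.
pose sg : R := (Num.sg (m 0 ord_max))%:~R.
have sgE : (m 0 ord_max)%:~R = sg * q0.+1%:R.
  rewrite q0E /sg natr_absz -intrM; congr (_%:~R); rewrite {1}[m 0 ord_max]numEsg//.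
exists (maxn D0 q0.+1), Psi0, (fun q x => a q x + (q == q0)%:R * M x),
  (fun q x => c q x + (q == q0)%:R * (sg * Ms x)); split=> //.
  move=> q; have [ta tc] := tac q; split; apply: tpD => //; apply: tpZ => //.
  exact: tpZ.
move=> D x s; rewrite geq_max => /andP[HD qD].
rewrite (H D x s HD) /trigp addrCA; congr (_ + _).
have -> : \sum_(q < D) ((a q x + (q == q0 :> nat)%:R * M x) * costau (q.+1%:R * s) +
    (c q x + (q == q0 :> nat)%:R * (sg * Ms x)) * sintau (q.+1%:R * s)) =
  \sum_(q < D) (a q x * costau (q.+1%:R * s) + c q x * sintau (q.+1%:R * s)) +
  \sum_(q < D) (q == q0 :> nat)%:R * (M x * costau (q.+1%:R * s) + sg * Ms x * sintau (q.+1%:R * s)).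
  by rewrite -big_split/=; apply: eq_bigr => q _; ring.
rewrite addrC; congr (_ + _).
rewrite (bigD1 (Ordinal qD))//= eqxx mul1r big1 ?addr0; last first.
  by move=> i iq; rewrite (_ : (i == q0 :> nat) = false) ?mul0r//; apply/negbTE; apply: contra iq => /eqP h; apply/eqP/val_inj.
rewrite dot_vert sgE /M /Ms costauD sintauD.
have sgc : costau (sg * q0.+1%:R * s) = costau (q0.+1%:R * s) /\ sintau (sg * q0.+1%:R * s) = sg * sintau (q0.+1%:R * s).
  rewrite /sg; case: sgrP md => // _ _.
    by rewrite !mul1r.
  by rewrite mulrN1z !mulN1r !mulNr costauN sintauN.
by rewrite sgc.1 sgc.2; ring.
Qed.
End fibre.

(** * The maximal inequality *)

Section tent.
Variables (R : realType) (K : R).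
Hypothesis K0 : 0 < K.

(** A Lipschitz substitute for the indicator of [[-K, K]]: averages of it depend on the height in a
    Lipschitz way, on which [recurrent_open] and [recurrent_bounded] rest. *)
Definition tent (y : R) : R := Num.max 0 (1 - `|y| / K).

Lemma tent_ge0 y : 0 <= tent y. Proof. by rewrite le_max lexx. Qed.

Lemma tent_le1 y : tent y <= 1.
Proof. by rewrite ge_max ler01/= lerBlDr lerDl divr_ge0// ltW. Qed.

Lemma tent_out y : K <= `|y| -> tent y = 0.
Proof. by move=> Ky; apply/max_idPl; rewrite subr_le0 ler_pdivlMr// mul1r. Qed.

Lemma tent_half y : `|y| <= K / 2 -> 2^-1 <= tent y.
Proof.
move=> Ky; rewrite le_max; apply/orP; right.
have : `|y| / K <= 2^-1 by rewrite ler_pdivrMr// mulrC.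
lra.
Qed.

Lemma tent_lip y y' : `|tent y - tent y'| <= `|y - y'| / K.
Proof.
have H : `|(1 - `|y| / K) - (1 - `|y'| / K)| <= `|y - y'| / K.
  rewrite (_ : 1 - `|y| / K - (1 - `|y'| / K) = (`|y'| - `|y|) / K); last by ring.
  have c0 : 0 <= K^-1 by rewrite invr_ge0 ltW.
  by rewrite normrM [`|K^-1|]ger0_norm// ler_wpM2r// (distrC y y') ler_dist_dist.
rewrite /tent; move: H; set u := 1 - _; set v := 1 - `|y'| / K => H.
apply: le_trans H; rewrite /Num.max; case: ltP => hu; case: ltP => hv.
- by [].
- rewrite subr0 (ger0_norm (ltW hu)) (le_trans _ (ler_norm _))// lerDl; lra.
- rewrite sub0r normrN (ger0_norm (ltW hv)) distrC (le_trans _ (ler_norm _))// lerDl; lra.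
- by rewrite subrr normr0.
Qed.

Lemma measurable_tent : measurable_fun [set: R] tent.
Proof.
apply: measurable_maxr => //; apply: measurable_funB => //.
by apply: measurable_funM => //; exact: measurableT_comp.
Qed.

End tent.

Section maximal.
Variables (R : realType) (n : nat) (A : 'M[int]_n) (b : 'rV[R]_n).
Hypothesis Au : upper_unipotent A.
Notation X := (n.-tuple R).
Notation V := 'rV[R]_n.
Notation T := (Tlift A b).
Notation Tc := (Tcube A b).
Notation mu := (@lebesgue_measure R).
Variable f : V -> R.
Hypothesis tf : trig_poly f.
Variables (K : R).
Hypothesis K0 : 0 < K.

Lemma bsumTS l x : bsumT A b f l.+1 x = f x + bsumT A b f l (T x).
Proof.
rewrite /bsumT big_ord_recl/=; congr (_ + _).
by apply: eq_bigr => j _; rewrite add0n -iterS iterSr.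
Qed.

Lemma bsumT_Tcube l (t : X) : bsumT A b f l (rv (Tc t)) = bsumT A b f l (T (rv t)).
Proof. by have := periodic_Tcube A b 1 t (periodic_bsumT A b l (tp_periodic tf)). Qed.

Definition skew (p : X * R) : X * R := (Tc p.1, p.2 + f (rv p.1)).

Notation prodm := (Lam R n \x mu)%E.

Lemma measurable_f_fst : measurable_fun [set: X * R] (fun p : X * R => f (rv p.1)).
Proof. by apply: (@measurableT_comp _ _ _ _ _ _ (f \o @rv R n)) => //; exact: bm_measurable (bm_tp tf). Qed.

Lemma measurable_skew : measurable_fun [set: X * R] skew.
Proof.
apply: measurable_fun_pair; first by apply: measurableT_comp => //; exact: measurable_Tcube.
by apply: measurable_funD => //; exact: measurable_f_fst.
Qed.

Lemma integral_skew (F : X * R -> \bar R) : measurable_fun [set: X * R] F -> (forall p, 0 <= F p)%E ->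
  (\int[prodm]_p F (skew p) = \int[prodm]_p F p)%E.
Proof.
move=> mF F0.
rewrite fubini_tonelli1 ?fubini_tonelli1//; last by apply: measurableT_comp => //; exact: measurable_skew.
transitivity (\int[Lam R n]_t fubini_F mu F (Tc t))%E; last first.
  apply: (integral_Tcube b Au (f := fubini_F mu F)).
    exact: measurable_fun_fubini_tonelli_F.
  by move=> x; apply: integral_ge0 => y _; exact: F0.
apply: eq_integral => t _; rewrite /fubini_F /skew/=.
have := @ge0_integral_shift R (f (rv t)) setT (fun y => F (Tc t, y)) measurableT.
by rewrite preimage_setT; apply => //; exact: measurable_fun_pair2.
Qed.

(** The largest Birkhoff sum of [tent K - a] for the skew product over at most [L] steps, empty sum
    included, in the recursive form that Garsia's argument uses. *)
Fixpoint maxf (a : R) (L : nat) (p : X * R) : R :=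
  if L is L'.+1 then Num.max 0 (tent K p.2 - a + maxf a L' (skew p)) else 0.

Lemma maxf_ge0 a L p : 0 <= maxf a L p.
Proof. by case: L => //= L; rewrite le_max lexx. Qed.

Lemma measurable_maxf a L : measurable_fun [set: X * R] (maxf a L).
Proof.
elim: L => [|L IH]; first exact: measurable_cst.
apply: measurable_maxr => //; apply: measurable_funD.
  by apply: measurable_funB => //; apply: measurableT_comp => //; exact: measurable_tent.
by apply: measurableT_comp => //; exact: measurable_skew.
Qed.

Lemma maxf_homo a L p : maxf a L p <= maxf a L.+1 p.
Proof.
elim: L p => [|L IH] p; first exact: maxf_ge0.
by rewrite /= le_max2 // lerD2l; exact: IH.
Qed.

Lemma maxf_ge a L N t y : (N <= L)%N ->
  \sum_(j < N) (tent K (y + bsumT A b f j (rv t)) - a) <= maxf a L (t, y).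
Proof.
elim: L N t y => [|L IH] [|N] t y //; rewrite ?big_ord0 ?maxf_ge0// ltnS => NL.
rewrite big_ord_recl /= le_max; apply/orP; right.
rewrite {1}/bsumT big_ord0 addr0 lerD2l.
apply: le_trans (IH N (Tc t) (y + f (rv t)) NL); rewrite le_eqVlt; apply/orP; left; apply/eqP.
by apply: eq_bigr => j _; rewrite /bump/= add1n bsumTS bsumT_Tcube addrA.
Qed.

Let I := (\int[prodm]_p (tent K p.2)%:E)%E.

Let mtent : measurable_fun [set: X * R] (fun p : X * R => (tent K p.2)%:E).
Proof. by apply/measurable_EFinP; apply: measurableT_comp => //; exact: measurable_tent. Qed.

Lemma integral_tent_fin : (I < +oo)%E.
Proof.
apply: (@le_lt_trans _ _ (2 * K)%:E); last exact: ltry.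
rewrite /I fubini_tonelli1//; last by move=> p; rewrite lee_fin tent_ge0.
apply: (@le_trans _ _ (\int[Lam R n]_t (2 * K)%:E)%E); last first.
  by rewrite integral_cst// [X in (_ * X)%E]probability_setT mule1.
apply: ge0_le_integral => //.
- by move=> t _; apply: integral_ge0 => y _; rewrite lee_fin tent_ge0.
- by apply: measurable_fun_fubini_tonelli_F => // p; rewrite lee_fin tent_ge0.
move=> t _; rewrite /fubini_F/=.
apply: (@le_trans _ _ (\int[mu]_y (\1_(`[- K, K]%classic : set R) y)%:E)%E).
  apply: ge0_le_integral => //.
  - by move=> y _; rewrite lee_fin tent_ge0.
  - by apply/measurable_EFinP; exact: measurable_tent.
  - by apply/measurable_EFinP; exact: measurable_indic.
  move=> y _; rewrite lee_fin indicE.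
  have [yK|yK] := boolP (y \in _); first exact: tent_le1.
  rewrite tent_out// leNgt; apply: contra yK => yK.
  by rewrite inE/= in_itv/= -ler_norml ltW.
rewrite integral_indic// setIT.
apply: le_trans (_ : (lebesgue_measure `[(- K)%R, K]%classic <= _)%E); first exact: lexx.
by rewrite lebesgue_measure_itv/= lte_fin; case: ifP => _; rewrite -?EFinB lee_fin ?opprK ?mulr_ge0 ?(ltW K0)// -mulr2n mulr_natl.
Qed.

Let mmax a L : measurable_fun [set: X * R] (fun p => (maxf a L p)%:E).
Proof. by apply/measurable_EFinP; exact: measurable_maxf. Qed.

Let max0 a L p : (0 <= (maxf a L p)%:E)%E. Proof. by rewrite lee_fin maxf_ge0. Qed.

Lemma integral_maxf_fin a L : 0 <= a -> (\int[prodm]_p (maxf a L p)%:E < +oo)%E.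
Proof.
move=> a0; elim: L => [|L IH]; first by rewrite integral0_eq.
apply: (@le_lt_trans _ _ (I + \int[prodm]_p (maxf a L (skew p))%:E)%E); last first.
  by rewrite (integral_skew (F := fun p => (maxf a L p)%:E))// lte_add_pinfty// integral_tent_fin.
rewrite /I -ge0_integralD//; last 2 first.
- by move=> p _; rewrite lee_fin tent_ge0.
- by apply/measurable_EFinP; apply: measurableT_comp; [exact: measurable_maxf|exact: measurable_skew].
apply: ge0_le_integral => //.
- exact: mmax.
- apply: emeasurable_funD => //.
  by apply/measurable_EFinP; apply: measurableT_comp; [exact: measurable_maxf|exact: measurable_skew].
move=> p _; rewrite -EFinD lee_fin/= ge_max addr_ge0 ?tent_ge0 ?maxf_ge0//=.
by rewrite lerD2r lerBlDr lerDl.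
Qed.

Definition max_pos a L := [set p | 0 < maxf a L p].

Lemma measurable_max_pos a L : measurable (max_pos a L).
Proof.
rewrite (_ : max_pos a L = maxf a L @^-1` `]0, +oo[); last first.
  by apply/seteqP; split=> p; rewrite /max_pos/= in_itv/= andbT.
by rewrite -[X in measurable X]setTI; apply: measurable_maxf.
Qed.

(* Hopf's maximal inequality, by Garsia's argument, on the infinite measure space [X * R]. *)
Lemma maximal_inequality a L : 0 < a -> (a%:E * prodm (max_pos a L) <= I)%E.
Proof.
move=> a0; case: L => [|L].
  rewrite (_ : max_pos a 0 = set0) ?measure0 ?mule0; first by apply: integral_ge0 => p _; rewrite lee_fin tent_ge0.
  by apply/seteqP; split=> p //; rewrite /max_pos/= ltxx.
have mms : measurable_fun [set: X * R] (fun p => (maxf a L (skew p))%:E).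
  by apply/measurable_EFinP; apply: measurableT_comp; [exact: measurable_maxf|exact: measurable_skew].
have mind : measurable_fun [set: X * R] (fun p : X * R => (a * \1_(max_pos a L.+1) p)%:E).
  by apply/measurable_EFinP; apply: measurable_funM => //; apply: measurable_indic; exact: measurable_max_pos.
have H : (\int[prodm]_p (maxf a L.+1 p)%:E + a%:E * prodm (max_pos a L.+1) <= I + \int[prodm]_p (maxf a L.+1 p)%:E)%E.
  apply: (@le_trans _ _ (I + \int[prodm]_p (maxf a L (skew p))%:E)%E); last first.
    rewrite (integral_skew (F := fun p => (maxf a L p)%:E))// leeD2l//.
    by apply: ge0_le_integral => //; [exact: mmax|exact: mmax|move=> p _; rewrite lee_fin maxf_homo].
  have -> : (a%:E * prodm (max_pos a L.+1) = \int[prodm]_p (a * \1_(max_pos a L.+1) p)%:E)%E.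
    under eq_integral do rewrite EFinM.
    rewrite ge0_integralZl//; last 2 first.
    - by apply/measurable_EFinP; apply: measurable_indic; exact: measurable_max_pos.
    - by rewrite lee_fin ltW.
    by rewrite integral_indic ?setIT//; exact: measurable_max_pos.
  rewrite /I -!ge0_integralD//; last 3 first.
  - by move=> p _; rewrite lee_fin tent_ge0.
  - exact: mmax.
  - by move=> p _; rewrite lee_fin mulr_ge0// ltW.
  apply: ge0_le_integral => //.
  - by move=> p _; rewrite adde_ge0// lee_fin ?maxf_ge0// mulr_ge0// ltW.
  - by apply: emeasurable_funD; [exact: mmax|exact: mind].
  - by apply: emeasurable_funD; [exact: mtent|exact: mms].
  move=> p _; rewrite -!EFinD lee_fin indicE.
  have [|] := boolP (p \in _).
    rewrite inE /max_pos/= lt_max ltxx/=; move: (tent K p.2) (maxf a L _) => u v h.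
    by rewrite mulr1 (max_idPr (ltW h)) addrAC subrK.
  rewrite notin_setE /max_pos/= => /negP; rewrite -leNgt => h; rewrite mulr0 addr0 (le_trans h)// addr_ge0 ?tent_ge0 ?maxf_ge0//.
have fin : (\int[prodm]_p (maxf a L.+1 p)%:E)%E \is a fin_num.
  by rewrite ge0_fin_numE; [exact/integral_maxf_fin/ltW|apply: integral_ge0 => p _; exact: max0].
by move: H; rewrite addeC leeD2rE.
Qed.

Definition avg (N : nat) (t : X) (y : R) : R := N%:R^-1 * \sum_(j < N) tent K (y + bsumT A b f j (rv t)).

Lemma avg_max_pos a N t y : (0 < N)%N -> a < avg N t y -> max_pos a N (t, y).
Proof.
move=> N0 H; rewrite /max_pos/=; apply: lt_le_trans (maxf_ge a t y (leqnn N)).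
rewrite sumrB sumr_const card_ord subr_gt0 -[a *+ N]mulr_natl.
by move: H; rewrite /avg mulrC ltr_pdivlMr ?ltr0n// mulrC.
Qed.

Definition max_all a := \bigcup_L max_pos a L.

Lemma measurable_max_all a : measurable (max_all a).
Proof. by apply: bigcup_measurable => L _; exact: measurable_max_pos. Qed.

(** The bound given by the maximal inequality does not depend on [L], so it survives the increasing
    union. *)
Lemma max_all_fin a : 0 < a -> (prodm (max_all a) < +oo)%E.
Proof.
move=> a0; apply: (@le_lt_trans _ _ (a^-1%:E * I)%E); last first.
  by rewrite lte_mul_pinfty ?integral_tent_fin// lee_fin invr_ge0 ltW.
have H : (prodm \o max_pos a) L @[L --> \oo] --> prodm (max_all a).
  apply: nondecreasing_cvg_mu; [exact: measurable_max_pos|exact: measurable_max_all|].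
  apply: homo_leq => [|? ? ?|L]; [exact: lexx|exact: le_trans|].
  by apply/subsetPset => p; rewrite /max_pos/= => h; apply: lt_le_trans h (maxf_homo _ _ _).
rewrite -(cvg_lim _ H)//; apply: lime_le; first by apply/cvg_ex; eexists; exact: H.
apply: nearW => L /=; rewrite -lee_pdivrMl ?invr_gt0// invrK.
exact: maximal_inequality.
Qed.

End maximal.

(** * Growth of Birkhoff sums on average *)

Section infinitely_often.
Variable (R : realType).

(* [io c g] says that [limsup g > c]. *)
Definition io (c : R) (g : nat -> R) :=
  exists i : nat, forall N0 : nat, exists2 N, (N0 <= N)%N & c + i.+1%:R^-1 < g N.

Lemma io_perturb c (g h : nat -> R) : (forall N, (0 < N)%N -> g N - h N <= N%:R^-1) -> io c g -> io c h.
Proof.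
(* Half of the margin [1 / (i + 1)] is kept, and the other half absorbs [1 / N]. *)
move=> gh [i Hi]; exists (i.+1).*2 => N0.
have [N NN gN] := Hi (maxn N0 (i.+1).*2.+1).
have N0N : (N0 <= N)%N by rewrite (leq_trans _ NN)// leq_maxl.
have iN : ((i.+1).*2.+1 <= N)%N by rewrite (leq_trans _ NN)// leq_maxr.
exists N => //; have Np : (0 < N)%N by apply: leq_trans iN.
have := gh _ Np => gh1.
have h1 : N%:R^-1 <= ((i.+1).*2.+1)%:R^-1 :> R by rewrite lef_pV2 ?posrE ?ltr0n// ler_nat.
have h2 : ((i.+1).*2.+1)%:R^-1 <= i.+1%:R^-1 / 2 :> R.
  by rewrite -invfM lef_pV2 ?posrE ?mulr_gt0 ?ltr0n// -natrM ler_nat muln2 leqnSn.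
move: gN gh1 h1 h2; move: (N%:R^-1) (_.*2.+1%:R^-1) (i.+1%:R^-1) => x y z; lra.
Qed.

Lemma io_close c (g : nat -> R) : io c g -> exists2 e, 0 < e &
  forall h : nat -> R, (forall N, g N - h N <= e) -> io c h.
Proof.
move=> [i Hi]; exists (i.+1%:R^-1 / 2) => [|h gh]; first by rewrite divr_gt0.
exists (i.+1).*2 => N0; have [N NN gN] := Hi N0; exists N => //.
have h2 : ((i.+1).*2.+1)%:R^-1 <= i.+1%:R^-1 / 2 :> R.
  by rewrite -invfM lef_pV2 ?posrE ?mulr_gt0 ?ltr0n// -natrM ler_nat muln2 leqnSn.
have := gh N; move: gN h2; move: (_.*2.+1%:R^-1) (i.+1%:R^-1) => x y; lra.
Qed.

Lemma io_gt c (g : nat -> R) : io c g -> exists2 N, (0 < N)%N & c < g N.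
Proof.
move=> [i /(_ 1) [N N1 gN]]; exists N => //.
by apply: lt_trans gN; rewrite ltrDl.
Qed.

Lemma measurable_io d (T : measurableType d) c (g : nat -> T -> R) :
  (forall N, measurable_fun [set: T] (g N)) -> measurable [set t | io c (g ^~ t)].
Proof.
move=> mg.
rewrite (_ : [set t | _] = \bigcup_i \bigcap_N0 \bigcup_N
    (if (N0 <= N)%N then g N @^-1` `]c + i.+1%:R^-1, +oo[ else set0)).
  apply: bigcupT_measurable => i; apply: bigcapT_measurable => N0; apply: bigcupT_measurable => N.
  by case: ifP => // _; rewrite -[X in measurable X]setTI; apply: mg.
apply/seteqP; split=> t /=.
  by move=> [i Hi]; exists i => // N0 _; have [N NN h] := Hi N0; exists N => //; rewrite NN/= in_itv/= h.
move=> [i _ Hi]; exists i => N0; have [N _] := Hi N0 I.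
by case: ifP => // NN /=; rewrite in_itv/= andbT => h; exists N.
Qed.

End infinitely_often.

Section sup_measurable.
Context d (T : measurableType d) (R : realType).

(* For sections [S t] that are open (only from the left is needed), [sup (S t)] is determined by the rational points of [S t]. *)
Lemma measurable_sup (S : T -> set R) :
  (forall y, measurable [set t | S t y]) ->
  (forall t y, S t y -> exists2 e, 0 < e & forall y', y - e < y' <= y -> S t y') ->
  measurable_fun [set: T] (fun t => sup (S t)).
Proof.
move=> mS oS.
have ratS t y r : S t y -> r < y -> exists q : rat, S t (ratr q) /\ r < ratr q.
  move=> Sy ry; have [e e0 He] := oS _ _ Sy.
  have : Num.max r (y - e) < y by rewrite gt_max ry ltrBlDr ltrDl.
  move=> /rat_in_itvoo[q]; rewrite in_itv/= gt_max -andbA => /and3P[rq qe qy].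
  by exists q; split=> //; apply: He; rewrite qe ltW.
pose gtS (r : R) : set T := \bigcup_(q : rat) (if r < ratr q then [set t | S t (ratr q)] else set0).
have gtE r t : gtS r t <-> exists2 y, S t y & r < y.
  split=> [[q _]|[y Sy ry]]; first by case: ifP => // rq Sq; exists (ratr q).
  by have [q [Sq rq]] := ratS _ _ _ Sy ry; exists q => //; rewrite rq.
have mgt r : measurable (gtS r).
  by apply: bigcupT_measurable_rat => q; case: ifP.
pose ne : set T := \bigcup_(m : nat) gtS (- m%:R).
pose nb : set T := \bigcap_(m : nat) gtS m%:R.
have neE t : ne t <-> (S t !=set0).
  split=> [[m _ /gtE[y Sy _]]|[y Sy]]; first by exists y.
  exists (Num.bound `|y|) => //; apply/gtE; exists y => //.
  by rewrite ltrNl (le_lt_trans (ler_norm _))// normrN archi_boundP//.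
have nbE t : nb t <-> ~ has_ubound (S t).
  split=> [Ht [M HM]|H m _].
    have /gtE[y Sy My] := Ht (Num.bound `|M|) I.
    have := HM _ Sy; apply/negP; rewrite -ltNge (le_lt_trans (ler_norm _))//.
    by rewrite (lt_trans _ My)// archi_boundP.
  apply/gtE; apply: contrapT => h; apply: H; exists m%:R => y Sy.
  by rewrite leNgt; apply/negP => my; apply: h; exists y.
apply: (measurability _ (RGenOInfty.measurableE R)) => //.
move=> /= _ [_ [r ->] <-]; rewrite setTI.
pose hs : set T := ne `&` ~` nb.
have hsE t : hs t <-> has_sup (S t).
  split=> [[/neE ? h]|[/neE ? h]]; split=> //; last by move=> /nbE.
  by apply: contrapT => h'; apply: h; apply/nbE.
have mhs : measurable hs.
  apply: measurableI; first by apply: bigcupT_measurable.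
  by apply: measurableC; apply: bigcapT_measurable.
(* [sup] is zero where there is no supremum, which counts exactly when [r < 0]. *)
rewrite (_ : _ @^-1` _ = (hs `&` gtS r) `|` (if r < 0 then ~` hs else set0)).
  apply: measurableU; first exact: measurableI.
  by case: ifP => // _; exact: measurableC.
apply/seteqP; split=> t /=; rewrite in_itv/= andbT.
  have [h|h] := pselect (has_sup (S t)).
    move=> rs; left; split; first exact/hsE.
    by have [y Sy ry] := sup_gt h.1 rs; apply/gtE; exists y.
  by rewrite sup_out// => ->; right => /hsE.
move=> [[/hsE h /gtE[y Sy ry]]|].
  by apply: lt_le_trans ry _; apply: (ub_le_sup h.2).
by case: ifP => // r0 h; rewrite sup_out// => /hsE.
Qed.

Lemma sup_shift (Y Z : set R) c : has_sup Y -> (forall y, Y (y - c) <-> Z y) -> sup Z = sup Y + c.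
Proof.
move=> hY YZ; have ZY y : Y y -> Z (y + c) by move=> h; apply/YZ; rewrite addrK.
have hZ : has_sup Z.
  split; first by have [y Yy] := hY.1; exists (y + c); exact: ZY.
  exists (sup Y + c) => z /YZ Yz; rewrite -lerBlDr; exact: (ub_le_sup hY.2).
apply/le_anti/andP; split.
  by apply: ge_sup hZ.1 _ => z /YZ Yz; rewrite -lerBlDr; exact: (ub_le_sup hY.2).
rewrite -lerBrDr; apply: ge_sup hY.1 _ => y Yy; rewrite lerBrDr.
by apply: (ub_le_sup hZ.2); exact: ZY.
Qed.

End sup_measurable.

Section cesaro.
Variables (R : realType) (n : nat) (A : 'M[int]_n) (b : 'rV[R]_n).
Hypothesis Au : upper_unipotent A.
Hypothesis irr : irrational_invariants A b.
Hypothesis nil : nu_nilpotent A.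
Notation X := (n.-tuple R).
Notation V := 'rV[R]_n.
Notation T := (Tlift A b).
Notation Tc := (Tcube A b).
Notation P := (Lam R n).
Notation E := (Ex (Lam R n)).
Notation mu := (@lebesgue_measure R).
Variable f : V -> R.
Hypothesis tf : trig_poly f.

Section fixed_scale.
Variables (K : R).
Hypothesis K0 : 0 < K.
Notation avg := (avg A b f K).

Lemma avg_lip N t y y' : `|avg N t y - avg N t y'| <= `|y - y'| / K.
Proof.
rewrite /avg; case: N => [|N]; first by rewrite !big_ord0 !mulr0 subrr normr0 divr_ge0// ltW.
rewrite -mulrBr normrM ger0_norm// ler_pdivrMl// -sumrB.
apply: le_trans (ler_norm_sum _ _ _) _.
rewrite [leRHS](_ : _ = \sum_(j < N.+1) (`|y - y'| / K)); last by rewrite sumr_const card_ord mulr_natl.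
apply: ler_sum => j _.
by apply: le_trans (tent_lip K0 _ _) _; rewrite opprD addrACA subrr addr0.
Qed.

(** A shift by one step along the orbit changes the sum by its two end terms only, each between 0
    and 1. *)
Lemma avg_shift N t y : (0 < N)%N -> `|avg N (Tc t) y - avg N t (y - f (rv t))| <= N%:R^-1.
Proof.
move=> N0; rewrite /avg -mulrBr normrM ger0_norm// ler_piMr//.
have -> : \sum_(j < N) tent K (y + bsumT A b f j (rv (Tc t))) =
    \sum_(j < N) tent K (y - f (rv t) + bsumT A b f j.+1 (rv t)).
  by apply: eq_bigr => j _; rewrite bsumTS bsumT_Tcube// addrA subrK.
rewrite -sumrB (eq_bigr (fun j : 'I_N => (fun i => tent K (y - f (rv t) + bsumT A b f i (rv t))) j.+1
    - (fun i => tent K (y - f (rv t) + bsumT A b f i (rv t))) j))//.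
rewrite -(big_mkord xpredT (fun j => (fun i => tent K (y - f (rv t) + bsumT A b f i (rv t))) j.+1
    - (fun i => tent K (y - f (rv t) + bsumT A b f i (rv t))) j)) telescope_sumr//.
have := tent_ge0 K (y - f (rv t) + bsumT A b f N (rv t)).
have := tent_le1 K0 (y - f (rv t) + bsumT A b f N (rv t)).
have := tent_ge0 K (y - f (rv t) + bsumT A b f 0 (rv t)).
have := tent_le1 K0 (y - f (rv t) + bsumT A b f 0 (rv t)).
by rewrite ler_norml; lra.
Qed.

Lemma measurable_avg N y : measurable_fun [set: X] (avg N ^~ y).
Proof.
apply: measurable_funM => //; apply: measurable_sum => j.
apply: (measurableT_comp (measurable_tent K)); apply: measurable_funD => //.
exact: (bm_measurable (bm_bsumT A b j (tp_periodic tf) (bm_tp tf))).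
Qed.

Lemma avg_bounds N t y : 0 <= avg N t y <= 1.
Proof.
rewrite /avg; case: N => [|N]; first by rewrite big_ord0 mulr0 lexx ler01.
rewrite mulr_ge0//=; last by apply: sumr_ge0 => j _; exact: tent_ge0.
rewrite ler_pdivrMl// mulr1 -[X in _ <= X%:R](card_ord N.+1) -sumr_const.
by apply: ler_sum => j _; exact: tent_le1.
Qed.

(** The heights from which the skew product comes back near zero with upper frequency, weighted by
    the tent, more than [c]. By [recurrent_shift] this set is translated by [f] along the orbit, so
    its supremum, where finite, is a transfer function. *)
Definition recurrent c (t : X) : set R := [set y | io c (avg ^~ t ^~ y)].
Notation Y := recurrent.

Lemma recurrent_shift c t y : Y c t (y - f (rv t)) <-> Y c (Tc t) y.
Proof.
split; apply: io_perturb => N N0; have := avg_shift t y N0; rewrite ler_norml; lra.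
Qed.

Lemma recurrent_open c t y : Y c t y -> exists2 e, 0 < e & forall y', y - e < y' <= y -> Y c t y'.
Proof.
move=> /io_close[e e0 He]; exists (e * K); first by rewrite mulr_gt0.
move=> y' /andP[h1 h2]; apply: He => N; apply: le_trans (ler_norm _) _.
apply: le_trans (avg_lip _ _ _ _) _; rewrite ler_pdivrMr// ger0_norm ?subr_ge0//.
by rewrite lerBlDr addrC -lerBlDr ltW.
Qed.

Lemma measurable_recurrent c y : measurable [set t | Y c t y].
Proof. by apply: measurable_io => N; exact: measurable_avg. Qed.

(** By the Lipschitz bound each recurrent [y] brings the whole interval [[y, y + c K / 2]] into the
    section of [max_all]; a set of finite measure has no room for such intervals far out. *)
Lemma recurrent_bounded c t : 0 < c -> (mu (xsection (max_all A b f K (c / 2)) t) < +oo)%E -> has_ubound (Y c t).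
Proof.
move=> c0; set S := xsection _ _ => Sfin.
have mS : measurable S by apply: measurable_xsection; exact: measurable_max_all.
have d0 : 0 < c * K / 2 by rewrite divr_gt0// mulr_gt0.
pose F (m : nat) : set R := S `&` `[m%:R, +oo[%classic.
have mF m : measurable (F m) by exact: measurableI.
have F0 : \bigcap_m F m = set0.
  apply/seteqP; split=> // r /(_ (Num.bound `|r|) I)[_ /=]; rewrite in_itv/= andbT leNgt.
  by rewrite (le_lt_trans (ler_norm _))// archi_boundP.
have cvF : (mu \o F) m @[m --> \oo] --> mu (\bigcap_m F m).
  apply: nonincreasing_cvg_mu => //; last first.
  - move=> i j ij; apply/subsetPset => z [Sz]/=; rewrite !in_itv/= !andbT => jr; split=> //=.
    by rewrite in_itv/= andbT (le_trans _ jr)// ler_nat.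
  - by rewrite F0.
  by apply: le_lt_trans Sfin; apply: le_measure; rewrite ?inE//; [exact: mF|exact: subIsetl].
rewrite F0 measure0 in cvF.
have [m Hm] : exists m, (mu (F m) < (c * K / 2)%:E)%E.
  apply: contrapT => h; have : ((c * K / 2)%:E <= 0 :> \bar R)%E.
    rewrite -(cvg_lim _ cvF)//; apply: lime_ge; first by apply/cvg_ex; eexists; exact: cvF.
    by apply: nearW => m; rewrite leNgt; apply/negP => ?; apply: h; exists m.
  by rewrite lee_fin leNgt d0.
exists m%:R => y Yy; rewrite leNgt; apply/negP => my.
have : (mu `[y, (y + c * K / 2)%R]%classic <= mu (F m))%E.
  apply: le_measure; [by rewrite inE|by rewrite inE; exact: mF|move=> y' /=; rewrite in_itv/= => /andP[h1 h2]; split]; last first.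
    by rewrite /= in_itv/= andbT (le_trans (ltW my)).
  rewrite /S /xsection/= inE; have [N N0 hN] := io_gt Yy.
  exists N => //; apply: avg_max_pos => //.
  have := avg_lip N t y y'; rewrite ler_norml => /andP[_].
  have : `|y - y'| / K <= c / 2.
    by rewrite ler_pdivrMr// ler_norml; apply/andP; split; lra.
  lra.
rewrite lebesgue_measure_itv/= lte_fin ltrDl d0 -EFinB addrAC subrr add0r leNgt.
by rewrite Hm.
Qed.

(** The set where some height is recurrent is invariant and not null, so it has full measure by
    ergodicity; almost all sections of [max_all] have finite measure. Hence the supremum of the
    recurrent heights exists almost everywhere. *)
Lemma cohom_of_recurrence c : 0 < c -> E (\1_[set t | io c (avg ^~ t ^~ 0)]) != 0 ->
  exists u : X -> R, measurable_fun [set: X] u /\ exists N, measurable N /\ P N = 0%E /\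
    forall t, unit_cube t -> ~ N t -> f (rv t) = u (Tc t) - u t.
Proof.
move=> c0 E0.
pose I : set X := \bigcup_(q : rat) [set t | Y c t (ratr q)].
have IE t : I t <-> (Y c t !=set0).
  split=> [[q _ h]|[y Yy]]; first by exists (ratr q).
  have [e e0 He] := recurrent_open Yy.
  have : y - e < y by rewrite ltrBlDr ltrDl.
  by move=> /rat_in_itvoo[q]; rewrite in_itv/= => /andP[h1 h2]; exists q => //; apply: He; rewrite h1 ltW.
have mI : measurable I by apply: bigcupT_measurable_rat => q; exact: measurable_recurrent.
have TI t : unit_cube t -> I (Tc t) <-> I t.
  move=> _; split=> /IE[y Yy]; apply/IE.
    by exists (y - f (rv t)); apply: (recurrent_shift c t y).2.
  by exists (y + f (rv t)); apply: (recurrent_shift c t _).1; rewrite addrK.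
have EI : E \1_I = 1.
  have [h|//] := ergodic Au irr nil mI TI.
  have : E (\1_[set t | io c (avg ^~ t ^~ 0)]) <= E \1_I.
    apply: Ex_le; [by apply: bm_indic; exact: (measurable_recurrent c 0)|exact: bm_indic|move=> t].
    rewrite !indicE; have [h'|h'] := pselect (Y c t 0); last by rewrite memNset.
    by rewrite mem_set// mem_set//; apply/IE; exists 0.
  rewrite h => h2; exfalso; move/negP: E0; apply; rewrite eq_le h2/=.
  by apply: Ex_ge0 => t; rewrite indicE.
have NI : P (~` I) = 0%E.
  have : fine (P I) = 1 by rewrite -Ex_indic.
  by rewrite probability_setC// => h; rewrite -[P I]fineK ?fin_num_measure// h subee.
have [B [mB PB HB]] : exists B, [/\ measurable B, P B = 0%E &
    forall t, ~ B t -> (mu (xsection (max_all A b f K (c / 2)) t) < +oo)%E].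
  have mM : measurable (max_all A b f K (c / 2)) by exact: measurable_max_all.
  have : P.-integrable setT (fun t => mu (xsection (max_all A b f K (c / 2)) t)).
    apply/integrableP; split; first exact: measurable_fun_xsection.
    under eq_integral do rewrite gee0_abs//.
    by apply: max_all_fin => //; rewrite divr_gt0.
  move=> /(integrable_ae measurableT)[B [mB PB HB]]; exists B; split=> // t nB.
  apply: contrapT => h; apply: nB; apply: HB => /= /(_ Logic.I) h'; apply: h.
  by rewrite ltey_eq h'.
exists (fun t => sup (Y c t)); split.
  by apply: measurable_sup => [y|t y]; [exact: measurable_recurrent|exact: recurrent_open].
exists (~` I `|` (B `|` Tc @^-1` B)); split.
  apply: measurableU; first exact: measurableC.
  by apply: measurableU => //; exact: measurable_preimage_Tcube.
have mTB : measurable (Tc @^-1` B) by exact: measurable_preimage_Tcube.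
split.
  apply/eqP; rewrite -measure_le0 (le_trans (measureU2 _ _ _))//; [exact: measurableC|exact: measurableU|].
  rewrite [X in (X + _)%E]NI add0e (le_trans (measureU2 _ _ _))// [X in (X + _)%E]PB add0e.
  by rewrite [leLHS](Lam_Tcube b Au mB) PB.
move=> t ct h.
have It : I t by apply: contrapT => h'; apply: h; left.
have hs : has_sup (Y c t).
  split; first exact/IE.
  by apply: recurrent_bounded => //; apply: HB => h'; apply: h; right; left.
rewrite (sup_shift hs (recurrent_shift c t)); ring.
Qed.

End fixed_scale.

(** If small sums keep a positive frequency in the mean, the averages at height zero exceed [d / 4]
    on a set of measure at least [d / 4] at each large time, hence at arbitrarily large times on a
    set of at least that measure: recurrence. *)
Lemma cesaro_cohom C d L0 : 0 < d ->
  (forall L, (L0 <= L)%N -> d <= L%:R^-1 * \sum_(j < L) E (\1_[set t | `|bsumT A b f j (rv t)| <= C])) ->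
  exists u : X -> R, measurable_fun [set: X] u /\ exists N, measurable N /\ P N = 0%E /\
    forall t, unit_cube t -> ~ N t -> f (rv t) = u (Tc t) - u t.
Proof.
(* Makes [tent K] at least one half on [[-C, C]], and [K] positive whatever the sign of [C]. *)
move=> d0 H; pose K := 2 * Num.max C 1.
have K0 : 0 < K by rewrite mulr_gt0// lt_max ltr01 orbT.
have CK : C <= K / 2 by rewrite /K mulrC mulKf// le_max lexx.
have mB j : measurable [set t : X | `|bsumT A b f j (rv t)| <= C].
  have mb := bm_measurable (bm_abs (bm_bsumT A b j (tp_periodic tf) (bm_tp tf))).
  rewrite (_ : [set t | _] = (fun t => `|bsumT A b f j (rv t)|) @^-1` `]-oo, C]).
    by rewrite -[X in measurable X]setTI; apply: mb.
  by apply/seteqP; split=> t /=; rewrite in_itv.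
have bavg N : bm (fun t : X => avg A b f K N t 0).
  split; first exact: measurable_avg.
  by exists 1 => t; have /andP[h1 h2] := avg_bounds K0 N t 0; rewrite ger0_norm.
have Eavg L : (L0 <= L)%N -> d / 2 <= E (fun t => avg A b f K L t 0).
  move=> /H dL; apply: (@le_trans _ _ (E (fun t => 2^-1 * (L%:R^-1 * \sum_(j < L) \1_[set t | `|bsumT A b f j (rv t)| <= C] t)))).
    rewrite !ExZ; last 2 first.
    - by apply: bm_sum => j; exact: bm_indic.
    - by apply: bmZ; apply: bm_sum => j; exact: bm_indic.
    by rewrite Ex_sum; [rewrite mulrC ler_wpM2l|move=> j; exact: bm_indic].
  apply: Ex_le => //; first by do 2!apply: bmZ; apply: bm_sum => j; exact: bm_indic.
  move=> t; rewrite /avg mulrCA ler_wpM2l// mulr_sumr; apply: ler_sum => j _.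
  rewrite indicE add0r; case: (boolP (t \in _)); rewrite ?mulr1 ?mulr0 ?tent_ge0// inE/= => h.
  by apply: tent_half => //; exact: le_trans CK.
pose G M : set X := [set t | d / 4 < avg A b f K M t 0].
have mG M : measurable (G M).
  rewrite (_ : G M = (fun t => avg A b f K M t 0) @^-1` `]d / 4, +oo[).
    by rewrite -[X in measurable X]setTI; apply: (bm_measurable (bavg M)).
  by apply/seteqP; split=> t; rewrite /G/= in_itv/= andbT.
pose U N : set X := \bigcup_(M in [set M | (N <= M)%N]) G M.
have mU N : measurable (U N) by apply: bigcup_measurable => M _.
have GE M : (L0 <= M)%N -> ((d / 4)%:E <= P (G M))%E.
  move=> /Eavg dM.
  have h : E (fun t => avg A b f K M t 0) <= E (fun t => d / 4 + \1_(G M) t).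
    apply: Ex_le => //; first by apply: bmD; [exact: bm_cst|exact: bm_indic].
    move=> t; have /andP[_ h2] := avg_bounds K0 M t 0.
    rewrite indicE; case: (boolP (t \in _)) => [_|]; first by rewrite (le_trans h2)// lerDr divr_ge0// ltW.
    by rewrite notin_setE /G/= => /negP; rewrite -leNgt addr0.
  rewrite ExD ?Ex_cst in h; [|exact: bm_cst|exact: bm_indic].
  rewrite Ex_indic// in h; rewrite -[P (G M)]fineK ?fin_num_measure// lee_fin; lra.
have cvU : (P \o U) N @[N --> \oo] --> P (\bigcap_N U N).
  apply: nonincreasing_cvg_mu => //; last first.
  - move=> i j ij; apply/subsetPset => t [M /= jM h]; exists M => //=; exact: leq_trans jM.
  - exact: bigcapT_measurable.
  by rewrite (le_lt_trans (probability_le1 _ _))// ltry.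
have dU : ((d / 4)%:E <= P (\bigcap_N U N))%E.
  rewrite -(cvg_lim _ cvU)//; apply: lime_ge; first by apply/cvg_ex; eexists; exact: cvU.
  apply: nearW => N /=; apply: le_trans (GE (maxn L0 N) (leq_maxl _ _)) _.
  apply: le_measure; rewrite ?inE// => t Gt; exists (maxn L0 N) => //=; exact: leq_maxr.
have d8 : 0 < d / 8 by rewrite divr_gt0.
apply: (cohom_of_recurrence K0 d8).
have mio : measurable [set t : X | io (d / 8) ((avg A b f K)^~ t ^~ 0)].
  by apply: measurable_io => N; exact: measurable_avg.
rewrite Ex_indic//; apply/eqP => h.
have : ((d / 4)%:E <= 0)%E.
  apply: (@le_trans _ _ (P [set t : X | io (d / 8) ((avg A b f K)^~ t ^~ 0)])); last first.
    by rewrite -[leLHS]fineK ?fin_num_measure// h.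
  apply: le_trans dU _; apply: le_measure; rewrite ?inE//.
    exact: bigcapT_measurable.
  (* The margin required by [io] fits into the gap between the level [d / 8] and the values above
     [d / 4]. *)
  move=> t Ut; exists (Num.bound (d / 8)^-1) => N0; have [M /= NM GM] := Ut N0 I.
  exists M => //; apply: le_lt_trans GM.
  suff : (Num.bound (d / 8)^-1).+1%:R^-1 <= d / 8 by move: (_.+1%:R^-1) => x; lra.
  rewrite -[leRHS]invrK lef_pV2 ?posrE ?invr_gt0// (le_trans (ltW (archi_boundP _)))//.
  - by rewrite invr_ge0 ltW.
  - by rewrite ler_nat.
by rewrite lee_fin; lra.
Qed.

End cesaro.

Section cesaro_growth.
Variables (R : realType) (n : nat) (A : 'M[int]_n) (b : 'rV[R]_n).
Hypothesis Au : upper_unipotent A.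
Hypothesis irr : irrational_invariants A b.
Hypothesis nil : nu_nilpotent A.
Notation X := (n.-tuple R).
Notation E := (Ex (Lam R n)).

Lemma cesaro_growth (Psi : 'rV[R]_n -> R) C d L0 : trig_poly Psi ->
  ~ meas_cohom_const A b (Psi \o @rv R n) -> 0 < d ->
  exists2 L, (L0 <= L)%N &
    L%:R^-1 * \sum_(j < L) E (\1_[set t : X | `|bsumT A b (fun x => Psi x - intT (Psi \o @rv R n)) j (rv t)| <= C]) < d.
Proof.
move=> tP; apply: contra_notP => H.
set f := fun x => Psi x - intT (Psi \o @rv R n).
have tf : trig_poly f by apply: tpB => //; exact: tp_cst.
have [|L L0L|u [mu' [N [mN [PN HN]]]]] := @cesaro_cohom _ _ _ _ Au irr nil f tf C d L0.
- by apply: contrapT => h; apply: H => d0; exfalso; apply: h.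
- by rewrite leNgt; apply/negP => h; apply: H => _; exists L.
exists u; split; first exact: measurable_funTS.
exists N; split=> //; split; last by move=> t ct /(HN _ ct).
rewrite /lam iintE; [|by apply/measurable_EFinP; exact: measurable_indic|by move=> x; rewrite lee_fin].
by rewrite integral_indic// setIT.
Qed.

End cesaro_growth.

(** * Growth of Birkhoff sums *)

Section small_indicator.
Variable R : realType.

Definition small (C r : R) : R := (`|r| <= C)%R%:R.

Lemma small_ge0 C r : 0 <= small C r. Proof. exact: ler0n. Qed.

Lemma small_le1 C r : small C r <= 1. Proof. by rewrite /small -[leRHS]/(1%:R) ler_nat leq_b1. Qed.

Lemma small_le C C' r r' : (`|r| <= C -> `|r'| <= C') -> small C r <= small C' r'.
Proof. by rewrite /small; case: (`|r| <= C) => [->|_]//; exact: ler0n. Qed.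

Lemma small_indic d (T : measurableType d) C (g : T -> R) :
  (\1_[set t | `|g t| <= C] : T -> R) = (fun t => small C (g t)).
Proof.
apply/funext => t; rewrite indicE /small.
by have [h|h] := boolP (`|g t| <= C); [rewrite mem_set|rewrite memNset//; exact/negP].
Qed.

Lemma measurable_norm_le d (T : measurableType d) C (g : T -> R) : measurable_fun [set: T] g ->
  measurable [set t | `|g t| <= C].
Proof.
move=> mg; rewrite (_ : [set t | _] = g @^-1` `[- C, C]).
  by rewrite -[X in measurable X]setTI; apply: mg.
by apply/seteqP; split=> t /=; rewrite in_itv/= ler_norml.
Qed.

Lemma bm_small d (T : measurableType d) C (g : T -> R) : measurable_fun [set: T] g ->
  bm (fun t => small C (g t)).
Proof. by move=> mg; rewrite -small_indic; apply: bm_indic; exact: measurable_norm_le. Qed.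

Lemma Ex_sqr_le d (T : measurableType d) (P : probability T R) (g : T -> R) : bm g ->
  Ex P g ^+ 2 <= Ex P (fun t => g t ^+ 2).
Proof.
move=> bg; set m := Ex P g.
have b2 : bm (fun t => g t ^+ 2) by under eq_fun do rewrite expr2; exact: bmM.
have : 0 <= Ex P (fun t => (g t - m) ^+ 2) by apply: Ex_ge0 => t; exact: sqr_ge0.
have -> : (fun t => (g t - m) ^+ 2) = (fun t => g t ^+ 2 - 2 * m * g t + m ^+ 2).
  by apply/funext => t; ring.
rewrite ExD ?Ex_cst; [|by apply: bmB => //; exact: bmZ|exact: bm_cst].
rewrite ExB//; last exact: bmZ.
rewrite ExZ// -/m; nra.
Qed.

End small_indicator.

Section norm1.
Variables (R : realType) (n : nat).
Implicit Types x y : 'rV[R]_n.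

Lemma norm1D x y : norm1 (x + y) <= norm1 x + norm1 y.
Proof. by rewrite /norm1 -big_split/=; apply: ler_sum => i _; rewrite mxE ler_normD. Qed.

Lemma norm1Z (c : R) x : norm1 (c *: x) = `|c| * norm1 x.
Proof. by rewrite /norm1 mulr_sumr; apply: eq_bigr => i _; rewrite mxE normrM. Qed.

Lemma norm1_sum (I : Type) (s : seq I) (F : I -> 'rV[R]_n) :
  norm1 (\sum_(i <- s) F i) <= \sum_(i <- s) norm1 (F i).
Proof.
elim: s => [|i s IH]; first by rewrite !big_nil /norm1 big1// => i _; rewrite mxE normr0.
by rewrite !big_cons (le_trans (norm1D _ _))// lerD2l.
Qed.

End norm1.

Section invariance.
Variables (R : realType) (n : nat) (A : 'M[int]_n) (b : 'rV[R]_n).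
Hypothesis Au : upper_unipotent A.
Notation X := (n.-tuple R).
Notation V := 'rV[R]_n.
Notation T := (Tlift A b).
Notation Tc := (Tcube A b).
Notation E := (Ex (Lam R n)).

Lemma Ex_translate (g : V -> R) v : periodic g -> bm (g \o @rv R n) ->
  E (fun t => g (rv t + v)) = E (g \o @rv R n).
Proof.
move=> pg bg; rewrite -(Ex_Tcube v (@upper_unipotent1 n) bg); congr (Ex _ _); apply/funext => t /=.
rewrite (periodic_Tcube 1%:M v 1 t pg)/= /Tlift.
by rewrite (_ : map_mx _ 1%:M = 1%:M) ?mulmx1//; apply/matrixP => i j; rewrite !mxE; case: eqP.
Qed.

(** The square of [L * E h] is at most the second moment of the sum of [h] over [L] iterates, and by
    invariance each product in it depends on the time difference only. So a set whose returns are
    rare on average is small. *)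
Lemma second_moment (h : X -> R) (r : nat -> R) L : bm h -> (forall t, 0 <= h t) ->
  (forall j, E (fun t => h t * h (iter j Tc t)) <= r j) -> (forall j, 0 <= r j) -> (0 < L)%N ->
  E h ^+ 2 <= 2 / L%:R * \sum_(j < L) r j.
Proof.
move=> bh h0 hr r0 L0.
pose hi i t := h (iter i Tc t).
have bhi i : bm (hi i) by apply: (bm_comp _ bh); exact: measurable_iter_Tcube.
have hij i j : (i <= j)%N -> E (fun t => hi i t * hi j t) <= r (j - i)%N.
  move=> ij; apply: le_trans (hr (j - i)%N); rewrite le_eqVlt; apply/orP; left; apply/eqP.
  rewrite -(Ex_iter_Tcube b Au i (f := fun t => h t * h (iter (j - i) Tc t))); last first.
    by apply: bmM => //; exact: (bhi (j - i)%N).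
  by congr (Ex _ _); apply/funext => t /=; rewrite /hi -iterD subnK.
pose S l t := \sum_(i < l) hi i t.
have bS l : bm (S l) by exact: bm_sum.
have key l : (l <= L)%N -> E (fun t => S l t ^+ 2) <= 2 * l%:R * \sum_(j < L) r j.
  elim: l => [_|l IH lL].
    under eq_fun do rewrite /S big_ord0 expr0n/=.
    by rewrite Ex_cst mulr0 mul0r.
  have b2 m : bm (fun t => S m t ^+ 2) by under eq_fun do rewrite expr2; exact: bmM.
  have bb : bm (fun t => 2 * \sum_(i < l.+1) hi i t * hi l t).
    by apply: bmZ; apply: bm_sum => i; exact: bmM.
  apply: (@le_trans _ _ (E (fun t => S l t ^+ 2 + 2 * \sum_(i < l.+1) hi i t * hi l t))).
    apply: Ex_le => //; first exact: bmD.
    move=> t; rewrite /S !big_ord_recr/= -mulr_suml; have := h0 (iter l Tc t); rewrite -/(hi l t).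
    by move: (\sum_(_ < l) _) (hi l t) => u v; nra.
  rewrite ExD// ExZ; last by apply: bm_sum => i; exact: bmM.
  rewrite Ex_sum; last by move=> i; exact: bmM.
  have := IH (ltnW lL).
  have : \sum_(i < l.+1) E (fun t => hi i t * hi l t) <= \sum_(j < L) r j.
    apply: (@le_trans _ _ (\sum_(i < l.+1) r (l - i)%N)).
      by apply: ler_sum => i _; apply: hij; rewrite -ltnS.
    rewrite (reindex_inj rev_ord_inj)/= (eq_bigr (fun i : 'I_l.+1 => r i)); last first.
      by move=> i _; rewrite subSS subKn// -ltnS.
    rewrite -!(big_mkord xpredT r) [leRHS](big_cat_nat_idem _ (n := l.+1))//=; last exact: addr0.
    by rewrite lerDl sumr_ge0.
  by rewrite -[l.+1%:R]natr1; move: (\sum_(_ < L) _) (l%:R : R) => u v; nra.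
have Lp : 0 < L%:R :> R by rewrite ltr0n.
have ES : E (S L) = L%:R * E h.
  rewrite Ex_sum// (eq_bigr (fun=> E h)); first by rewrite sumr_const card_ord mulr_natl.
  by move=> i _; exact: (Ex_iter_Tcube b Au i bh).
have := Ex_sqr_le (Lam R n) (bS L); rewrite ES => /le_trans/(_ (key L (leqnn L))).
by rewrite exprMn -ler_pdivlMl ?exprn_gt0//; congr (_ <= _); field; rewrite pnatr_eq0 -lt0n.
Qed.

Lemma tp_Tlift f : trig_poly f -> trig_poly (fun x => f (T x)).
Proof.
move: f; apply: tp_ind => [|m al be f _ IH]; first exact: tp_cst.
apply: tpD => //.
have -> : (fun x : V => al * costau (dot m (T x)) + be * sintau (dot m (T x))) = fun x =>
    (al * costau (dot m b) + be * sintau (dot m b)) * costau (dot (m + nu A m) x) +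
    (be * costau (dot m b) - al * sintau (dot m b)) * sintau (dot (m + nu A m) x).
  by apply/funext => x; rewrite dot_Tlift addrA -dotDl costauD sintauD; ring.
exact: tp_cs.
Qed.

Lemma tp_iter f k : trig_poly f -> trig_poly (fun x => f (iter k T x)).
Proof.
by move=> tf; elim: k => [//|k IH]; under eq_fun do rewrite iterSr; exact: (tp_Tlift IH).
Qed.

Lemma tp_bsumT f l : trig_poly f -> trig_poly (bsumT A b f l).
Proof. by move=> tf; apply: tp_sum => j; exact: tp_iter. Qed.

Lemma bsumTB f g l x : bsumT A b (fun y => f y - g y) l x = bsumT A b f l x - bsumT A b g l x.
Proof. by rewrite /bsumT sumrB. Qed.

Lemma bsumT_cst c l x : bsumT A b (fun=> c) l x = l%:R * c.
Proof. by rewrite /bsumT sumr_const card_ord mulr_natl. Qed.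

(* Both sides are [S_(m+l)] minus the middle block. *)
Lemma bsumT_comm f l m x :
  bsumT A b f l (iter m T x) - bsumT A b f l x = bsumT A b f m (iter l T x) - bsumT A b f m x.
Proof.
have H i j : bsumT A b f (i + j) x = bsumT A b f i x + bsumT A b f j (iter i T x).
  rewrite /bsumT big_split_ord/=; congr (_ + _).
  by apply: eq_bigr => p _; rewrite addnC iterD.
have : bsumT A b f l x + bsumT A b f m (iter l T x) = bsumT A b f m x + bsumT A b f l (iter m T x).
  by rewrite -!H addnC.
lra.
Qed.

End invariance.

Section unipotent.
Variables (R : realType) (n : nat) (A : 'M[int]_n.+1) (b : 'rV[R]_n.+1).
Notation V := 'rV[R]_n.+1.
Notation T := (Tlift A b).
Notation N := (mxN R A).

Lemma iter_Tlift_add m x (v : V) : iter m T (x + v) = iter m T x + v *m (N + 1) ^+ m.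
Proof.
elim: m => [|m IH]; first by rewrite expr0 mulmx1.
by rewrite !iterS IH /Tlift mulmxDl exprSr mulmxA -addrA [_ + b]addrC addrA /mxN subrK.
Qed.

(** Below [k] each ratio of consecutive coefficients is at most [k / (m - k)], which is at most one,
    so lowering the index further only helps. *)
Lemma bin_ratio m k i : (k.*2 <= m)%N -> (i < k)%N -> ((m - k) * 'C(m, i) <= k * 'C(m, k))%N.
Proof.
move=> km.
have step j : (j < k)%N -> ((m - k) * 'C(m, j) <= k * 'C(m, j.+1))%N.
  move=> jk; apply: (@leq_trans ((m - j) * 'C(m, j))); first by rewrite leq_mul2r leq_sub2l ?orbT// ltnW.
  by rewrite -mul_bin_left leq_mul2r jk orbT.
have [d] := ubnP (k - i)%N; elim: d i => // d IH i; rewrite ltnS => di ik.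
have [ik1|ik1] := eqVneq i.+1 k; first by have := step i ik; rewrite ik1.
have {}ik1 : (i.+1 < k)%N by rewrite ltn_neqAle ik1.
apply: leq_trans (step i ik) _.
have := IH i.+1 (leq_trans _ di) ik1.
rewrite (_ : (k - i.+1 < k - i)%N); last by lia.
move=> /(_ isT) H; apply: leq_trans H; rewrite leq_mul2r; lia.
Qed.

(** In the binomial expansion applied to [v = w / 'C(m, k)] the terms above [k] vanish, the term [k]
    is [u], and the lower ones are [O(1 / m)] by [bin_ratio]; the case [i = 0] also bounds [v]
    itself. *)
Lemma shear_vector k (w : V) (u : V) : (0 < k)%N -> N ^+ k.+1 = 0 -> w *m N ^+ k = u ->
  forall e, 0 < e -> exists M, forall m, (M <= m)%N -> exists v : V,
    norm1 v <= e /\ norm1 (v *m (N + 1) ^+ m - u) <= e.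
Proof.
move=> k0 Nk wu e e0.
pose S := \sum_(i < k) norm1 (w *m N ^+ i).
have S0 : 0 <= S by apply: sumr_ge0 => i _; exact: norm1_ge0.
pose M0 := (Num.truncn (k%:R * S / e)).+1.
exists (k.*2 + M0)%N => m Mm; have km : (k.*2 <= m)%N by rewrite (leq_trans _ Mm)// leq_addr.
have C0 : 0 < 'C(m, k)%:R :> R by rewrite ltr0n bin_gt0; lia.
have mk0 : 0 < (m - k)%:R :> R by rewrite ltr0n; lia.
have rat i : (i < k)%N -> 'C(m, i)%:R / 'C(m, k)%:R <= k%:R / (m - k)%:R :> R.
  move=> ik; rewrite ler_pdivrMr// mulrAC ler_pdivlMr// -!natrM ler_nat mulnC.
  exact: bin_ratio.
have small : k%:R / (m - k)%:R * S <= e.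
  rewrite mulrAC ler_pdivrMr// [leRHS]mulrC -ler_pdivrMr//; apply: (@le_trans _ _ M0%:R).
    by rewrite ltW// truncnS_gt.
  by rewrite ler_nat; lia.
exists ('C(m, k)%:R^-1 *: w); split.
  apply: le_trans small; rewrite norm1Z ger0_norm; last by rewrite invr_ge0 ltW.
  apply: (@le_trans _ _ (k%:R / (m - k)%:R * norm1 w)).
    by apply: ler_wpM2r; [exact: norm1_ge0|have := rat 0 k0; rewrite bin0 mul1r].
  rewrite ler_wpM2l ?divr_ge0// /S (bigD1 (Ordinal k0))//= expr0 mulmx1 lerDl.
  by apply: sumr_ge0 => i _; exact: norm1_ge0.
have -> : ('C(m, k)%:R^-1 *: w) *m (N + 1) ^+ m - u = \sum_(i < k) ('C(m, i)%:R / 'C(m, k)%:R) *: (w *m N ^+ i).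
  rewrite exprD1n mulmx_sumr -(big_mkord xpredT (fun i => _ *m (N ^+ i *+ 'C(m, i)))).
  have term i : ('C(m, k)%:R^-1 *: w) *m (N ^+ i *+ 'C(m, i)) = ('C(m, i)%:R / 'C(m, k)%:R) *: (w *m N ^+ i).
    by rewrite (raddfMn (mulmx ('C(m, k)%:R^-1 *: w)))/=; rewrite -scaler_nat -scalemxAl scalerA.
  rewrite (big_cat_nat (n := k.+1))//=; last by lia.
  rewrite [X in _ + X - _]big_nat_cond [X in _ + X - _]big1 ?addr0; last first.
    move=> i /andP[/andP[ki _] _]; rewrite term -(subnKC ki) exprD Nk mul0r mulmx0 scaler0 //.
  rewrite big_nat_recr//= term divff ?gt_eqF// scale1r wu addrK big_mkord.
  by apply: eq_bigr => i _; rewrite term.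
apply: le_trans (norm1_sum _ _) _; apply: le_trans small; rewrite mulr_sumr; apply: ler_sum => i _.
rewrite norm1Z ger0_norm ?divr_ge0//; apply: ler_wpM2r; first exact: norm1_ge0.
exact: rat.
Qed.

End unipotent.

Section vertical.
Variables (R : realType) (n : nat) (A : 'M[int]_n.+1) (b : 'rV[R]_n.+1).
Hypothesis Au : upper_unipotent A.
Notation T := (Tlift A b).

Lemma Tlift_vert x s : T (vert x s) = vert (T x) s.
Proof.
rewrite /vert /Tlift mulmxDl -scalemxAl addrAC; congr (_ + _ *: _).
rewrite /e_ -rowE; apply/rowP => j; rewrite !mxE eqxx/=.
have [->|jn] := eqVneq j ord_max; first by rewrite Au.2.
rewrite Au.1//= ltn_neqAle -ltnS ltn_ord andbT.
by apply: contra jn => /eqP h; apply/eqP/val_inj.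
Qed.

Lemma iter_vert k x s : iter k T (vert x s) = vert (iter k T x) s.
Proof. by elim: k => // k IH; rewrite !iterS IH Tlift_vert. Qed.

End vertical.

Section trigp_facts.
Variable R : realType.

Lemma trigp_le D g a c (s : R) : `|trigp D g a c s - g| <= trigp_norm D a c.
Proof.
rewrite /trigp addrAC subrr add0r (le_trans (ler_norm_sum _ _ _))//; apply: ler_sum => q _.
rewrite (le_trans (ler_normD _ _))// lerD// normrM ler_piMr//; [exact: costau_le1|exact: sintau_le1].
Qed.

Lemma trigp_frac D g a c (s : R) : trigp D g a c (frac s) = trigp D g a c s.
Proof.
have [z ->] := fracE s; rewrite /trigp; congr (_ + _); apply: eq_bigr => q _.
have -> : q.+1%:R * (s + z%:~R) = q.+1%:R * s + (Posz q.+1 * z)%:~R by rewrite mulrDr intrM.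
by rewrite costauDz sintauDz.
Qed.

Lemma Ex_uniform_small r e (g : R -> R) : measurable_fun [set: R] g ->
  (lebesgue_measure [set s | (0 <= s < 1)%R /\ (`|g s| <= r)%R] <= e%:E)%E ->
  Ex (uniform_prob (@ltr01 R)) (fun s => small r (g s)) <= e.
Proof.
move=> mg H; rewrite -lee_fin ExE; last exact: bm_small.
rewrite integral_uniform01; last 2 first.
- by apply/measurable_EFinP; exact: bm_measurable (bm_small _ mg).
- by move=> x; rewrite lee_fin small_ge0.
apply: le_trans H; rewrite le_eqVlt; apply/orP; left; apply/eqP.
have -> : [set x : R | 0 <= x < 1] = `[0, 1[%classic by apply/seteqP; split=> x /=; rewrite in_itv.
transitivity (\int[lebesgue_measure]_(x in `[0%R, 1%R[) (\1_[set s | `|g s| <= r] x)%:E)%E.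
  by apply: eq_integral => x _; rewrite small_indic.
rewrite integral_indic//; last exact: measurable_norm_le.
by congr (lebesgue_measure _); apply/seteqP; split=> x /=; rewrite in_itv/= => -[].
Qed.

End trigp_facts.

Section growth.
Variables (R : realType) (n : nat) (A : 'M[int]_n.+1) (b : 'rV[R]_n.+1).
Hypothesis Au : upper_unipotent A.
Notation X := (n.+1.-tuple R).
Notation V := 'rV[R]_n.+1.
Notation T := (Tlift A b).
Notation Tc := (Tcube A b).
Notation E := (Ex (Lam R n.+1)).
Notation U := (uniform_prob (@ltr01 R)).
Variables (D : nat) (Psi Psi0 : V -> R) (a c : nat -> V -> R) (m0 : R).
Hypothesis tP : trig_poly Psi.
Hypothesis tP0 : trig_poly Psi0.
Hypothesis ta : forall q, trig_poly (a q).
Hypothesis tc : forall q, trig_poly (c q).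
Hypothesis PsiE : forall x s, Psi (vert x s) = trigp D (Psi0 x) (a ^~ x) (c ^~ x) s.

Notation S := (bsumT A b).
Notation f := (fun x => Psi x - m0).

(** The size of the nonconstant part of [S_j] on the fibre of [x]: an upper bound for that part and,
    by [level_set_small], its typical magnitude. *)
Definition Hn j x : R := trigp_norm D (fun q => S (a q) j x) (fun q => S (c q) j x).

Lemma bsumT_vert j x s : S Psi j (vert x s) =
  trigp D (S Psi0 j x) (fun q => S (a q) j x) (fun q => S (c q) j x) s.
Proof.
rewrite /bsumT.
under eq_bigr => i _ do rewrite (iter_vert b Au) PsiE.
rewrite /trigp big_split/=; congr (_ + _); rewrite exchange_big/=.
rewrite [RHS](eq_bigr (fun q : 'I_D => \sum_(i < j) (a q (iter i T x) * costau (q.+1%:R * s) + c q (iter i T x) * sintau (q.+1%:R * s))))//.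
by move=> q _; rewrite !mulr_suml -big_split.
Qed.

Lemma Hn_ge0 j x : 0 <= Hn j x.
Proof. by apply: sumr_ge0 => q _; rewrite addr_ge0. Qed.

Lemma periodic_Hn j : periodic (Hn j).
Proof.
move=> x z; apply: eq_bigr => q _; rewrite (periodic_bsumT A b j (tp_periodic (ta q)) x z).
by rewrite (periodic_bsumT A b j (tp_periodic (tc q)) x z).
Qed.

Lemma bm_Hn j : bm (Hn j \o @rv R n.+1).
Proof.
by apply: bm_sum => q; apply: bmD; apply: bm_abs;
  [exact: (bm_tp (tp_bsumT A b j (ta q)))|exact: (bm_tp (tp_bsumT A b j (tc q)))].
Qed.

Section nilpotent_shear.
Variables (k : nat) (w : V).
Hypothesis k0 : (0 < k)%N.
Hypothesis Nk : mxN R A ^+ k.+1 = 0.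
Hypothesis wE : w *m mxN R A ^+ k = e_ R ord_max.

(** The order of quantifiers matters: [C'] depends on neither [j] nor [m], while the time [M] after
    which the shear is accurate may depend on [j]. *)
Lemma return_small C e : 0 < e -> exists C', forall j, exists M, forall m, (M <= m)%N ->
  E (fun t => small C (S f j (iter m T (rv t)) - S f j (rv t))) <= e + E (fun t => small C' (Hn j (rv t))).
Proof.
move=> e0; have [eta [eta0 Heta]] := @level_set_small R D e e0.
(* The extra one covers two displacement errors of one half, at [x] and at [T^m x]. *)
exists ((C + 1) / eta) => j.
have tf : trig_poly f by apply: tpB => //; exact: tp_cst.
have tSf : trig_poly (S f j) by exact: tp_bsumT.
have [K [K0 HK]] := tp_lip tSf.
pose e1 := (2 * K + 1)^-1.
have K1 : 0 < 2 * K + 1 by rewrite ltr_wpDl// mulr_ge0.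
have e10 : 0 < e1 by rewrite invr_gt0.
have Ke1 : K * e1 <= 2^-1.
  by rewrite ler_pdivrMr// mulrC -ler_pdivrMr ?invr_gt0// invrK; lra.
have [M HM] := shear_vector k0 Nk wE e10.
exists M => m /HM[v [v1 v2]].
pose G x := small C (S f j (iter m T x) - S f j x).
have tG : trig_poly (fun x => S f j (iter m T x) - S f j x) by apply: tpB => //; exact: tp_iter.
have pG : periodic G by move=> x z; rewrite /G (tp_periodic tG).
have bG : bm (G \o @rv R n.+1) by apply: bm_small; exact: bm_measurable (bm_tp tG).
pose g t := S Psi0 j (iter m T (rv t)) - j%:R * m0 - S f j (rv t).
pose h (p : X * R) := small (C + 1) (trigp D (g p.1) (fun q => S (a q) j (iter m T (rv p.1)))
  (fun q => S (c q) j (iter m T (rv p.1))) p.2).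
have hE t s : h (t, s) = small (C + 1) (S f j (vert (iter m T (rv t)) s) - S f j (rv t)).
  rewrite /h /g; congr small.
  by rewrite [in RHS]bsumTB bsumT_cst bsumT_vert /trigp /=; ring.
(* The translation uses [frac s] to remain short, which is harmless because [h] has period one in
   [s]. *)
have Gh t s : G (rv t + frac s *: v) <= h (t, s).
  have -> : h (t, s) = h (t, frac s) by rewrite /h /= trigp_frac.
  rewrite hE; apply: small_le; move: (frac s) (frac_ge0 s) (ltW (frac_lt1 s)) => {}s s0 s1.
  have h1 : `|S f j (rv t + s *: v) - S f j (rv t)| <= 2^-1.
    apply: le_trans (HK _ _) _; apply: le_trans Ke1; rewrite ler_wpM2l// addrC addKr norm1Z ger0_norm//.
    by rewrite (le_trans _ v1)// ler_piMl// norm1_ge0.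
  have h2 : `|S f j (iter m T (rv t + s *: v)) - S f j (vert (iter m T (rv t)) s)| <= 2^-1.
    apply: le_trans (HK _ _) _; apply: le_trans Ke1; rewrite ler_wpM2l//.
    rewrite iter_Tlift_add /vert opprD addrACA subrr add0r -scalemxAl -scalerBr norm1Z ger0_norm//.
    by rewrite (le_trans _ v2)// ler_piMl// norm1_ge0.
  move: h1 h2; move: (S f j _) (S f j _) (S f j _) (S f j _) => u1 u2 u3 u4.
  by rewrite !ler_norml; lra.
have mtp (p : V -> R) : trig_poly p -> measurable_fun [set: X * R] (fun z : X * R => p (rv z.1)).
  by move=> tp0; apply: (measurableT_comp (bm_measurable (bm_tp tp0))).
have bh : bm h.
  apply: bm_small; apply: measurable_funD.
    apply: (mtp (fun x => S Psi0 j (iter m T x) - j%:R * m0 - S f j x)); apply: tpB => //; apply: tpB; last exact: tp_cst.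
    by apply: tp_iter; exact: tp_bsumT.
  apply: measurable_sum => q; apply: measurable_funD; apply: measurable_funM.
  - by apply: (mtp (fun x => S (a q) j (iter m T x))); apply: tp_iter; exact: tp_bsumT.
  - by apply: (measurableT_comp (@measurable_costau R)); apply: measurable_funM.
  - by apply: (mtp (fun x => S (c q) j (iter m T x))); apply: tp_iter; exact: tp_bsumT.
  - by apply: (measurableT_comp (@measurable_sintau R)); apply: measurable_funM.
apply: (@le_trans _ _ (Ex U (fun s => E (fun t => h (t, s))))).
  rewrite -[leLHS](Ex_cst U); apply: Ex_le; [exact: bm_cst|exact: (@bm_Ex' _ _ _ _ _ (Lam R n.+1) U h bh)|move=> s].
  rewrite -[leLHS](Ex_translate (frac s *: v) pG bG); apply: Ex_le => //; last exact: (bm_pair' bh).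
  have := bm_iter 1%:M (frac s *: v) 1 pG bG.
  congr bm; apply/funext => t /=; congr G; rewrite /Tlift.
  by rewrite (_ : map_mx _ 1%:M = 1%:M) ?mulmx1//; apply/matrixP => i i'; rewrite !mxE; case: eqP.
rewrite -Ex_Fubini//.
have bH : bm (fun t : X => small ((C + 1) / eta) (Hn j (rv t))).
  by apply: bm_small; exact: bm_measurable (bm_Hn j).
pose r t := small ((C + 1) / eta) (Hn j t).
have pr : periodic r by move=> x z; rewrite /r periodic_Hn.
have -> : E (fun t : X => small ((C + 1) / eta) (Hn j (rv t))) = E (fun t => r (iter m T (rv t))).
  rewrite -(Ex_iter_Tcube b Au m bH); congr (Ex _ _); apply/funext => t /=.
  by rewrite -(periodic_Tcube A b m t pr).
have br : bm (fun t : X => r (iter m T (rv t))) := bm_iter A b m pr bH.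
rewrite -[e](Ex_cst (Lam R n.+1)) -ExD//; last exact: bm_cst.
apply: Ex_le; [exact: (@bm_Ex _ _ _ _ _ (Lam R n.+1) U h bh)|by apply: bmD => //; exact: bm_cst|move=> t].
rewrite /r /small; have [_|lt] := leP `|_| _.
  apply: Ex_le_cst => [|s]; first exact: (bm_pair bh).
  by rewrite (le_trans (small_le1 _ _))// lerDr ltW.
rewrite addr0; apply: (@Ex_uniform_small R (C + 1) e (trigp D (g t) (fun q => S (a q) j (iter m T (rv t)))
  (fun q => S (c q) j (iter m T (rv t))))); first exact: measurable_trigp.
move: lt; rewrite (ger0_norm (Hn_ge0 _ _)) => lt.
(* The sublevel estimate requires a positive norm. A zero norm above the threshold forces
   [C + 1 < 0], and the set is then empty. *)
have [H0|H0] := leP (Hn j (iter m T (rv t))) 0.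
  have C10 : C + 1 < 0 by have := lt_le_trans lt H0; rewrite pmulr_llt0// invr_gt0.
  rewrite (_ : [set s | _] = set0) ?measure0 ?lee_fin ?ltW//.
  by apply/seteqP; split=> s //= [_]; rewrite leNgt (lt_le_trans C10).
apply: le_trans (Heta (g t) _ _ H0); apply: le_measure; rewrite ?inE.
- rewrite (_ : [set s | _] = `[0, 1[ `&` [set s | `|trigp D (g t) (fun q => S (a q) j (iter m T (rv t)))
    (fun q => S (c q) j (iter m T (rv t))) s| <= C + 1]).
    by apply: measurableI => //; apply: measurable_norm_le; exact: measurable_trigp.
  by apply/seteqP; split=> s /=; rewrite in_itv.
- rewrite (_ : [set s | _] = `[0, 1[ `&` [set s | `|trigp D (g t) (fun q => S (a q) j (iter m T (rv t)))
    (fun q => S (c q) j (iter m T (rv t))) s| <= eta * Hn j (iter m T (rv t))]).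
    by apply: measurableI => //; apply: measurable_norm_le; exact: measurable_trigp.
  by apply/seteqP; split=> s /=; rewrite in_itv.
move=> s /= [s01 sC]; split=> //; apply: le_trans sC _.
by rewrite mulrC -ler_pdivrMr// ltW.
Qed.

Hypothesis cesaro : forall C d L0, 0 < d -> exists2 L, (L0 <= L)%N &
  L%:R^-1 * \sum_(j < L) E (fun t => small C (S f j (rv t))) < d.
Variable C0 : R.
Hypothesis dev : forall l x, `|S Psi0 l x - l%:R * m0| <= C0.

Lemma bsumT_Hn j x : `|S f j x| <= C0 + Hn j x.
Proof.
have := dev j x; have := bsumT_vert j x 0; rewrite vert0 => e.
have := trigp_le D (S Psi0 j x) (fun q => S (a q) j x) (fun q => S (c q) j x) 0.
rewrite -e -/(Hn j x) bsumTB bsumT_cst.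
by move: (S Psi j x) (S Psi0 j x) (Hn j x) => u1 u2 u3; rewrite !ler_norml; lra.
Qed.

Lemma small_Hn C j x : small C (Hn j x) <= small (C0 + C) (S f j x).
Proof.
by apply: small_le; rewrite (ger0_norm (Hn_ge0 _ _)) => h; rewrite (le_trans (bsumT_Hn _ _))// lerD2l.
Qed.

Lemma bm_smallS C j : bm (fun t : X => small C (S f j (rv t))).
Proof.
apply: bm_small; apply: (bm_measurable (bm_tp (tp_bsumT A b j (f := f) _))).
by apply: tpB => //; exact: tp_cst.
Qed.

Lemma growth C d : 0 < d -> exists M, forall m, (M <= m)%N -> E (fun t => small C (S f m (rv t))) < d.
Proof.
(* The argument ends with [E h ^+ 2 <= 4 * e], which is below [d ^+ 2]. *)
move=> d0; pose e := d ^+ 2 / 8.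
have e0 : 0 < e by rewrite divr_gt0// exprn_gt0.
have [C' HC'] := @return_small (2 * C) e e0.
have [Mf HMf] := choice HC'.
(* [L] is fixed after [C'] and before [m], so [m] has only finitely many thresholds [Mf j] to
   pass. *)
have [L L1 HL] := @cesaro (C0 + C') e 1 e0.
exists (\max_(j < L) Mf j)%N => m Mm.
have Lp : 0 < L%:R :> R by rewrite ltr0n.
pose h t := small C (S f m (rv t)).
pose r j := E (fun t => small (2 * C) (S f j (iter m T (rv t)) - S f j (rv t))).
have tf : trig_poly f by apply: tpB => //; exact: tp_cst.
have br j : bm (fun t : X => small (2 * C) (S f j (iter m T (rv t)) - S f j (rv t))).
  apply: bm_small; apply: (bm_measurable (bm_tp (f := fun x => S f j (iter m T x) - S f j x) _)).
  by apply: tpB; [apply: tp_iter|]; exact: tp_bsumT.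
have tS : trig_poly (S f m) by exact: tp_bsumT.
have : E h ^+ 2 <= 2 / L%:R * \sum_(j < L) r j.
  have := @second_moment R n.+1 A b Au h r L; apply => //.
  - exact: bm_smallS.
  - move=> j; apply: Ex_le => //.
      by apply: bmM; [|apply: (bm_comp (measurable_iter_Tcube A b j))]; exact: bm_smallS.
    move=> t; rewrite /h (periodic_Tcube A b j t (tp_periodic tS)) bsumT_comm /small.
    have [h1|_] := leP `|S f m (rv t)| C; last by rewrite mul0r.
    have [h2|_] := leP `|S f m (iter j T (rv t))| C; last by rewrite mulr0.
    rewrite mulr1; suff -> : (`|S f m (iter j T (rv t)) - S f m (rv t)| <= 2 * C) by [].
    by rewrite (le_trans (ler_normB _ _))//; lra.
  - by move=> j; apply: Ex_ge0 => t; exact: small_ge0.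
have rs : \sum_(j < L) r j <= L%:R * e + \sum_(j < L) E (fun t => small (C0 + C') (S f j (rv t))).
  rewrite [L%:R * e](_ : _ = \sum_(j < L) e); last by rewrite sumr_const card_ord mulr_natl.
  rewrite -big_split/=; apply: ler_sum => j _.
  apply: le_trans (HMf j m _) _; first by rewrite (leq_trans _ Mm)//; exact: (leq_bigmax j).
  rewrite lerD2l; apply: Ex_le; [|exact: bm_smallS|by move=> t; exact: small_Hn].
  by apply: bm_small; exact: bm_measurable (bm_Hn j).
have E0 : 0 <= E h by apply: Ex_ge0 => t; exact: small_ge0.
move: HL rs; rewrite ltr_pdivrMl// => HL rs H.
have : E h ^+ 2 <= 4 * e.
  apply: le_trans H _; rewrite mulrAC ler_pdivrMr//.
  by move: HL rs; move: (\sum_(_ < _) _) (\sum_(_ < _) _) => u v; nra.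
rewrite /e -[E _]/(E h); nra.
Qed.

Lemma growth_Hn C d : 0 < d -> exists M, forall m, (M <= m)%N -> E (fun t => small C (Hn m (rv t))) < d.
Proof.
move=> d0; have [M HM] := @growth (C0 + C) d d0; exists M => m /HM; apply: le_lt_trans.
apply: Ex_le; [|exact: bm_smallS|by move=> t; exact: small_Hn].
by apply: bm_small; exact: bm_measurable (bm_Hn m).
Qed.

End nilpotent_shear.
End growth.

(** * Deviations of the fibre averages *)

Section uniform_shift.
Variable R : realType.
Notation U := (uniform_prob (@ltr01 R)).

Lemma Ex_uniformE (g : R -> R) : bm g -> (forall x, 0 <= g x) ->
  (Ex U g)%:E = (\int[lebesgue_measure]_(x in [set x : R | (0 <= x < 1)%R]) (g x)%:E)%E.
Proof.
move=> bg g0; rewrite ExE//; apply: integral_uniform01 => [|x]; last by rewrite lee_fin.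
by apply/measurable_EFinP; exact: bm_measurable bg.
Qed.

Lemma Ex_uniform_shift (g : R -> R) x0 : bm g -> Ex U (fun s : R => g (frac (s + x0))) = Ex U g.
Proof.
move=> bg; have [mg [M gM]] := bg.
have mf : measurable_fun [set: R] (fun s : R => frac (s + x0)).
  by apply: (measurableT_comp (@measurable_frac R)); exact: measurable_funD.
have bg' : bm (fun s : R => g (frac (s + x0))) by apply: (bm_comp mf).
suff: Ex U (fun s : R => g (frac (s + x0)) + M) = Ex U (fun s : R => g s + M).
  by rewrite !ExD//; [rewrite !Ex_cst => /addIr|exact: bm_cst|exact: bm_cst].
have bM : bm (fun s : R => g s + M) by apply: bmD => //; exact: bm_cst.
have mM : measurable_fun [set: R] (fun s : R => (g s + M)%:E) by apply/measurable_EFinP; exact: bm_measurable bM.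
have M0 s : (0 <= (g s + M)%:E)%E by move: (gM s); rewrite ler_norml lee_fin; lra.
apply: EFin_inj; rewrite !ExE//; last by apply: (bm_comp mf bM).
rewrite !integral_uniform01//; last first.
  by apply/measurable_EFinP; exact: bm_measurable (bm_comp mf bM).
exact: (ge0_integral_frac_shift x0 mM M0).
Qed.

Lemma bm_costau k : bm (fun s : R => costau (k * s)).
Proof.
split; last by exists 1 => s; exact: costau_le1.
by apply: (measurableT_comp (@measurable_costau R)); exact: measurable_funM.
Qed.

Lemma bm_sintau k : bm (fun s : R => sintau (k * s)).
Proof.
split; last by exists 1 => s; exact: sintau_le1.
by apply: (measurableT_comp (@measurable_sintau R)); exact: measurable_funM.
Qed.

Lemma bm_trigp D g a c : bm (trigp D g a c : R -> R).
Proof.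
apply: bmD; first exact: bm_cst.
by apply: bm_sum => q; apply: bmD; apply: bmZ; [exact: bm_costau|exact: bm_sintau].
Qed.

(* Translating by half a period changes the sign. *)
Lemma Ex_uniform_trig q : Ex U (fun s => costau (q.+1%:R * s)) = 0 /\ Ex U (fun s => sintau (q.+1%:R * s)) = 0.
Proof.
have q0 : q.+1%:R != 0 :> R by rewrite pnatr_eq0.
have cs2 : costau (2^-1 : R) = -1 /\ sintau (2^-1 : R) = 0.
  by rewrite /costau /sintau mulrAC divff ?mul1r ?cospi ?sinpi.
have shift (s : R) : exists z : int, q.+1%:R * frac (s + (2 * q.+1%:R)^-1) = q.+1%:R * s + 2^-1 + z%:~R.
  have [z ->] := fracE (s + (2 * q.+1%:R)^-1); exists (Posz q.+1 * z).
  by rewrite intrM !mulrDr -!addrA; congr (_ + (_ + _)); field.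
split.
- have := Ex_uniform_shift (2 * q.+1%:R)^-1 (bm_costau q.+1%:R).
  have -> : (fun s => costau (q.+1%:R * frac (s + (2 * q.+1%:R)^-1))) = fun s : R => -1 * costau (q.+1%:R * s).
    by apply/funext => s; have [z ->] := shift s; rewrite costauDz costauD cs2.1 cs2.2; ring.
  by rewrite ExZ; [lra|exact: bm_costau].
- have := Ex_uniform_shift (2 * q.+1%:R)^-1 (bm_sintau q.+1%:R).
  have -> : (fun s => sintau (q.+1%:R * frac (s + (2 * q.+1%:R)^-1))) = fun s : R => -1 * sintau (q.+1%:R * s).
    by apply/funext => s; have [z ->] := shift s; rewrite sintauDz sintauD cs2.1 cs2.2; ring.
  by rewrite ExZ; [lra|exact: bm_sintau].
Qed.

Lemma Ex_uniform_trigp D g a c : Ex U (trigp D g a c) = g.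
Proof.
have [bc bs] := (bm_costau, bm_sintau).
rewrite ExD; [|exact: bm_cst|by apply: bm_sum => q; apply: bmD; apply: bmZ; [exact: bc|exact: bs]].
rewrite Ex_cst Ex_sum; last by move=> q; apply: bmD; apply: bmZ; [exact: bc|exact: bs].
rewrite big1 ?addr0// => q _; rewrite ExD; [|exact/bmZ/bc|exact/bmZ/bs].
by rewrite ExZ ?ExZ; [|exact: bs|exact: bc]; rewrite (Ex_uniform_trig q).1 (Ex_uniform_trig q).2 !mulr0 addr0.
Qed.

End uniform_shift.

Section continuous_periodic.
Variables (R : realType) (n : nat).

Lemma continuous_periodic_bounded (u : 'rV[R]_n.+1 -> R) : continuous u -> periodic u ->
  exists M, 0 <= M /\ forall x, `|u x| <= M.
Proof.
move=> cu pu; pose K : set 'rV[R]_n.+1 := [set v | forall i, `[0, 1]%classic (v ord0 i)].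
have cK : compact K by apply: (@rV_compact R _ (fun=> `[0, 1]%classic)) => i; exact: segment_compact.
have : compact (u @` K) by apply: continuous_compact => //; exact: continuous_subspaceT.
move=> /compact_bounded[M [_ HM]]; exists (`|M| + 1); split=> [|x]; first by rewrite addr_ge0.
have -> : u x = u (\row_i frac (x 0 i)).
  rewrite -(pu x (map_mx (fun r : R => - Num.floor r) x)); congr u; apply/rowP => i.
  by rewrite !mxE /Defs.frac rmorphN.
apply: HM; first by rewrite ltr_pwDr// ler_norm.
exists (\row_i frac (x 0 i)) => // i; rewrite /= in_itv/= mxE frac_ge0/= ltW//; exact: frac_lt1.
Qed.

End continuous_periodic.

Section fibre_average.
Variables (R : realType) (n : nat) (A : 'M[int]_n.+1) (b : 'rV[R]_n.+1).
Hypothesis Au : upper_unipotent A.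
Notation V := 'rV[R]_n.+1.
Notation T := (Tlift A b).
Notation E := (Ex (Lam R n.+1)).
Notation S := (bsumT A b).
Variables (D : nat) (Psi Psi0 : V -> R) (a c : nat -> V -> R).
Hypothesis tP : trig_poly Psi.
Hypothesis tP0 : trig_poly Psi0.
Hypothesis ta : forall q, trig_poly (a q).
Hypothesis tc : forall q, trig_poly (c q).
Hypothesis Psi0v : forall x s, Psi0 (vert x s) = Psi0 x.
Hypothesis PsiE : forall x s, Psi (vert x s) = trigp D (Psi0 x) (a ^~ x) (c ^~ x) s.

Definition proj (x : V) : 'rV[R]_n := \row_j x 0 (widen_ord (leqnSn n) j).

Lemma extend_proj x s : extend (proj x) s = vert x (s - x 0 ord_max).
Proof.
apply/rowP => j; rewrite !mxE; case: unliftP => [k ->|->]; last by rewrite !eqxx/= mulr1 addrC subrK.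
have lk : lift ord_max k = widen_ord (leqnSn n) k.
  by apply/val_inj; rewrite /= /bump leqNgt ltn_ord.
rewrite mxE lk (_ : (widen_ord _ k == ord_max) = false) ?mulr0 ?addr0//.
by apply/negbTE; rewrite neq_ltn /= ltn_ord.
Qed.

Lemma proj_Tlift x : proj (T x) = Tlift (factor_mat A) (factor_vec b) (proj x).
Proof.
apply/rowP => j; rewrite !mxE; congr (_ + _).
rewrite big_ord_recr/= [X in _ + X](_ : _ = 0) ?addr0.
  by apply: eq_bigr => i _; rewrite !mxE.
by rewrite mxE Au.1 ?mulr0//= ltn_ord.
Qed.

Lemma fiber_avg_proj x : (forall y, 0 <= Psi y) -> fiber_avg Psi (proj x) = Psi0 x.
Proof.
move=> Pp; set y := vert x (- x 0 ord_max).
have e (s : R) : Psi (extend (proj x) s) = trigp D (Psi0 y) (a ^~ y) (c ^~ y) s.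
  by rewrite extend_proj addrC -vertD PsiE.
rewrite /fiber_avg -[RHS](Psi0v x (- x 0 ord_max)) -[RHS](Ex_uniform_trigp D _ (a ^~ y) (c ^~ y)).
apply: EFin_inj; rewrite Ex_uniformE; [|exact: bm_trigp|by move=> s; rewrite -e].
under eq_integral do rewrite e.
by rewrite fineK// -Ex_uniformE//; [exact: bm_trigp|move=> s; rewrite -e].
Qed.

Lemma Ex_Psi0 : E (Psi \o @rv R n.+1) = E (Psi0 \o @rv R n.+1).
Proof.
pose h (p : n.+1.-tuple R * R) := trigp D (Psi0 (rv p.1)) (a ^~ (rv p.1)) (c ^~ (rv p.1)) p.2.
have bf (p : V -> R) : trig_poly p -> bm (fun z : n.+1.-tuple R * R => p (rv z.1)).
  by move=> tp0; apply: (bm_comp (T' := (n.+1.-tuple R * R)%type) (h := fst) _ (bm_tp tp0)).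
have bh : bm h.
  apply: bmD; first exact: bf.
  apply: bm_sum => q; apply: bmD; apply: bmM; try exact: bf.
  - by apply: (bm_comp (T' := (n.+1.-tuple R * R)%type) (h := snd) _ (bm_costau q.+1%:R)).
  - by apply: (bm_comp (T' := (n.+1.-tuple R * R)%type) (h := snd) _ (bm_sintau q.+1%:R)).
have := @Ex_Fubini _ _ _ _ _ (Lam R n.+1) (uniform_prob (@ltr01 R)) h bh.
rewrite [in LHS](_ : (fun x => _) = Psi0 \o @rv R n.+1); last first.
  by apply/funext => t; rewrite /h /= Ex_uniform_trigp.
move=> ->; rewrite -[LHS](Ex_cst (uniform_prob (@ltr01 R))); congr (Ex _ _); apply/funext => s.
rewrite -(Ex_translate (s *: e_ R ord_max) (tp_periodic tP) (bm_tp tP)); congr (Ex _ _); apply/funext => t.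
by rewrite /h /= -PsiE.
Qed.

Lemma intT_tp (g : V -> R) : trig_poly g -> (forall x, 0 <= g x) -> intT (g \o @rv R n.+1) = E (g \o @rv R n.+1).
Proof.
move=> tg g0; rewrite /intT iintE ?/Ex//.
- by apply/measurable_EFinP; exact: bm_measurable (bm_tp tg).
- by move=> x; rewrite lee_fin; exact: g0.
Qed.

(** The Birkhoff sums of the fibre average telescope to a difference of two values of a continuous
    periodic, hence bounded, function. *)
Lemma fibre_deviation : (0 < n)%N -> (forall x, 0 < Psi x) ->
  smooth_cohom_const (factor_mat A) (factor_vec b) (fiber_avg Psi) ->
  exists C0, forall l x, `|S Psi0 l x - l%:R * intT (Psi \o @rv R n.+1)| <= C0.
Proof.
move=> n0 Pp [u [su [pu hu]]]; set m' := intT _ in hu.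
have [M [M0 HM]] : exists M, 0 <= M /\ forall x, `|u x| <= M.
  case: n n0 u su pu {hu} => // n' _ u su pu.
  by apply: continuous_periodic_bounded => //; exact: (su [::]).1.
have H l x : `|S Psi0 l x - l%:R * m'| <= 2 * M.
  have -> : S Psi0 l x - l%:R * m' = u (proj (iter l T x)) - u (proj x).
    elim: l => [|l IH]; first by rewrite /bsumT big_ord0 mul0r !subrr.
    rewrite /bsumT big_ord_recr/= -/(S Psi0 l x) -natr1 mulrDl mul1r.
    have := hu (proj (iter l T x)); rewrite fiber_avg_proj -?proj_Tlift; last by move=> y; exact: ltW.
    by move: IH; move: (u _) (u _) (u _) => u1 u2 u3; lra.
  have := HM (proj (iter l T x)); have := HM (proj x).
  by move: (u _) (u _) => u1 u2; rewrite !ler_norml; lra.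
(* [m'] is a mean over the base torus. Bounded deviation makes it the uniform average of [Psi0],
   hence the mean of [Psi0], which is that of [Psi]. *)
exists (2 * M) => l x; suff -> : intT (Psi \o @rv R n.+1) = m' by [].
rewrite intT_tp// => [|y]; last exact: ltW.
rewrite Ex_Psi0; apply: (Ex_unif_avg Au (tp_periodic tP0) (bm_tp tP0) (b := b)) => e e0.
exists (2 * M) => y l'; apply: le_trans (H l' y) _; rewrite lerDr mulr_ge0//; exact: ltW.
Qed.

End fibre_average.

(** * Calculus along vertical circles *)

Section continuous_bounded.
Variable R : realType.
Implicit Types f g : R -> R.

Definition cb f := continuous f /\ exists M, forall x, `|f x| <= M.

Lemma cb_cst r : cb (fun=> r).
Proof. by split; [exact: cst_continuous|exists `|r|]. Qed.

Lemma cbD f g : cb f -> cb g -> cb (fun x => f x + g x).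
Proof.
move=> [cf [M fM]] [cg [N gN]]; split; first by move=> x; apply: cvgD; [exact: cf|exact: cg].
by exists (M + N) => x; rewrite (le_trans (ler_normD _ _))// lerD.
Qed.

Lemma cbM f g : cb f -> cb g -> cb (fun x => f x * g x).
Proof.
move=> [cf [M fM]] [cg [N gN]]; split; first by move=> x; apply: cvgM; [exact: cf|exact: cg].
by exists (M * N) => x; rewrite normrM ler_pM.
Qed.

Lemma cbN f : cb f -> cb (fun x => - f x).
Proof. by move=> cf; under eq_fun do rewrite -mulN1r; apply: cbM => //; exact: cb_cst. Qed.

Lemma cbB f g : cb f -> cb g -> cb (fun x => f x - g x).
Proof. by move=> cf cg; apply: cbD => //; exact: cbN. Qed.

Lemma cb_sum (I : Type) (s : seq I) (F : I -> R -> R) : (forall i, cb (F i)) ->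
  cb (fun x => \sum_(i <- s) F i x).
Proof.
move=> bF; elim: s => [|i s IH].
  by under eq_fun do rewrite big_nil; exact: cb_cst.
by under eq_fun do rewrite big_cons; exact: cbD.
Qed.

Lemma cb_comp f g : cb f -> continuous g -> cb (fun x => f (g x)).
Proof.
move=> [cf [M fM]] cg; split; last by exists M.
by move=> x; apply: continuous_comp; [exact: cg|exact: cf].
Qed.

Lemma cbV f m : 0 < m -> (forall x, m <= f x) -> cb f -> cb (fun x => (f x)^-1).
Proof.
move=> m0 mf [cf _]; have fx x : 0 < f x by apply: lt_le_trans (mf x).
split; first by move=> x; apply: cvgV; [rewrite gt_eqF|exact: cf].
exists m^-1 => x; rewrite ger0_norm; last by rewrite invr_ge0 ltW.
by rewrite lef_pV2 ?posrE.
Qed.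

Lemma cb_bm f : cb f -> bm f.
Proof. by move=> [cf bf]; split=> //; exact: continuous_measurable_fun. Qed.

End continuous_bounded.

Section derivatives.
Variable R : realType.
Implicit Types f g : R -> R.
Notation is_d x f df := (is_derive (x : R) (1 : R) f (df : R)).

Lemma is_dD f g (x df dg : R) : is_d x f df -> is_d x g dg -> is_d x (fun s => f s + g s) (df + dg).
Proof. by move=> hf hg; exact: is_deriveD. Qed.

Lemma is_dM f g (x df dg : R) : is_d x f df -> is_d x g dg -> is_d x (fun s => f s * g s) (df * g x + f x * dg).
Proof.
move=> hf hg; apply: (is_derive_eq (is_deriveM hf hg)).
by rewrite /GRing.scale/= addrC [g x * _]mulrC.
Qed.

Lemma is_dZ f (x r df : R) : is_d x f df -> is_d x (fun s => r * f s) (r * df).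
Proof. by move=> hf; apply: (is_derive_eq (is_dM (is_derive_cst r x 1) hf)); rewrite mul0r add0r. Qed.

Lemma is_d_sum (I : Type) (s : seq I) (F dF : I -> R -> R) (x : R) : (forall i, is_d x (F i) (dF i x)) ->
  is_d x (fun y => \sum_(i <- s) F i y) (\sum_(i <- s) dF i x).
Proof.
move=> HF; elim: s => [|i s IH].
  by under eq_fun do rewrite big_nil; rewrite big_nil; exact: is_derive_cst.
by under eq_fun do rewrite big_cons; rewrite big_cons; exact: is_dD.
Qed.

Lemma is_d_comp f g (x df dg : R) : is_d (g x) f df -> is_d x g dg -> is_d x (fun s => f (g s)) (df * dg).
Proof. by move=> hf hg; apply: is_derive1_comp. Qed.

Lemma is_dV f (x df : R) : f x != 0 -> is_d x f df -> is_d x (fun s => (f s)^-1) (- df / f x ^+ 2).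
Proof.
move=> fx hf; apply: (is_derive_eq (is_deriveV fx hf)).
by rewrite /GRing.scale/= mulrC mulNr mulrN.
Qed.

Lemma is_d_continuous f df : (forall x, is_d x f (df x)) -> continuous f.
Proof.
move=> H x; apply: differentiable_continuous; apply/derivable1_diffP.
by have := H x; case.
Qed.

Lemma Ex_uniform_deriv (Y dY : R -> R) : (forall x, is_d x Y (dY x)) -> cb dY -> Y 1 = Y 0 ->
  Ex (uniform_prob (@ltr01 R)) dY = 0.
Proof.
move=> HY cdY Y10; have [cd [M dM]] := cdY.
have bdY := cb_bm cdY.
(* Adding [M * x] makes the integrand nonnegative, as [integral_uniform] requires. *)
pose Z x := Y x + M * x; pose dZ x := dY x + M.
have HZ x : is_d x Z (dZ x).
  by apply: is_dD => //; apply: (is_derive_eq (is_dZ M (is_derive_id x 1))); rewrite mulr1.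
have cdZ : cb dZ by apply: cbD => //; exact: cb_cst.
have dZ0 x : 0 <= dZ x by move: (dM x); rewrite ler_norml /dZ; lra.
have cZ := is_d_continuous HZ.
suff : Ex (uniform_prob (@ltr01 R)) dZ = M.
  rewrite ExD//; last exact: bm_cst.
  by rewrite Ex_cst => h; apply: (addIr M); rewrite h add0r.
apply: EFin_inj; rewrite ExE; last exact: cb_bm.
rewrite integral_uniform//; last first.
  by apply/measurable_EFinP; exact: bm_measurable (cb_bm cdZ).
rewrite subr0 invr1 mul1e (@continuous_FTC2 R dZ Z 0 1)//.
- by rewrite /Z Y10 -EFinB; congr EFin; ring.
- by apply: continuous_subspaceT; exact: cdZ.1.
- split; first by move=> x _; have := HZ x; case.
  + by apply: cvg_at_right_filter; exact: cZ.
  + by apply: cvg_at_left_filter; exact: cZ.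
- by move=> x _; rewrite derive1E; have := HZ x => h; rewrite derive_val.
Qed.

Lemma is_d_trigp D (g : R) a c (s : R) : is_d s (trigp D g a c)
  (trigp D 0 (fun q => 2 * pi * q.+1%:R * c q) (fun q => - (2 * pi * q.+1%:R) * a q) s).
Proof.
have hlin q : is_d s (fun s : R => 2 * pi * (q.+1%:R * s)) (2 * pi * q.+1%:R).
  apply: is_dZ; apply: (is_derive_eq (is_dZ _ (is_derive_id s 1))); exact: mulr1.
have hc q : is_d s (fun s : R => costau (q.+1%:R * s)) (- (2 * pi * q.+1%:R) * sintau (q.+1%:R * s)).
  apply: (is_derive_eq (is_d_comp (is_derive_cos _) (hlin q))); rewrite /sintau; ring.
have hs q : is_d s (fun s : R => sintau (q.+1%:R * s)) (2 * pi * q.+1%:R * costau (q.+1%:R * s)).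
  apply: (is_derive_eq (is_d_comp (is_derive_sin _) (hlin q))); rewrite /costau; ring.
apply: (is_dD (is_derive_cst g s 1)).
apply: (@is_d_sum _ _ (fun (q : 'I_D) s => a q * costau (q.+1%:R * s) + c q * sintau (q.+1%:R * s))
  (fun (q : 'I_D) s => 2 * pi * q.+1%:R * c q * costau (q.+1%:R * s) + - (2 * pi * q.+1%:R) * a q * sintau (q.+1%:R * s))) => q.
apply: (is_derive_eq (is_dD (is_dZ (a q) (hc q)) (is_dZ (c q) (hs q)))); ring.
Qed.

End derivatives.

Section vertical_derivative.
Variables (R : realType) (n : nat).
Notation V := 'rV[R]_n.+1.
Notation X := (n.+1.-tuple R).
Notation E := (Ex (Lam R n.+1)).
Notation U := (uniform_prob (@ltr01 R)).

Definition vder (f df : V -> R) := forall x (s : R), is_derive s (1 : R) (fun s => f (vert x s)) (df (vert x s)).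

Lemma tp_vder f : trig_poly f -> exists df, trig_poly df /\ vder f df.
Proof.
move: f; apply: tp_ind => [|m al be f _ [df [tdf vdf]]].
  by exists (fun=> 0); split; [exact: tp_cst|move=> x s; exact: is_derive_cst].
pose k : R := 2 * pi * (m 0 ord_max)%:~R.
exists (fun x => (k * be) * costau (dot m x) + (- k * al) * sintau (dot m x) + df x); split.
  by apply: tpD => //; exact: tp_cs.
move=> x s; apply: is_dD; last exact: vdf.
have hlin : is_derive s (1 : R) (fun s : R => 2 * pi * dot m (vert x s)) k.
  under eq_fun do rewrite dot_vert mulrDr mulrA -/k.
  apply: (is_derive_eq (is_dD (is_derive_cst _ s 1) (is_dZ k (is_derive_id s 1)))); ring.
have hc := is_d_comp (is_derive_cos _) hlin.
have hs := is_d_comp (is_derive_sin _) hlin.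
apply: (is_derive_eq (is_dD (is_dZ al hc) (is_dZ be hs))); rewrite /costau /sintau; ring.
Qed.

Lemma cb_vert (f : V -> R) x : trig_poly f -> cb (fun s => f (vert x s)).
Proof.
move=> tf; have [df [_ vdf]] := tp_vder tf; split; last by have [M [_ HM]] := tp_bounded tf; exists M.
exact: (is_d_continuous (df := fun s => df (vert x s))).
Qed.

Lemma bm_vert f : trig_poly f -> bm (fun p : X * R => f (vert (rv p.1) p.2)).
Proof.
move=> tf; have [D [f0 [a [c [t0 ta tc _ fE]]]]] := fibre_decomposition tf.
under eq_fun do rewrite fE.
have bf (p : V -> R) : trig_poly p -> bm (fun z : X * R => p (rv z.1)).
  by move=> tp0; apply: (bm_comp (T' := (X * R)%type) (h := fst) _ (bm_tp tp0)).
apply: bmD; first exact: bf.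
apply: bm_sum => q; apply: bmD; apply: bmM; try exact: bf.
- by apply: (bm_comp (T' := (X * R)%type) (h := snd) _ (bm_costau q.+1%:R)).
- by apply: (bm_comp (T' := (X * R)%type) (h := snd) _ (bm_sintau q.+1%:R)).
Qed.

Lemma Ex_fibre (F : V -> R) : periodic F -> bm (F \o @rv R n.+1) ->
  bm (fun p : X * R => F (vert (rv p.1) p.2)) ->
  E (F \o @rv R n.+1) = E (fun t => Ex U (fun s => F (vert (rv t) s))).
Proof.
move=> pF bF bvF; rewrite (@Ex_Fubini _ _ _ _ _ (Lam R n.+1) U _ bvF).
rewrite -[LHS](Ex_cst U); congr (Ex _ _); apply/funext => s.
by rewrite -(Ex_translate (s *: e_ R ord_max) pF bF).
Qed.

Lemma Ex_vder f df : trig_poly f -> trig_poly df -> vder f df -> E (df \o @rv R n.+1) = 0.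
Proof.
move=> tf tdf vdf; rewrite Ex_fibre; [|exact: tp_periodic|exact: bm_tp|exact: bm_vert].
rewrite -[RHS](Ex_cst (Lam R n.+1)); congr (Ex _ _); apply/funext => t.
apply: (Ex_uniform_deriv (Y := fun s => f (vert (rv t) s))) => //; first exact: cb_vert.
by rewrite vert0 vert1//; exact: tp_periodic.
Qed.

End vertical_derivative.

(** * Counting the terms of a separated sequence in a window *)

Section counting.
Variables (R : realType) (c0 M : R).
Hypothesis c0p : 0 < c0.
Hypothesis M0 : 0 <= M.

(** The maximum with zero keeps the bound true for sequences that start beyond the window, as the
    induction requires. *)
Lemma count_small_le (s : nat -> R) N t : (forall k, c0 <= s k.+1 - s k) ->
  \sum_(k < N) small M (t - s k) <= Num.max 0 ((t - s 0%N + M) / c0 + 1).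
Proof.
elim: N s => [|N IH] s hs; first by rewrite big_ord0 le_max lexx.
rewrite big_ord_recl/=; apply: le_trans (_ : small M (t - s 0%N) + Num.max 0 ((t - s 1%N + M) / c0 + 1) <= _).
  by rewrite lerD2l; apply: (IH (fun k => s k.+1)).
have h1 : (t - s 1%N + M) / c0 + 1 <= (t - s 0%N + M) / c0.
  have c0n : c0 != 0 by rewrite gt_eqF.
  rewrite -[X in _ + X](divff c0n) -mulrDl ler_pM2r ?invr_gt0//.
  by have := hs 0%N; lra.
rewrite /small; have [|] := boolP (`|_| <= M) => h.
  have h2 : 0 <= (t - s 0%N + M) / c0 by apply: divr_ge0; [move: h; rewrite ler_norml; lra|exact: ltW].
  by rewrite le_max; apply/orP; right; rewrite addrC lerD2r ge_max h2.
by rewrite add0r ge_max !le_max lexx/=; apply/orP; right; lra.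
Qed.

(** Terms before the window are dropped up to the first one with [t - s 0 <= M]; from there the
    previous bound no longer depends on [t]. *)
Lemma count_small (s : nat -> R) N t : (forall k, c0 <= s k.+1 - s k) ->
  \sum_(k < N) small M (t - s k) <= 2 * M / c0 + 1.
Proof.
elim: N s => [|N IH] s hs; first by rewrite big_ord0 addr_ge0// divr_ge0 ?mulr_ge0// ltW.
have [tM|tM] := leP (t - s 0%N) M.
  apply: le_trans (count_small_le _ _ hs) _; rewrite ge_max; apply/andP; split.
    by rewrite addr_ge0// divr_ge0 ?mulr_ge0// ltW.
  by rewrite lerD2r ler_pM2r ?invr_gt0//; lra.
rewrite big_ord_recl/= [small _ _](_ : _ = 0); last first.
  by rewrite /small (_ : (_ <= M) = false)//; apply/negbTE; rewrite -ltNge (lt_le_trans tM (ler_norm _)).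
rewrite add0r.
exact: (IH (fun k => s k.+1)).
Qed.

End counting.

(** * Cancellation by shearing on fibres *)

Section birkhoff_differences.
Variables (R : realType) (n : nat) (A : 'M[int]_n) (b : 'rV[R]_n).
Notation T := (Tlift A b).
Notation S := (bsumT A b).

Lemma bsumT_add f i j x : S f (i + j) x = S f i x + S f j (iter i T x).
Proof.
rewrite /bsumT big_split_ord/=; congr (_ + _).
by apply: eq_bigr => p _; rewrite addnC iterD.
Qed.

Lemma bsumT_diff_le (f : 'rV[R]_n -> R) e C : (forall x l, `|S f l x| <= e * l%:R + C) ->
  forall x i j, `|S f i x - S f j x| <= e * `|i%:R - j%:R| + C.
Proof.
move=> H; have main x i j : (j <= i)%N -> `|S f i x - S f j x| <= e * `|i%:R - j%:R| + C.
  move=> ji; rewrite -(subnKC ji) bsumT_add addrAC subrr add0r natrD addrAC subrr add0r.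
  by rewrite (ger0_norm (ler0n _ _)); exact: H.
move=> x i j; have [|ij] := leqP j i; first exact: main.
by rewrite distrC (distrC i%:R); apply: main; exact: ltnW.
Qed.

Lemma bsumT_diff_ge (f : 'rV[R]_n -> R) c0 : (forall x, c0 <= f x) ->
  forall x i j, c0 * `|i%:R - j%:R| <= `|S f i x - S f j x|.
Proof.
move=> H.
have S0 x l : c0 * l%:R <= S f l x.
  rewrite (_ : c0 * l%:R = \sum_(i < l) c0); last by rewrite sumr_const card_ord mulr_natr.
  by apply: ler_sum => i _; exact: H.
have main x i j : (j <= i)%N -> c0 * `|i%:R - j%:R| <= `|S f i x - S f j x|.
  move=> ji; rewrite -(subnKC ji) bsumT_add addrAC subrr add0r natrD addrAC subrr add0r.
  by rewrite (ger0_norm (ler0n _ _)); apply: le_trans (S0 _ _) (ler_norm _).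
move=> x i j; have [|ij] := leqP j i; first exact: main.
by rewrite distrC [leRHS]distrC; apply: main; exact: ltnW.
Qed.

Lemma bsumTZ r (f : 'rV[R]_n -> R) l x : S (fun y => r * f y) l x = r * S f l x.
Proof. by rewrite /bsumT mulr_sumr. Qed.

End birkhoff_differences.

Section regularised_inverse.
Variable R : realFieldType.

(* [P / (P^2 + Q^2)] is a substitute for [1 / P] that stays bounded near the zeros of [P]. *)
Definition reginv (Q P : R) : R := P / (P ^+ 2 + Q ^+ 2).

Variables (Q P : R).
Hypothesis Q0 : 0 < Q.

Let den : 0 < P ^+ 2 + Q ^+ 2. Proof. by rewrite ltr_wpDl ?sqr_ge0// exprn_gt0. Qed.

Lemma reginv_le : `|reginv Q P| <= Q^-1.
Proof.
rewrite /reginv normrM normfV (ger0_norm (ltW den)) ler_pdivrMr// mulrC ler_pdivlMr//.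
have : `|P| ^+ 2 = P ^+ 2 by rewrite real_normK// num_real.
have := normr_ge0 P; move: `|P| => p p0 <-; nra.
Qed.

Lemma reginvM : 1 - reginv Q P * P = Q ^+ 2 / (P ^+ 2 + Q ^+ 2).
Proof. by rewrite /reginv; field; rewrite gt_eqF. Qed.

Lemma reginvM_le1 : 0 <= Q ^+ 2 / (P ^+ 2 + Q ^+ 2) <= 1.
Proof.
rewrite divr_ge0 ?sqr_ge0 ?(ltW den)//= ler_pdivrMr// mul1r lerDr; exact: sqr_ge0.
Qed.

Lemma reginvM_le r : 0 < r -> r <= `|P| -> Q ^+ 2 / (P ^+ 2 + Q ^+ 2) <= (Q / r) ^+ 2.
Proof.
move=> r0 rP; rewrite expr_div_n ler_wpM2l ?sqr_ge0// lef_pV2 ?posrE ?exprn_gt0//.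
have -> : P ^+ 2 = `|P| ^+ 2 by rewrite real_normK// num_real.
by have := sqr_ge0 Q; nra.
Qed.

Definition dreginv (dP : R) : R := dP * (Q ^+ 2 - P ^+ 2) / (P ^+ 2 + Q ^+ 2) ^+ 2.

Lemma dreginv_le dP : `|dreginv dP| <= `|dP| / Q ^+ 2.
Proof.
rewrite /dreginv -mulrA normrM ler_wpM2l// normrM normfV [`|_ ^+ 2|]ger0_norm ?sqr_ge0//.
rewrite ler_pdivrMr ?exprn_gt0// mulrC ler_pdivlMr ?exprn_gt0//.
have [p0 q0] := (sqr_ge0 P, sqr_ge0 Q).
apply: (@le_trans _ _ ((P ^+ 2 + Q ^+ 2) * Q ^+ 2)).
  by rewrite ler_wpM2r// ler_norml; apply/andP; split; lra.
rewrite [leRHS]expr2; apply: ler_wpM2l; first exact: ltW.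
by rewrite lerDr.
Qed.

End regularised_inverse.

Section reginv_derivative.
Variable R : realType.

Lemma is_d_reginv (Q : R) (P : R -> R) (s dP : R) : 0 < Q -> is_derive s (1 : R) P dP ->
  is_derive s (1 : R) (fun s => reginv Q (P s)) (dreginv Q (P s) dP).
Proof.
move=> Q0 hP.
have den : 0 < P s ^+ 2 + Q ^+ 2 by rewrite ltr_wpDl ?sqr_ge0// exprn_gt0.
have hden : is_derive s (1 : R) (fun s => P s ^+ 2 + Q ^+ 2) (2 * P s * dP).
  under eq_fun do rewrite expr2.
  by apply: (is_derive_eq (is_dD (is_dM hP hP) (is_derive_cst (Q ^+ 2) s 1))); ring.
have dn : (fun s => P s ^+ 2 + Q ^+ 2) s != 0 by rewrite /= gt_eqF.
have hq := is_dM hP (is_dV (f := fun s => P s ^+ 2 + Q ^+ 2) dn hden); apply: (is_derive_eq hq).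
rewrite /dreginv /=; field; rewrite gt_eqF//.
Qed.

Lemma cb_reginv (Q : R) (P : R -> R) : 0 < Q -> cb P -> cb (fun s => reginv Q (P s)).
Proof.
move=> Q0 cP; apply: cbM => //; apply: (@cbV _ _ (Q ^+ 2)); first by rewrite exprn_gt0.
  by move=> s; rewrite lerDr sqr_ge0.
by under eq_fun do rewrite expr2; apply: cbD; [exact: cbM|exact: cb_cst].
Qed.

Lemma cb_dreginv (Q : R) (P dP : R -> R) : 0 < Q -> cb P -> cb dP -> cb (fun s => dreginv Q (P s) (dP s)).
Proof.
move=> Q0 cP cdP; apply: cbM.
  apply: cbM => //; apply: cbB; first exact: cb_cst.
  by under eq_fun do rewrite expr2; exact: cbM.
apply: (@cbV _ _ ((Q ^+ 2) ^+ 2)); first by rewrite !exprn_gt0.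
  by move=> s; rewrite ler_sqr ?nnegrE ?sqr_ge0 ?addr_ge0 ?sqr_ge0// lerDr sqr_ge0.
under eq_fun do rewrite expr2.
by apply: cbM; apply: cbD; try exact: cb_cst; under eq_fun do rewrite expr2; exact: cbM.
Qed.

End reginv_derivative.

Section shear.
Variables (R : realType) (n : nat) (A : 'M[int]_n.+1) (b : 'rV[R]_n.+1).
Hypothesis Au : upper_unipotent A.
Hypothesis irr : irrational_invariants A b.
Hypothesis nil : nu_nilpotent A.
Notation X := (n.+1.-tuple R).
Notation V := 'rV[R]_n.+1.
Notation T := (Tlift A b).
Notation E := (Ex (Lam R n.+1)).
Notation U := (uniform_prob (@ltr01 R)).
Notation S := (bsumT A b).
Variables (D : nat) (Psi Psi0 : V -> R) (a c : nat -> V -> R) (m0 C0 c0 : R).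
Hypothesis tP : trig_poly Psi.
Hypothesis ta : forall q, trig_poly (a q).
Hypothesis tc : forall q, trig_poly (c q).
Hypothesis PsiE : forall x s, Psi (vert x s) = trigp D (Psi0 x) (a ^~ x) (c ^~ x) s.
Hypothesis dev : forall l x, `|S Psi0 l x - l%:R * m0| <= C0.
Hypothesis c0p : 0 < c0.
Hypothesis Psic0 : forall x, c0 <= Psi x.
Hypothesis m0p : 0 < m0.
Notation H := (Hn A b D a c).

Lemma bsumT_fibre j x s : `|S Psi j (vert x s) - j%:R * m0| <= C0 + H j x.
Proof.
have := dev j x; rewrite (bsumT_vert b Au PsiE).
have := trigp_le D (S Psi0 j x) (fun q => S (a q) j x) (fun q => S (c q) j x) s.
rewrite [X in _ <= X -> _](_ : _ = H j x)//.
by rewrite !ler_norml; lra.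
Qed.

Lemma vder_iter (f df : V -> R) k : vder f df -> vder (fun x => f (iter k T x)) (fun x => df (iter k T x)).
Proof.
move=> vf x s; under eq_fun do rewrite (iter_vert b Au).
by rewrite (iter_vert b Au); exact: vf.
Qed.

Lemma vder_bsumT (f df : V -> R) k : vder f df -> vder (S f k) (S df k).
Proof.
move=> vf x s.
exact: (@is_d_sum _ _ _ (fun (j : 'I_k) s => f (iter j T (vert x s))) (fun (j : 'I_k) s => df (iter j T (vert x s))) s
  (fun j => vder_iter j vf x s)).
Qed.

(** The first derivative integrates to zero over each vertical circle, so its uniform average is
    zero. On fibres its sums have the coefficients of [S_j] multiplied by [2 pi (q + 1)] up to sign,
    and the second derivative is bounded through the same coefficients. *)
Lemma fibre_derivatives : exists Psi1 Psi2, [/\ trig_poly Psi1, trig_poly Psi2, vder Psi Psi1 & vder Psi1 Psi2] /\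
  [/\ unif_avg A b Psi1 0,
    forall j x s, S Psi1 j (vert x s) = trigp D 0 (fun q => 2 * pi * q.+1%:R * S (c q) j x)
      (fun q => - (2 * pi * q.+1%:R) * S (a q) j x) s &
    forall j x s, `|S Psi2 j (vert x s)| <= (2 * pi * D%:R) ^+ 2 * H j x].
Proof.
have [Psi1 [t1 v1]] := tp_vder tP; have [Psi2 [t2 v2]] := tp_vder t1.
have e1 x s : Psi1 (vert x s) = trigp D 0 (fun q => 2 * pi * q.+1%:R * c q x) (fun q => - (2 * pi * q.+1%:R) * a q x) s.
  have h := v1 x s; have h2 := is_d_trigp D (Psi0 x) (a ^~ x) (c ^~ x) s.
  have e : (fun s => Psi (vert x s)) = trigp D (Psi0 x) (a ^~ x) (c ^~ x) by apply/funext => s'; exact: PsiE.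
  rewrite e in h; by rewrite -(@derive_val _ _ _ _ _ _ _ h) -(@derive_val _ _ _ _ _ _ _ h2).
have e2 x s : Psi2 (vert x s) = trigp D 0 (fun q => - (2 * pi * q.+1%:R) ^+ 2 * a q x) (fun q => - (2 * pi * q.+1%:R) ^+ 2 * c q x) s.
  have h := v2 x s; have h2 := is_d_trigp D 0 (fun q => 2 * pi * q.+1%:R * c q x) (fun q => - (2 * pi * q.+1%:R) * a q x) s.
  have e : (fun s => Psi1 (vert x s)) = trigp D 0 (fun q => 2 * pi * q.+1%:R * c q x) (fun q => - (2 * pi * q.+1%:R) * a q x).
    by apply/funext => s'; exact: e1.
  rewrite e in h; rewrite -(@derive_val _ _ _ _ _ _ _ h) (@derive_val _ _ _ _ _ _ _ h2).
  by rewrite /trigp; congr (_ + _); apply: eq_bigr => q _; ring.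
have z j x : S (fun=> 0) j x = 0 :> R by rewrite /bsumT big1.
exists Psi1, Psi2; split; [by split|split].
- have [c' hc'] := unif_avg_tp irr nil t1.
  rewrite (_ : 0 = c')//; have := Ex_unif_avg Au (tp_periodic t1) (bm_tp t1) hc'.
  by rewrite (Ex_vder tP t1 v1).
- move=> j x s; rewrite (@bsumT_vert _ _ _ _ Au D Psi1 (fun=> 0) (fun q x => 2 * pi * q.+1%:R * c q x) (fun q x => - (2 * pi * q.+1%:R) * a q x))//.
  by rewrite z /trigp; congr (_ + _); apply: eq_bigr => q _; rewrite !bsumTZ.
- move=> j x s; rewrite (@bsumT_vert _ _ _ _ Au D Psi2 (fun=> 0) (fun q x => - (2 * pi * q.+1%:R) ^+ 2 * a q x) (fun q x => - (2 * pi * q.+1%:R) ^+ 2 * c q x))//.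
  rewrite z -[X in `|X|]subr0; apply: le_trans (trigp_le _ _ _ _ _) _.
  rewrite /H /trigp_norm mulr_sumr; apply: ler_sum => q _; rewrite !bsumTZ !normrM normrN -mulrDr.
  apply: ler_wpM2r; first by rewrite addr_ge0.
  rewrite ger0_norm ?sqr_ge0// ler_sqr ?nnegrE ?mulr_ge0 ?pi_ge0// ler_wpM2l ?mulr_ge0 ?pi_ge0//.
  by rewrite ler_nat.
Qed.

Variables (kap dkap : R -> R) (M be : R).
Hypothesis dk : forall x, is_derive x (1 : R) kap (dkap x).
Hypothesis ck : cb kap.
Hypothesis cdk : cb dkap.
Hypothesis M0 : 0 <= M.
Hypothesis kM : forall y, `|kap y| <= be * small M y.
Hypothesis dkM : forall y, `|dkap y| <= be * small M y.

Variables (g h : V -> R).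
Hypothesis tg : trig_poly g.
Hypothesis th : trig_poly h.

(** The kernel enters as the derivative of [kap], since the vertical derivative of [kap (t - S_k)]
    is [- dkap (t - S_k)] times that of [S_k]. *)
Definition shear_sum N t x : R := g x * \sum_(k < N) h (iter k T x) * dkap (t - S Psi k x).

Lemma be0 : 0 <= be.
Proof.
have := le_trans (normr_ge0 _) (kM 0); rewrite /small normr0 M0 mulr1; exact: id.
Qed.

Lemma count_bsumT N t x : \sum_(k < N) small M (t - S Psi k x) <= 2 * M / c0 + 1.
Proof.
by apply: (count_small c0p M0 (s := fun k => S Psi k x)) => k; rewrite /bsumT big_ord_recr/= addrAC subrr add0r.
Qed.

Lemma shear_sum_le B N t x : (forall y, `|g y| <= B) -> (forall y, `|h y| <= B) ->
  `|shear_sum N t x| <= (2 * M / c0 + 1) * (be * B ^+ 2).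
Proof.
move=> gB hB; have B0 : 0 <= B by apply: le_trans (gB x).
rewrite /shear_sum mulr_sumr; apply: le_trans (ler_norm_sum _ _ _) _.
apply: (@le_trans _ _ (\sum_(k < N) small M (t - S Psi k x) * (be * B ^+ 2))); last first.
  by rewrite -mulr_suml ler_wpM2r ?count_bsumT// mulr_ge0 ?be0 ?sqr_ge0.
apply: ler_sum => k _; rewrite mulrA normrM mulrA mulrC.
rewrite [leRHS](_ : _ = be * small M (t - S Psi k x) * (B * B)); last by ring.
by rewrite normrM; apply: ler_pM; rewrite ?normr_ge0 ?dkM ?mulr_ge0// ler_pM.
Qed.

(** The product rule for [g h W kap], regrouped: the main term survives only through [1 - W * Pk],
    and the other terms carry a factor [W] or [dW]. *)
Lemma shear_term_le (w B r gv hv g1v h1v kv dkv W Pk dW : R) :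
  `|gv| <= B -> `|hv| <= B -> `|g1v| <= B -> `|h1v| <= B -> `|kv| <= w -> `|dkv| <= w ->
  `|1 - W * Pk| + 2 * `|W| + `|dW| <= r ->
  `|gv * (hv * dkv) + (((g1v * hv + gv * h1v) * W + gv * hv * dW) * kv + gv * hv * W * (dkv * - Pk))| <= w * (B * B * r).
Proof.
move=> gB hB g1B h1B kw dkw Wr.
have w0 : 0 <= w by apply: le_trans dkw.
have B0 : 0 <= B by apply: le_trans gB.
have BM u v : `|u| <= B -> `|v| <= B -> `|u * v| <= B * B by move=> uB vB; rewrite normrM ler_pM.
rewrite (_ : _ + _ = dkv * (gv * hv) * (1 - W * Pk) + kv * (g1v * hv * W + gv * h1v * W + gv * hv * dW)); last by ring.
apply: (@le_trans _ _ (w * (B * B) * `|1 - W * Pk| + w * (B * B * `|W| + B * B * `|W| + B * B * `|dW|))).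
  apply: le_trans (ler_normD _ _) _; apply: lerD.
    by rewrite normrM ler_wpM2r// normrM ler_pM// BM.
  rewrite normrM ler_pM//; apply: le_trans (ler_normD _ _) _; apply: lerD; last by rewrite normrM ler_wpM2r// BM.
  by apply: le_trans (ler_normD _ _) _; apply: lerD; rewrite normrM ler_wpM2r// BM.
rewrite (_ : _ + _ = w * (B * B) * (`|1 - W * Pk| + 2 * `|W| + `|dW|)); last by ring.
by rewrite [leRHS]mulrA ler_wpM2l// mulr_ge0// mulr_ge0.
Qed.

(** Integration by parts with [W], a regularised inverse of the vertical derivative of [S_m], for
    the single index [m]. Four errors arise: the part of the fibre where that derivative is small,
    the defect of the inverse elsewhere, the passage from [m] to [k], and terms of order [1 / H].
    Each is at most [e2], up to the common factor [K]. *)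
Lemma fibre_bound e : 0 < e -> exists2 Hs, 0 <= Hs & forall x m t N, `|t - m%:R * m0| <= m0 -> Hs < H m x ->
  `|Ex U (fun s => shear_sum N t (vert x s))| <= e.
Proof.
move=> e0.
have [Psi1 [Psi2 [[t1 t2 v1 v2] [u1 P1E P2H]]]] := fibre_derivatives.
have [g1 [tg1 vg]] := tp_vder tg; have [h1 [th1 vh]] := tp_vder th.
have [B [B0 gB hB g1B h1B]] : exists B, [/\ 0 <= B, forall x, `|g x| <= B, forall x, `|h x| <= B,
    forall x, `|g1 x| <= B & forall x, `|h1 x| <= B].
  have [B1 [B10 HB1]] := tp_bounded tg; have [B2 [B20 HB2]] := tp_bounded th.
  have [B3 [B30 HB3]] := tp_bounded tg1; have [B4 [B40 HB4]] := tp_bounded th1.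
  exists (B1 + B2 + B3 + B4); split; first lra.
  - by move=> x; apply: le_trans (HB1 x) _; lra.
  - by move=> x; apply: le_trans (HB2 x) _; lra.
  - by move=> x; apply: le_trans (HB3 x) _; lra.
  - by move=> x; apply: le_trans (HB4 x) _; lra.
pose cnt := 2 * M / c0 + 1.
have cnt0 : 0 <= cnt by rewrite addr_ge0// divr_ge0 ?mulr_ge0// ltW.
pose K := cnt * (be * (B * B)).
have K0 : 0 <= K by rewrite mulr_ge0// mulr_ge0 ?be0// mulr_ge0.
pose e2 := Num.min 1 (e / (4 * (K + 1))).
have e20 : 0 < e2 by rewrite lt_min ltr01 divr_gt0// mulr_gt0// ltr_wpDl.
have e21 : e2 <= 1 by rewrite ge_min lexx.
have Ke2 : K * (4 * e2) <= e.
  have : e2 <= e / (4 * (K + 1)) by rewrite ge_min lexx orbT.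
  by rewrite ler_pdivlMr ?mulr_gt0// ?ltr_wpDl// => h2; nra.
have [eta' [eta'0 Hlev]] := @level_set_small R D e2 e20.
(* A factor [e2] below the sublevel scale [eta']: off the sublevel set the defect of the regularised
   inverse is at most [e2 ^+ 2]. *)
pose eta := eta' * e2.
have eta0 : 0 < eta by rewrite mulr_gt0.
(* [|m - k|] will be at most about [H / c0], and [e1] times this is [e2 * Q]. *)
pose e1 := e2 * eta * c0.
have e10 : 0 < e1 by rewrite !mulr_gt0.
have [C1 HC1] := u1 _ e10.
pose C2 := (2 * pi * D%:R) ^+ 2 : R.
have C20 : 0 <= C2 by exact: sqr_ge0.
(* Collects the error terms that end up divided by [H]. *)
pose R1 := (e1 * (M + m0 + C0) / c0 + C1 + 2) / eta + C2 / eta ^+ 2.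
exists (Num.max 0 (R1 / e2)); first by rewrite le_max lexx.
move=> x m t N tm; rewrite gt_max => /andP[H0 HR1].
set Hx := H m x in H0 HR1.
pose Q := eta * Hx; have Q0 : 0 < Q by rewrite mulr_gt0.
have R1e : R1 / Hx <= e2 by rewrite ler_pdivrMr// mulrC -ler_pdivrMr// ltW.
pose P s := S Psi1 m (vert x s); pose dP s := S Psi2 m (vert x s).
pose W s := reginv Q (P s); pose dW s := dreginv Q (P s) (dP s).
have tP1 k : trig_poly (S Psi1 k) by exact: tp_bsumT.
have dPk k (s : R) : is_derive s (1 : R) (fun s => t - S Psi k (vert x s)) (- S Psi1 k (vert x s)).
  by apply: (is_derive_eq (is_deriveB (is_derive_cst t s 1) (vder_bsumT k v1 x s))); rewrite sub0r.
have cbP : cb P by exact: cb_vert.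
have cbdP : cb dP by apply: cb_vert; exact: tp_bsumT.
have cbW : cb W by exact: cb_reginv.
have cbdW : cb dW by exact: cb_dreginv.
have dWs (s : R) : is_derive s (1 : R) W (dW s) by apply: is_d_reginv => //; exact: (vder_bsumT m v2 x s).
pose hk k s := h (iter k T (vert x s)); pose h1k k s := h1 (iter k T (vert x s)).
pose kk k s := kap (t - S Psi k (vert x s)); pose dkk k s := dkap (t - S Psi k (vert x s)).
have cbhk k : cb (hk k) by apply: (cb_vert (f := fun x => h (iter k T x))); exact: tp_iter.
have cbh1k k : cb (h1k k) by apply: (cb_vert (f := fun x => h1 (iter k T x))); exact: tp_iter.
have cS k : continuous (fun s => t - S Psi k (vert x s)) := is_d_continuous (dPk k).
have cbkk k : cb (kk k) by apply: cb_comp.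
have cbdkk k : cb (dkk k) by apply: cb_comp.
have [cbg cbg1] : cb (fun s => g (vert x s)) /\ cb (fun s => g1 (vert x s)) by split; exact: cb_vert.
pose Yk k s := g (vert x s) * hk k s * W s * kk k s.
pose dYk k s := ((g1 (vert x s) * hk k s + g (vert x s) * h1k k s) * W s + g (vert x s) * hk k s * dW s) * kk k s +
  g (vert x s) * hk k s * W s * (dkk k s * - S Psi1 k (vert x s)).
have isYk k (s : R) : is_derive s (1 : R) (Yk k) (dYk k s).
  have d1 := is_dM (is_dM (vg x s) (vder_iter k vh x s)) (dWs s).
  exact: (is_dM d1 (is_d_comp (dk _) (dPk k s))).
have cbP1 k : cb (fun s => S Psi1 k (vert x s)) by exact: cb_vert.
have cbdYk k : cb (dYk k).
  apply: cbD; apply: cbM => //.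
  - by apply: cbD; apply: cbM => //; [apply: cbD|]; exact: cbM.
  - by apply: cbM => //; exact: cbM.
  - by apply: cbM => //; exact: cbN.
pose dY s := \sum_(k < N) dYk k s.
have cbdY : cb dY by exact: cb_sum.
have EdY : Ex U dY = 0.
  apply: (Ex_uniform_deriv (Y := fun s => \sum_(k < N) Yk k s)) => //.
    by move=> s; exact: (@is_d_sum _ _ _ (fun (k : 'I_N) => Yk k) (fun (k : 'I_N) => dYk k) s (fun k => isYk k s)).
  have per (f : V -> R) : trig_poly f -> f (vert x 1) = f (vert x 0) by move=> /tp_periodic pf; rewrite vert0 vert1.
  apply: eq_bigr => k _; rewrite /Yk /hk /W /kk /P.
  by rewrite (per _ tg) (per _ (tp_iter A b k th)) (per _ (tP1 m)) (per _ (tp_bsumT A b k tP)).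
pose Z s := shear_sum N t (vert x s).
have cbZ : cb Z by apply: cbM => //; apply: cb_sum => k; exact: (cbM (cbhk k) (cbdkk k)).
(* Adding the derivative of a periodic function costs nothing. *)
have -> : Ex U Z = Ex U (fun s => Z s + dY s).
  by rewrite ExD ?EdY ?addr0//; exact: cb_bm.
have bZdY : bm (fun s => Z s + dY s) by apply: cb_bm; exact: cbD.
have bsm : bm (fun s => small (eta' * Hx) (P s)) by apply: bm_small; exact: bm_measurable (cb_bm cbP).
apply: le_trans (@Ex_abs _ _ R U (fun s => Z s + dY s) bZdY) _.
apply: (@le_trans _ _ (Ex U (fun s => K * (small (eta' * Hx) (P s) + 3 * e2)))); last first.
  rewrite ExZ; last by apply: bmD => //; exact: bm_cst.
  rewrite ExD ?Ex_cst//; last exact: bm_cst.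
  apply: le_trans Ke2; rewrite ler_wpM2l// (_ : 4 * e2 = e2 + 3 * e2); last by ring.
  rewrite lerD2r; apply: Ex_uniform_small; first exact: bm_measurable (cb_bm cbP).
  set al := fun q => 2 * pi * q.+1%:R * S (c q) m x; set ga := fun q => - (2 * pi * q.+1%:R) * S (a q) m x.
  have nH : Hx <= trigp_norm D al ga.
    apply: ler_sum => q _; rewrite /al /ga !normrM normrN addrC.
    have pq : 1 <= `|2 : R| * `|pi| * `|q.+1%:R|.
      rewrite !ger0_norm ?pi_ge0//; have := pi_ge2 R => p2.
      have : 1 <= q.+1%:R :> R by rewrite ler1n.
      nra.
    by rewrite lerD// ler_peMl// !normrM.
  have n0 : 0 < trigp_norm D al ga by apply: lt_le_trans nH.
  apply: le_trans (Hlev 0 al ga n0); apply: le_measure; rewrite ?inE.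
  - rewrite (_ : [set s | _] = `[0, 1[ `&` [set s | `|P s| <= eta' * Hx]).
      by apply: measurableI => //; apply: measurable_norm_le; exact: bm_measurable (cb_bm cbP).
    by apply/seteqP; split=> s /=; rewrite in_itv.
  - rewrite (_ : [set s | _] = `[0, 1[ `&` [set s | `|trigp D 0 al ga s| <= eta' * trigp_norm D al ga]).
      by apply: measurableI => //; apply: measurable_norm_le; exact: measurable_trigp.
    by apply/seteqP; split=> s /=; rewrite in_itv.
  move=> s /= [s01 Ps]; split=> //; rewrite -P1E; apply: le_trans Ps _.
  by rewrite ler_wpM2l// ltW.
apply: Ex_le; [exact: bm_abs|by apply: bmZ; apply: bmD => //; exact: bm_cst|move=> s].
rewrite /Z /dY /shear_sum mulr_sumr -big_split/=; apply: le_trans (ler_norm_sum _ _ _) _.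
set r := small _ _ + _.
have r0 : 0 <= r by rewrite addr_ge0 ?small_ge0// mulr_ge0// ltW.
apply: (@le_trans _ _ (\sum_(k < N) small M (t - S Psi k (vert x s)) * (be * (B * B) * r))); last first.
  rewrite -mulr_suml /K -[leRHS]mulrA; apply: ler_wpM2r; last exact: count_bsumT.
  by rewrite mulr_ge0// mulr_ge0 ?be0// mulr_ge0.
apply: ler_sum => k _; rewrite [leRHS](_ : _ = be * small M (t - S Psi k (vert x s)) * (B * B * r)); last by ring.
(* Outside the window both kernels vanish. Inside it [S_k] and [S_m] differ by at most [H] plus a
   constant, and the lower bound [c0] of [Psi] converts this into a bound for [|m - k|]. *)
have [Sk|Sk] := boolP (`|t - S Psi k (vert x s)| <= M); last first.
  have z : small M (t - S Psi k (vert x s)) = 0 by rewrite /small (negbTE Sk).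
  have kz := kM (t - S Psi k (vert x s)); have dkz := dkM (t - S Psi k (vert x s)).
  rewrite z mulr0 in kz dkz *; rewrite mul0r.
  have k0 : kk k s = 0 by apply/eqP; rewrite -normr_le0.
  have dk0 : dkk k s = 0 by apply/eqP; rewrite -normr_le0.
  by rewrite /dYk k0 -/(dkk k s) dk0; rewrite !(mulr0, mul0r, addr0) normr0.
apply: (shear_term_le (gB _) (hB _) (g1B _) (h1B _) (kM _) (dkM _)).
have gap : `|m%:R - k%:R| <= (M + m0 + C0 + Hx) / c0.
  rewrite ler_pdivlMr// mulrC distrC; apply: le_trans (bsumT_diff_ge A b Psic0 (vert x s) _ _) _.
  have := bsumT_fibre m x s; move: tm Sk; rewrite -/Hx.
  move: (S Psi k _) (S Psi m _) (m%:R * m0) => y1 y2 y3; rewrite !ler_norml; lra.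
have PP : `|P s - S Psi1 k (vert x s)| <= e1 * ((M + m0 + C0 + Hx) / c0) + C1.
  have HC1' y l : `|S Psi1 l y| <= e1 * l%:R + C1 by have := HC1 y l; rewrite mulr0 subr0.
  by apply: le_trans (bsumT_diff_le HC1' (vert x s) _ _) _; rewrite lerD2r ler_wpM2l// ltW.
have Wle : `|W s| <= Q^-1 := reginv_le (P s) Q0.
have dWle : `|dW s| <= C2 * Hx / Q ^+ 2.
  apply: le_trans (dreginv_le (P s) Q0 _) _; rewrite ler_wpM2r ?invr_ge0 ?sqr_ge0//.
  exact: P2H.
have W1 : `|1 - W s * P s| <= small (eta' * Hx) (P s) + e2.
  rewrite /W reginvM// ger0_norm; last by have /andP[] := reginvM_le1 (P s) Q0.
  rewrite /small; have [_|lt] := leP `|P s| _.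
    by have /andP[_ h2] := reginvM_le1 (P s) Q0; apply: le_trans h2 _; rewrite lerDl ltW.
  rewrite add0r; have eH0 : 0 < eta' * Hx by exact: mulr_gt0.
  apply: le_trans (reginvM_le Q0 eH0 (ltW lt)) _.
  rewrite (_ : Q / _ = e2); first by rewrite expr2 ler_piMl// ltW.
  by rewrite /Q /eta; field; rewrite !gt_eqF.
have W2 : `|1 - W s * S Psi1 k (vert x s)| <= small (eta' * Hx) (P s) + e2 + Q^-1 * (e1 * ((M + m0 + C0 + Hx) / c0) + C1).
  rewrite (_ : 1 - _ = (1 - W s * P s) + W s * (P s - S Psi1 k (vert x s))); last by ring.
  by apply: le_trans (ler_normD _ _) _; apply: lerD => //; rewrite normrM ler_pM.
rewrite /r; suff e3 : Q^-1 * (e1 * ((M + m0 + C0 + Hx) / c0) + C1) + 2 * Q^-1 + C2 * Hx / Q ^+ 2 = e2 + R1 / Hx by lra.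
rewrite /Q /R1 /e1; field; rewrite !gt_eqF//.
Qed.

Hypothesis gH : forall C d, 0 < d -> exists m1, forall m, (m1 <= m)%N -> E (fun t => small C (H m (rv t))) < d.

Lemma tp_bm_comp d (Y : measurableType d) (u : Y -> R) (f : R -> R) : cb f -> measurable_fun [set: Y] u ->
  bm (fun y => f (u y)).
Proof. by move=> cf mu; apply: (bm_comp mu (cb_bm cf)). Qed.

Lemma periodic_shear_sum N t : periodic (shear_sum N t).
Proof.
move=> x z; rewrite /shear_sum (tp_periodic tg); congr (_ * _); apply: eq_bigr => k _.
by rewrite (periodic_iter A b k (tp_periodic th)) (periodic_bsumT A b k (tp_periodic tP)).
Qed.

(** With [m] the integer part of [t / m0], the fibre bound applies wherever [H m] is large; the
    remaining points have small measure, and there the bound obtained by counting suffices. *)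
Lemma shear_cancellation e : 0 < e -> exists t0, forall t N, t0 <= t -> `|E (fun x => shear_sum N t (rv x))| <= e.
Proof.
move=> e0.
have [B1 [B10 HB1]] := tp_bounded tg; have [B2 [B20 HB2]] := tp_bounded th.
pose B := B1 + B2.
have gB x : `|g x| <= B by apply: le_trans (HB1 x) _; rewrite /B; lra.
have hB x : `|h x| <= B by apply: le_trans (HB2 x) _; rewrite /B; lra.
pose K := (2 * M / c0 + 1) * (be * B ^+ 2).
have K0 : 0 <= K.
  by rewrite mulr_ge0 ?(mulr_ge0 be0) ?sqr_ge0// addr_ge0// divr_ge0 ?mulr_ge0// ltW.
have e20 : 0 < e / 2 by rewrite divr_gt0.
have [Hs Hs0 HHs] := fibre_bound e20.
have d0 : 0 < e / (2 * (K + 1)) by rewrite divr_gt0// mulr_gt0// ltr_wpDl.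
have [m1 Hm1] := gH Hs d0.
exists (m1.+1%:R * m0) => t N tm1.
pose m := Num.truncn (t / m0).
have t0 : 0 <= t / m0 by rewrite divr_ge0 ?(le_trans _ tm1)// ?mulr_ge0// ltW.
have /andP[tl tu] := truncn_itv t0.
have m1m : (m1 <= m)%N.
  have : m1.+1%:R < m.+1%:R :> R by apply: le_lt_trans tu; rewrite ler_pdivlMr.
  by rewrite ltr_nat ltnS => /ltnW.
have tm : `|t - m%:R * m0| <= m0.
  rewrite ler_pdivlMr// in tl; rewrite ltr_pdivrMr// -natr1 mulrDl mul1r in tu.
  by rewrite ler_norml; lra.
have bF : bm (fun x => shear_sum N t (rv x)).
  apply: bmM; first exact: bm_tp.
  apply: bm_sum => k; apply: bmM; first exact: (bm_tp (tp_iter A b k th)).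
  apply: tp_bm_comp => //; apply: measurable_funB => //; exact: bm_measurable (bm_tp (tp_bsumT A b k tP)).
have bvF : bm (fun p : X * R => shear_sum N t (vert (rv p.1) p.2)).
  apply: bmM; first exact: bm_vert.
  apply: bm_sum => k; apply: bmM; first exact: (bm_vert (tp_iter A b k th)).
  apply: tp_bm_comp => //; apply: measurable_funB => //; exact: bm_measurable (bm_vert (tp_bsumT A b k tP)).
rewrite (Ex_fibre (@periodic_shear_sum N t) bF bvF).
have bEU := @bm_Ex _ _ _ _ _ (Lam R n.+1) U _ bvF.
have bsm : bm (fun x : X => small Hs (H m (rv x))).
  by apply: bm_small; exact: bm_measurable (bm_Hn A b D ta tc m).
apply: le_trans (Ex_abs _ bEU) _.
apply: (@le_trans _ _ (E (fun x => e / 2 + K * small Hs (H m (rv x))))).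
  apply: Ex_le; [exact: bm_abs|by apply: bmD; [exact: bm_cst|exact: bmZ]|move=> x].
  rewrite /small (ger0_norm (Hn_ge0 _ _ _ _ _ _ _)); have [_|lt] := leP (H m (rv x)) Hs.
    rewrite mulr1 (@le_trans _ _ K)//; last by rewrite lerDr ltW.
    by apply: Ex_norm_le => [|s]; [exact: (bm_pair bvF)|exact: shear_sum_le].
  by rewrite mulr0 addr0; apply: HHs tm lt.
rewrite ExD ?Ex_cst; [|exact: bm_cst|exact: bmZ].
rewrite ExZ//; have := Hm1 m m1m; rewrite ltr_pdivlMr ?mulr_gt0 ?ltr_wpDl//.
have : 0 <= E (fun x : X => small Hs (H m (rv x))) by apply: Ex_ge0 => x; exact: small_ge0.
by move: (E _) => u u0 hu; nra.
Qed.

End shear.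

(** * The averaged kernel *)

Section positive_part.
Variable R : realType.
Implicit Types u v x y : R.

Definition pp x : R := Num.max 0 x.
Definition pq x : R := pp x ^+ 2 / 2.

Lemma ppE x : 0 <= x -> pp x = x. Proof. by move=> x0; rewrite /pp (max_idPr x0). Qed.
Lemma pp0 x : x <= 0 -> pp x = 0. Proof. by move=> x0; rewrite /pp (max_idPl x0). Qed.

Lemma pq_quad u v : `|pq u - pq v - (u - v) * pp v| <= (u - v) ^+ 2 / 2.
Proof.
have s := sqr_ge0 (u - v).
rewrite /pq ler_norml; have [u0|/ltW u0] := leP u 0; have [v0|/ltW v0] := leP v 0.
- by rewrite (pp0 u0) (pp0 v0) !expr2; apply/andP; split; nra.
- have uv : u * v <= 0 by rewrite mulr_le0_ge0.
  by rewrite (pp0 u0) (ppE v0) !expr2; apply/andP; split; nra.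
- have uv : u * v <= 0 by rewrite mulr_ge0_le0.
  by rewrite (ppE u0) (pp0 v0) !expr2; apply/andP; split; nra.
- by rewrite (ppE u0) (ppE v0) !expr2; apply/andP; split; nra.
Qed.

Lemma is_d_pq x : is_derive x (1 : R) pq (pp x).
Proof.
have H : (fun h : R => h^-1 *: ((pq \o shift x) (h *: (1 : R)) - pq x)) @ 0^' --> pp x.
  apply/cvgrPdist_le => e e0; near=> h.
  have h0 : h != 0 by near: h; exact: nbhs_dnbhs_neq.
  rewrite /= /GRing.scale/= mulr1 distrC.
  have -> : h^-1 * (pq (h + x) - pq x) - pp x = h^-1 * (pq (h + x) - pq x - ((h + x) - x) * pp x).
    by rewrite addrK [RHS]mulrBr [h^-1 * (h * _)]mulrA mulVf// mul1r.
  rewrite normrM; apply: le_trans (ler_wpM2l _ (pq_quad _ _)) _; first exact: normr_ge0.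
  rewrite addrK normfV -real_normK ?num_real// (_ : _ * _ = `|h| / 2).
    have : `|h| <= e by near: h; apply: dnbhs0_le.
    have := normr_ge0 h; lra.
  by field; rewrite normr_eq0.
by apply: DeriveDef; [exact: cvgP H|exact: cvg_lim H].
Unshelve. all: by end_near.
Qed.

Lemma continuous_pp : continuous pp.
Proof. by move=> x; apply: (@continuous_max R _ (cst 0) id x); [exact: cst_continuous|exact: id]. Qed.

Lemma compact_support_bound (f : R -> R) M : continuous f -> (forall y, M < `|y| -> f y = 0) ->
  exists2 be, 0 <= be & forall y, `|f y| <= be * small M y.
Proof.
move=> cf fM.
have : compact (f @` `[- M, M]) by apply: continuous_compact; [exact: continuous_subspaceT|exact: segment_compact].
move=> /compact_bounded[B [_ HB]]; exists (`|B| + 1); first by rewrite addr_ge0.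
move=> y; rewrite /small; have [yM|yM] := leP `|y| M; last by rewrite fM// normr0 mulr0.
rewrite mulr1; apply: HB; first by rewrite ltr_pwDr// ler_norm.
by exists y => //; rewrite /= in_itv/= -ler_norml.
Qed.

(** The convolution of the indicators of [[0, p]] and [[0, q]], written with positive parts so that
    a primitive is explicit. Likewise [bump] is the tent of half-width [L] and integral one. *)
Definition overlap p q y : R := pp y - pp (y - p) - pp (y - q) + pp (y - p - q).
Definition overlap_prim p q y : R := pq y - pq (y - p) - pq (y - q) + pq (y - p - q).
Definition bump L y : R := (pp (y + L) - 2 * pp y + pp (y - L)) / L ^+ 2.
Definition bump_prim L y : R := (pq (y + L) - 2 * pq y + pq (y - L)) / L ^+ 2.

Lemma is_d_pq_shift c x : is_derive x (1 : R) (fun y => pq (y + c)) (pp (x + c)).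
Proof.
have h : is_derive x (1 : R) (fun y : R => y + c) 1.
  by apply: (is_derive_eq (is_dD (is_derive_id x 1) (is_derive_cst c x 1))); rewrite addr0.
by apply: (is_derive_eq (is_d_comp (is_d_pq _) h)); rewrite mulr1.
Qed.

Lemma is_d_overlap p q x : is_derive x (1 : R) (overlap_prim p q) (overlap p q x).
Proof.
have h := is_d_pq_shift.
have h4 : is_derive x (1 : R) (fun y => pq (y - p - q)) (pp (x - p - q)).
  by have := h (- p - q) x; under eq_fun do rewrite addrA; rewrite addrA.
exact: is_dD (is_deriveB (is_deriveB (is_d_pq x) (h (- p) x)) (h (- q) x)) h4.
Qed.

Lemma is_d_bump L x : is_derive x (1 : R) (bump_prim L) (bump L x).
Proof.
have h := is_d_pq_shift.
have := is_dZ (L ^+ 2)^-1 (is_dD (is_deriveB (h L x) (is_dZ 2 (is_d_pq x))) (h (- L) x)).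
rewrite /bump mulrC; congr is_derive.
by apply/funext => y; rewrite /bump_prim mulrC.
Qed.

Lemma continuous_pp_shift c : continuous (fun y => pp (y + c)).
Proof.
move=> x; apply: (@continuous_comp _ _ _ (fun y => y + c) pp); last exact: continuous_pp.
by apply: cvgD; [exact: cvg_id|exact: cvg_cst].
Qed.

Lemma continuous_overlap p q : continuous (overlap p q).
Proof.
have h := continuous_pp_shift.
move=> x; apply: cvgD; first by apply: cvgB; [apply: cvgB; [exact: continuous_pp|exact: h]|exact: h].
have e : (fun y : R => pp (y - p - q)) = (fun y => pp (y + (- p - q))) by apply/funext => y; rewrite addrA.
suff : {for x, continuous (fun y : R => pp (y - p - q))} by exact.
by rewrite e; exact: h.
Qed.

Lemma continuous_bump L : continuous (bump L).
Proof.
have h := continuous_pp_shift.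
move=> x; apply: cvgM; last exact: cvg_cst.
apply: cvgD; last exact: h.
by apply: cvgB; [exact: h|apply: cvgM; [exact: cvg_cst|exact: continuous_pp]].
Qed.

Lemma bump_tent L y : 0 < L -> bump L y = tent L y / L.
Proof.
move=> L0; rewrite /bump /tent.
have e : (1 - `|y| / L) / L = (L - `|y|) / L ^+ 2 by field; rewrite gt_eqF.
have [yL|yL] := leP L `|y|.
  rewrite (max_idPl _); last by rewrite subr_le0 ler_pdivlMr// mul1r.
  rewrite mul0r; have [y0|y0] := leP 0 y.
    rewrite ger0_norm// in yL; rewrite !ppE; [|lra..]; by rewrite (_ : _ + _ = 0) ?mul0r//; ring.
  rewrite ltr0_norm// in yL; rewrite !pp0; [|lra..]; by rewrite mulr0 subr0 addr0 mul0r.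
rewrite (max_idPr _); last by rewrite subr_ge0 ler_pdivrMr// mul1r ltW.
rewrite e; congr (_ / _); have [y0|y0] := leP 0 y.
  rewrite ger0_norm// in yL *; rewrite (ppE y0) [pp (y + L)]ppE; last lra.
  rewrite pp0; [ring|lra].
rewrite ltr0_norm// in yL *; rewrite (pp0 (ltW y0)) [pp (y + L)]ppE; last lra.
by rewrite pp0; [ring|lra].
Qed.

(* The overlap kernel and the bump have the same integral, so the primitive of their difference is compactly supported. *)
Lemma overlap_bump_support p q z L M y : 0 < L -> 0 <= p -> 0 <= q -> L <= M -> `|z| + p + q <= M -> M < `|y| ->
  overlap_prim p q (y - z) - p * q * bump_prim L y = 0 /\ overlap p q (y - z) - p * q * bump L y = 0.
Proof.
move=> L0 p0 q0 LM; have := ler_norm z; have := ler_norm (- z); rewrite normrN => z1 z2 zM.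
rewrite /overlap_prim /overlap /bump_prim /bump /pq; have [y0|y0] := leP 0 y.
  rewrite ger0_norm// => yM; rewrite !ppE; [|lra..].
  by split; field; rewrite gt_eqF.
rewrite ltr0_norm// => yM; rewrite !pp0; [|lra..].
by split; ring.
Qed.

End positive_part.

Section main_term.
Variables (R : realType) (n : nat) (A : 'M[int]_n) (b : 'rV[R]_n).
Notation V := 'rV[R]_n.
Notation T := (Tlift A b).
Notation S := (bsumT A b).
Variables (Psi : V -> R) (c0 Pm m0 : R).
Hypothesis c0p : 0 < c0.
Hypothesis Psic0 : forall x, c0 <= Psi x.
Hypothesis PsiPm : forall x, Psi x <= Pm.
Hypothesis m0p : 0 < m0.
Hypothesis Psi_avg : unif_avg A b Psi m0.

Lemma Pm0 : 0 < Pm.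
Proof. by apply: lt_le_trans (PsiPm 0); apply: lt_le_trans (Psic0 0). Qed.

Lemma bsumT0 f x : S f 0 x = 0. Proof. by rewrite /bsumT big_ord0. Qed.

Lemma bsumTr f l x : S f l.+1 x = S f l x + f (iter l T x).
Proof. by rewrite /bsumT big_ord_recr. Qed.

Lemma bsumT_ge j x : c0 * j%:R <= S Psi j x.
Proof. by elim: j => [|j IH]; rewrite ?bsumT0 ?mulr0// bsumTr -natr1 mulrDr mulr1 lerD. Qed.

Lemma bsumT_homo i j x : (i <= j)%N -> S Psi i x <= S Psi j x.
Proof.
move=> /subnKC <-; rewrite bsumT_add lerDl; apply: le_trans (bsumT_ge _ _).
by rewrite mulr_ge0// ltW.
Qed.

Lemma sum_ord_tail (f : nat -> R) J N : (forall j, (J <= j)%N -> f j = 0) -> (forall j, (N <= j)%N -> f j = 0) ->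
  \sum_(j < N) f j = \sum_(j < J) f j.
Proof.
have main I K : (I <= K)%N -> (forall j, (I <= j)%N -> f j = 0) -> \sum_(j < K) f j = \sum_(j < I) f j.
  move=> IK fI; rewrite -(subnKC IK) big_split_ord/= [X in _ + X]big1 ?addr0// => j _.
  by apply: fI; exact: leq_addr.
move=> fJ fN; rewrite -(main _ _ (leq_maxl N J) fN) -(main _ _ (leq_maxr N J) fJ).
by [].
Qed.

Lemma abel (u w : nat -> R) J : \sum_(j < J) u j * w j =
  (\sum_(j < J) u j) * w J - \sum_(j < J) (\sum_(i < j.+1) u i) * (w j.+1 - w j).
Proof.
elim: J => [|J IH]; first by rewrite !big_ord0; ring.
by rewrite !big_ord_recr/= IH ?big_ord_recr/=; ring.
Qed.

Section window.
Variables (L t : R) (J : nat).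
Hypothesis L0 : 0 < L.
Hypothesis tL : L <= t.
Hypothesis JL : t + L <= c0 * J%:R.

Let w x j := tent L (t - S Psi j x).

Lemma window_end x j : (J <= j)%N -> w x j = 0.
Proof.
move=> Jj; apply: tent_out => //; rewrite distrC (le_trans _ (ler_norm _))//.
have := bsumT_ge j x; have : c0 * J%:R <= c0 * j%:R by rewrite ler_pM2l// ler_nat.
by move: JL; lra.
Qed.

(** Abel summation: the last weight is zero and consecutive weights differ by at most [Pm / L], so
    only partial sums of [g] matter. *)
Lemma window_oscillation g e C x : (forall x l, `|S g l x| <= e * l%:R + C) -> 0 <= e ->
  `|\sum_(j < J) g (iter j T x) * w x j| <= J%:R * (e * J%:R + C) * (Pm / L).
Proof.
move=> gS e0; rewrite (abel (fun j => g (iter j T x)) (w x)) window_end// mulr0 sub0r normrN.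
have C0 : 0 <= C by have := gS x 0%N; rewrite bsumT0 normr0 mulr0 add0r.
apply: le_trans (ler_norm_sum _ _ _) _.
rewrite [leRHS](_ : _ = \sum_(j < J) (e * J%:R + C) * (Pm / L)); last by rewrite sumr_const card_ord -[RHS]mulr_natl mulrA.
apply: ler_sum => j _; rewrite normrM ler_pM//.
  by apply: le_trans (gS x j.+1) _; rewrite lerD2r ler_wpM2l// ler_nat.
apply: le_trans (tent_lip L0 _ _) _; rewrite ler_pM2r ?invr_gt0//.
rewrite (_ : t - S Psi j.+1 x - (t - S Psi j x) = - Psi (iter j T x)); last by rewrite bsumTr; ring.
by rewrite normrN ger0_norm// (le_trans _ (Psic0 _))// ltW.
Qed.

(** A Riemann sum for the integral [L] of the tent: consecutive nodes [t - S_j] are a value of [Psi]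
    apart, and the tent varies by [O(1 / L)] between them. *)
Lemma window_mass x : `|\sum_(j < J) Psi (iter j T x) * w x j - L| <= J%:R * (2 * Pm ^+ 2 / L).
Proof.
(* The primitive of the tent, equal to zero on its left and to [L] on its right. *)
pose Th y : R := L * bump_prim L y.
have ThE (u v : R) : `|Th u - Th v - (u - v) * tent L v| <= 2 * (u - v) ^+ 2 / L.
  have -> : tent L v = L * bump L v by rewrite bump_tent// mulrCA mulfV ?gt_eqF// mulr1.
  rewrite /Th /bump_prim /bump.
  have := pq_quad (u + L) (v + L); have := pq_quad u v; have := pq_quad (u - L) (v - L).
  rewrite (_ : u - L - (v - L) = u - v); last by ring.
  rewrite (_ : u + L - (v + L) = u - v); last by ring.
  move: (pq (u + L)) (pq (v + L)) (pq (u - L)) (pq (v - L)) (pq u) (pq v) => u1 v1 u2 v2 u3 v3.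
  move: (pp (v + L)) (pp (v - L)) (pp v) => w1 w2 w3 h2 h3 h1.
  rewrite (_ : _ - _ - _ = ((u1 - v1 - (u - v) * w1) - 2 * (u3 - v3 - (u - v) * w3) + (u2 - v2 - (u - v) * w2)) / L); last by field; rewrite gt_eqF.
  rewrite normrM normfV (ger0_norm (ltW L0)) ler_pM2r ?invr_gt0//.
  move: h1 h2 h3; move: (u1 - _ - _) (u2 - _ - _) (u3 - _ - _) => d1 d2 d3; rewrite !ler_norml.
  lra.
have Th1 : Th (t - S Psi 0 x) = L.
  rewrite /Th /bump_prim bsumT0 subr0 /pq !ppE; [|move: tL L0; lra..]; field; rewrite gt_eqF//.
have Th0 : Th (t - S Psi J x) = 0.
  have := bsumT_ge J x => SJ; rewrite /Th /bump_prim /pq !pp0; [ring|move: JL L0; lra..].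
have tel : L = \sum_(j < J) (Th (t - S Psi j x) - Th (t - S Psi j.+1 x)).
  rewrite -(big_mkord xpredT (fun j => Th (t - S Psi j x) - Th (t - S Psi j.+1 x))).
  rewrite (eq_bigr (fun j => - (Th (t - S Psi j.+1 x) - Th (t - S Psi j x)))); last by move=> j _; rewrite opprB.
  by rewrite sumrN telescope_sumr// Th1 Th0 sub0r opprK.
rewrite [X in _ - X]tel -sumrB; apply: le_trans (ler_norm_sum _ _ _) _.
rewrite [leRHS](_ : _ = \sum_(j < J) (2 * Pm ^+ 2 / L)); last by rewrite sumr_const card_ord mulr_natl.
apply: ler_sum => j _; have := ThE (t - S Psi j.+1 x) (t - S Psi j x).
have -> : t - S Psi j.+1 x - (t - S Psi j x) = - Psi (iter j T x) by rewrite bsumTr; ring.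
rewrite -/(w x j) (_ : _ - _ - - _ * _ = Psi (iter j T x) * w x j - (Th (t - S Psi j x) - Th (t - S Psi j.+1 x))); last by ring.
move=> /le_trans; apply; rewrite ler_pM2r ?invr_gt0// ler_pM2l// sqrrN ler_sqr ?nnegrE//; last exact: ltW Pm0.
by rewrite (le_trans _ (Psic0 _))// ltW.
Qed.

End window.

(** Subtracting [hb / m0] times [Psi] from [h] leaves average zero, to which [window_oscillation]
    applies; the part subtracted is evaluated by [window_mass]. *)
Lemma main_term h hb e : unif_avg A b h hb -> 0 < e -> exists2 L, 0 < L & forall t N x, L <= t -> t + L <= c0 * N%:R ->
  `|\sum_(k < N) h (iter k T x) * bump L (t - S Psi k x) - hb / m0| <= e.
Proof.
move=> hav e0.
pose r := hb / m0.
have gav : unif_avg A b (fun x => h x + (- r) * Psi x) 0.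
  by have := unif_avgD hav (unif_avgZ (- r) Psi_avg); rewrite /r mulNr divfK ?gt_eqF// subrr.
pose q := (2 + Pm) / c0 + 1.
have q0 : 0 < q by rewrite ltr_wpDl// divr_ge0 ?addr_ge0// ltW//; exact: Pm0.
have P0 := Pm0.
(* With at most [q * L] indices this contributes [e / 3 * L] before division by [L]; the choice of
   [L] handles the terms that do not grow with it. *)
pose e1 := e / (3 * (q ^+ 2 * Pm)).
have e10 : 0 < e1 by rewrite divr_gt0// !mulr_gt0.
have [C HC] := gav _ e10.
have gS x l : `|S (fun x => h x + - r * Psi x) l x| <= e1 * l%:R + C by have := HC x l; rewrite mulr0 subr0.
have C0 : 0 <= C by have := gS 0 0%N; rewrite bsumT0 normr0 mulr0 add0r.
pose L := 1 + 3 * (q * Pm * C + `|r| * q * (2 * Pm ^+ 2)) / e.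
have L1 : 1 <= L by rewrite lerDl divr_ge0 ?mulr_ge0 ?addr_ge0 ?mulr_ge0// ltW.
have L0 : 0 < L by apply: lt_le_trans L1.
have Le : q * Pm * C + `|r| * q * (2 * Pm ^+ 2) <= e / 3 * L.
  rewrite /L; move: (q * Pm * C + _) => Y.
  rewrite [leRHS](_ : _ = e / 3 + Y); last by field; rewrite gt_eqF.
  by rewrite lerDr divr_ge0// ltW.
exists L => // t N x tL NL.
have core t' x' J : L <= t' -> t' <= L + Pm -> t' + L <= c0 * J%:R -> J%:R <= q * L ->
    `|\sum_(j < J) h (iter j T x') * bump L (t' - S Psi j x') - r| <= e.
  move=> t'L t'P JL JqL.
  have := window_oscillation L0 JL x' gS (ltW e10); have := window_mass L0 t'L JL x'.
  rewrite [X in X - r](_ : _ = L^-1 * (\sum_(j < J) (h (iter j T x') + - r * Psi (iter j T x')) * tent L (t' - S Psi j x')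
     + r * \sum_(j < J) Psi (iter j T x') * tent L (t' - S Psi j x'))); last first.
    rewrite mulr_sumr -big_split/= mulr_sumr; apply: eq_bigr => j _; rewrite bump_tent//; ring.
  move: (\sum_(_ < J) _) (\sum_(_ < J) _) => s1 s2 h2 h1.
  rewrite (_ : _ - r = L^-1 * (s1 + r * (s2 - L))); last by field; rewrite gt_eqF.
  rewrite normrM normfV (ger0_norm (ltW L0)) ler_pdivrMl// mulrC.
  apply: le_trans (ler_normD _ _) _; rewrite normrM.
  have b1 : `|s1| <= q * L * (e1 * (q * L) + C) * (Pm / L).
    have PL : 0 <= Pm / L by rewrite divr_ge0// ltW.
    apply: le_trans h1 _; apply: ler_wpM2r => //; apply: ler_pM => //.
      by rewrite addr_ge0// mulr_ge0// ltW.
    by rewrite lerD2r ler_wpM2l// ltW.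
  have b2 : `|r| * `|s2 - L| <= `|r| * (q * L * (2 * Pm ^+ 2 / L)).
    apply: ler_wpM2l => //; apply: le_trans h2 _; apply: ler_wpM2r => //.
    by rewrite divr_ge0// ?ltW// mulr_gt0// exprn_gt0.
  have d1 : q * L * (e1 * (q * L) + C) * (Pm / L) = e / 3 * L + q * Pm * C.
    by rewrite /e1; field; rewrite !gt_eqF.
  have d2 : `|r| * (q * L * (2 * Pm ^+ 2 / L)) = `|r| * q * (2 * Pm ^+ 2) by field; rewrite gt_eqF.
  have : 0 < e * L by exact: mulr_gt0.
  move: b1 b2 Le; rewrite d1 d2 [_ * `|r|]mulrC; lra.
(* Restarting the orbit where the window begins leaves [O(L)] relevant indices instead of [O(t)];
   the error bounds grow with their number. *)
have [k0 [Sk0 Sk1]] : exists k0, S Psi k0 x <= t - L /\ t - L < S Psi k0.+1 x.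
  have ex : exists k, t - L < S Psi k.+1 x.
    exists N; apply: lt_le_trans (bsumT_ge _ _); rewrite -natr1 mulrDr mulr1; move: NL L0 c0p; lra.
  exists (ex_minn ex); case: ex_minnP => [[|k] Hk kmin]; split=> //; first by rewrite bsumT0 subr_ge0.
  by rewrite leNgt; apply/negP => /kmin; rewrite ltnn.
have k0N : (k0 <= N)%N.
  rewrite leqNgt; apply/negP => /ltnW /(bsumT_homo x); have := bsumT_ge N x; move: NL L0 Sk0; lra.
pose x' := iter k0 T x; pose t' := t - S Psi k0 x.
have t'L : L <= t' by rewrite /t'; move: Sk0; lra.
have t'P : t' <= L + Pm by rewrite /t'; move: Sk1; rewrite bsumTr; have := PsiPm (iter k0 T x); lra.
pose J := (Num.truncn ((2 * L + Pm) / c0)).+1.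
have JL : t' + L <= c0 * J%:R.
  have := truncnS_gt ((2 * L + Pm) / c0); rewrite ltr_pdivrMr// -/J; move: t'P; lra.
have JqL : J%:R <= q * L.
  have h0 : 0 <= (2 * L + Pm) / c0 by rewrite divr_ge0 ?addr_ge0 ?mulr_ge0// ltW.
  have /andP[h1 _] := truncn_itv h0.
  rewrite /J; move: h1; move: (Num.truncn _) => j h1.
  rewrite -natr1 /q [leRHS]mulrDl mul1r lerD//; apply: le_trans h1 _.
  by rewrite [leRHS]mulrAC ler_pM2r ?invr_gt0//; nra.
rewrite -/r; apply: le_trans (core t' x' J t'L t'P JL JqL).
rewrite le_eqVlt; apply/orP; left; apply/eqP; congr (`|_ - r|).
rewrite -(subnKC k0N) big_split_ord/= big1 ?add0r => [|k _]; last first.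
  rewrite bump_tent// tent_out ?mul0r ?mulr0// (le_trans _ (ler_norm _))//.
  have := bsumT_homo x (ltnW (ltn_ord k)); move: Sk0; lra.
have eqk j : h (iter (k0 + j) T x) * bump L (t - S Psi (k0 + j) x) = h (iter j T x') * bump L (t' - S Psi j x').
  by rewrite addnC iterD addnC bsumT_add opprD addrA.
under eq_bigr do rewrite eqk.
apply: (sum_ord_tail (f := fun j => h (iter j T x') * bump L (t' - S Psi j x'))) => j Jj.
  rewrite bump_tent// tent_out ?mul0r ?mulr0// distrC (le_trans _ (ler_norm _))//.
  have := bsumT_ge j x'; have : c0 * J%:R <= c0 * j%:R by rewrite ler_pM2l// ler_nat.
  by move: JL; lra.
rewrite -eqk bump_tent// tent_out ?mul0r ?mulr0// distrC (le_trans _ (ler_norm _))//.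
have := bsumT_ge (k0 + j) x; have : c0 * N%:R <= c0 * (k0 + j)%:R by rewrite ler_pM2l// ler_nat -leq_subLR.
by move: NL; lra.
Qed.

End main_term.

(** * Correlations of rectangles *)

Section dynkin_convergence.
Context d (T : measurableType d) (R : realType) (P : probability T R).
Variables (phi : R -> set T -> R) (psi : set T -> R) (C : R).
Hypothesis phiU : forall t A B, measurable A -> measurable B -> A `&` B = set0 -> phi t (A `|` B) = phi t A + phi t B.
Hypothesis psiU : forall A B, measurable A -> measurable B -> A `&` B = set0 -> psi (A `|` B) = psi A + psi B.
Hypothesis phi_le : forall t A, measurable A -> 0 <= phi t A <= C * fine (P A).
Hypothesis psi_le : forall A, measurable A -> 0 <= psi A <= C * fine (P A).

Definition eventually_close (A : set T) := forall e, 0 < e -> exists t0, forall t, t0 <= t -> `|phi t A - psi A| <= e.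

Lemma eventually_closeU A B : measurable A -> measurable B -> A `&` B = set0 ->
  eventually_close A -> eventually_close B -> eventually_close (A `|` B).
Proof.
move=> mA mB AB cA cB e e0; have e20 : 0 < e / 2 by rewrite divr_gt0.
have [t1 H1] := cA _ e20; have [t2 H2] := cB _ e20.
exists (Num.max t1 t2) => t; rewrite ge_max => /andP[/H1 h1 /H2 h2].
rewrite phiU// psiU// opprD addrACA (le_trans (ler_normD _ _))//; lra.
Qed.

Lemma eventually_closeC A : measurable A -> eventually_close setT -> eventually_close A -> eventually_close (~` A).
Proof.
move=> mA cT cA e e0; have e20 : 0 < e / 2 by rewrite divr_gt0.
have [t1 H1] := cA _ e20; have [t2 H2] := cT _ e20.
have mC : measurable (~` A) by exact: measurableC.
exists (Num.max t1 t2) => t; rewrite ge_max => /andP[/H1 h1 /H2].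
have := phiU t mA mC (setICr A); rewrite setUv => ->.
have := psiU mA mC (setICr A); rewrite setUv => -> h2.
move: h1 h2; move: (phi t A) (psi A) (phi t (~` A)) (psi (~` A)) => u1 u2 u3 u4.
rewrite !ler_norml; lra.
Qed.

(** The bound by a multiple of [P] is uniform in [t], so the tail of the union is negligible at all
    times simultaneously. *)
Lemma eventually_close_bigcup (F : (set T)^nat) : (forall n, measurable (F n)) -> trivIset setT F ->
  (forall n, eventually_close (F n)) -> eventually_close (\bigcup_n F n).
Proof.
move=> mF tF cF e e0.
pose A m := \bigcup_(k in [set k | (k < m)%N]) F k.
pose B m := \bigcup_(k in [set k | (m <= k)%N]) F k.
have mA m : measurable (A m) by apply: bigcup_measurable.
have mB m : measurable (B m) by apply: bigcup_measurable.
have AB m : A m `&` B m = set0.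
  apply/seteqP; split=> // x [[i /= im Fi] [j /= mj Fj]].
  have ij : i = j by apply: (tF i j) => //; exists x.
  by move: im; rewrite ij ltnNge mj.
have AUB m : \bigcup_n F n = A m `|` B m.
  apply/seteqP; split=> [x [k _ Fk]|x [[k _ Fk]|[k _ Fk]]]; [|by exists k..].
  by have [mk|km] := leqP m k; [right|left]; exists k.
have cA m : eventually_close (A m).
  elim: m => [|m IH].
    rewrite (_ : A 0%N = set0); last by apply/seteqP; split=> // x [].
    move=> e' e'0; exists 0 => t _.
    have := phi_le t measurable0; have := psi_le measurable0; rewrite measure0 mulr0.
    move: (phi t set0) (psi set0) => u v; rewrite ler_norml; lra.
  rewrite (_ : A m.+1 = A m `|` F m).
    apply: eventually_closeU => //; apply/seteqP; split=> // x [[i /= im Fi] Fm].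
    by have ij : i = m by [apply: (tF i m) => //; exists x]; move: im; rewrite ij ltnn.
  apply/seteqP; split=> [x [k /=]|x [[k /= km Fk]|Fm]].
  - by rewrite ltnS leq_eqVlt => /orP[/eqP-> Fm|km Fk]; [right|left; exists k].
  - by exists k => //=; exact: ltnW.
  - by exists m => /=.
have cvB : (P \o B) m @[m --> \oo] --> P (\bigcap_m B m).
  apply: nonincreasing_cvg_mu => //; last first.
  - by move=> i j ij; apply/subsetPset => x [k /= jk Fk]; exists k => //=; exact: leq_trans jk.
  - exact: bigcapT_measurable.
  by rewrite (le_lt_trans (probability_le1 _ _))// ltry.
have B0 : \bigcap_m B m = set0.
  apply/seteqP; split=> // x H; have [i _ Fi] := H 0%N I; have [j /= ij Fj] := H i.+1 I.
  have e' : i = j by apply: (tF i j) => //; exists x.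
  by move: ij; rewrite e' ltnn.
rewrite B0 measure0 in cvB.
have C1 : 0 < 4 * (`|C| + 1) by rewrite mulr_gt0// ltr_pwDr.
have [m Hm] : exists m, fine (P (B m)) <= e / (4 * (`|C| + 1)).
  apply: contrapT => h; have : ((e / (4 * (`|C| + 1)))%:E <= 0 :> \bar R)%E.
    rewrite -(cvg_lim _ cvB)//; apply: lime_ge; first by apply/cvg_ex; eexists; exact: cvB.
    apply: nearW => m; rewrite /= -[P (B m)]fineK ?fin_num_measure// lee_fin.
    by rewrite leNgt; apply/negP => ?; apply: h; exists m; exact: ltW.
  by rewrite lee_fin leNgt divr_gt0.
have CB : C * fine (P (B m)) <= e / 4.
  have PB0 : 0 <= fine (P (B m)) by exact: fine_ge0.
  rewrite ler_pdivlMr// in Hm; have := ler_norm C; nra.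
have e20 : 0 < e / 2 by rewrite divr_gt0.
have [t0 H0] := cA m _ e20; exists t0 => t /H0 h.
rewrite (AUB m) phiU// psiU//.
have := phi_le t (mB m); have := psi_le (mB m); move: h CB.
move: (phi t (A m)) (psi (A m)) (phi t (B m)) (psi (B m)) (C * _) => u1 u2 u3 u4 u5.
rewrite !ler_norml; lra.
Qed.

Lemma dynkin_close (G : set_system T) : @measurable d T = <<s G >> -> setI_closed G ->
  eventually_close setT -> (forall A, G A -> eventually_close A) -> forall A, measurable A -> eventually_close A.
Proof.
move=> gen GI cT cG A; rewrite gen; move: A; apply: (@dynkin_induction _ _ G eventually_close gen GI) => //.
- by move=> S mS; exact: eventually_closeC.
- exact: eventually_close_bigcup.
Qed.

End dynkin_convergence.

(** * The inverse map and the flow summed over floors *)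

Section inverse_map.
Variables (R : realType) (n : nat) (A : 'M[int]_n) (b : 'rV[R]_n).
Hypothesis Au : upper_unipotent A.

Lemma upper_unipotent_unit : A \in unitmx.
Proof.
rewrite unitmxE -det_tr det_trig; last first.
  by apply/is_trig_mxP => i j ij; rewrite mxE Au.1.
by rewrite big1 ?unitr1// => i _; rewrite mxE Au.2.
Qed.

Notation AR := (map_mx (fun z : int => z%:~R : R)).

Lemma Tlift_invK k x : iter k (Tlift (invmx A) (- (b *m AR (invmx A)))) (iter k (Tlift A b) x) = x.
Proof.
have H y : Tlift (invmx A) (- (b *m AR (invmx A))) (Tlift A b y) = y.
  rewrite /Tlift mulmxDl addrK -mulmxA -(map_mxM (intmul (1 : R))) mulmxV ?upper_unipotent_unit//.
  by rewrite map_mx1 mulmx1.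
by elim: k x => // k IH x; rewrite iterSr iterS H IH.
Qed.

Lemma Tlift_invKV x : Tlift A b (Tlift (invmx A) (- (b *m AR (invmx A))) x) = x.
Proof.
rewrite /Tlift mulmxDl mulNmx -!mulmxA -(map_mxM (intmul (1 : R))) mulVmx ?upper_unipotent_unit//.
by rewrite map_mx1 !mulmx1 subrK.
Qed.

End inverse_map.

Section pull.
Variables (R : realType) (n : nat) (A : 'M[int]_n) (b : 'rV[R]_n).
Hypothesis Au : upper_unipotent A.
Notation X := (n.-tuple R).
Notation V := 'rV[R]_n.
Notation T := (Tlift A b).
Notation Tc := (Tcube A b).
Notation E := (Ex (Lam R n)).
Notation S := (bsumT A b).
Variables (Psi : V -> R) (c0 M : R).
Hypothesis tP : trig_poly Psi.
Hypothesis c0p : 0 < c0.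
Hypothesis Psic0 : forall x, c0 <= Psi x.
Hypothesis M0 : 0 < M.
Notation UM := (uniform_prob M0).
Notation Pr := (Lam R n \x UM)%E.

(* On functions supported in [X * [0, M[], this is composition with the time-[t] map of the flow, extended to
   [X * R] by summing over all the floors. *)
Definition pull N t (u : X * R -> R) (p : X * R) : R :=
  \sum_(k < N) u (iter k Tc p.1, p.2 + t - S Psi k (rv p.1)).

Definition strip : set (X * R) := [set p | 0 <= p.2 < M].

Lemma measurable_strip : measurable strip.
Proof.
rewrite (_ : strip = snd @^-1` `[0, M[); last by apply/seteqP; split=> p; rewrite /strip/= in_itv.
by rewrite -[X in measurable X]setTI; exact: measurable_snd.
Qed.

Lemma measurable_floor k t : measurable_fun [set: X * R]
  (fun p : X * R => (iter k Tc p.1, p.2 + t - S Psi k (rv p.1))).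
Proof.
apply: measurable_fun_pair; first by apply: measurableT_comp => //; exact: measurable_iter_Tcube.
apply: measurable_funB; first exact: measurable_funD.
apply: (@measurableT_comp _ _ _ _ _ _ (S Psi k \o @rv R n)) => //.
exact: bm_measurable (bm_tp (tp_bsumT A b k tP)).
Qed.

Lemma bm_pull N t u : bm u -> bm (pull N t u).
Proof. by move=> bu; apply: bm_sum => k; apply: (bm_comp (measurable_floor k t) bu). Qed.

Definition cnt : R := 2 * M / c0 + 1.

Lemma cnt_ge0 : 0 <= cnt.
Proof. by rewrite addr_ge0// divr_ge0 ?mulr_ge0// ltW. Qed.

Lemma pull_le N t u B p : 0 <= B -> (forall p, `|u p| <= B * \1_strip p) -> `|pull N t u p| <= B * cnt.
Proof.
move=> B0 uB; apply: le_trans (ler_norm_sum _ _ _) _.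
apply: (@le_trans _ _ (\sum_(k < N) B * small M (p.2 + t - S Psi k (rv p.1)))); last first.
  rewrite -mulr_sumr ler_wpM2l//; apply: (count_small c0p (ltW M0) (s := fun k => S Psi k (rv p.1))) => k.
  by rewrite bsumTr addrAC subrr add0r.
apply: ler_sum => k _; apply: le_trans (uB _) _; rewrite ler_wpM2l// indicE /small.
have [|] := boolP (_ \in _); last by rewrite ler0n.
by rewrite inE /strip/= => /andP[h1 h2]; rewrite ger0_norm// (ltW h2).
Qed.

(** A translation of the height; the factor [small M (r - tau)] is what is retained of the condition
    that the former height lies in [[0, M]]. *)
Lemma Ex_uniform_shift_le (f : R -> R) tau : bm f -> (forall y, 0 <= f y) -> (forall y, ~ (0 <= y < M) -> f y = 0) ->
  Ex UM (fun r => f (r + tau)) <= Ex UM (fun r => f r * small M (r - tau)).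
Proof.
move=> bf f0 fs.
have ms : measurable_fun [set: R] (fun r : R => r + tau) by exact: measurable_funD.
have b1 : bm (fun r : R => f (r + tau)) by apply: (bm_comp ms bf).
have b2 : bm (fun r : R => f r * small M (r - tau)).
  by apply: bmM => //; apply: bm_small; exact: measurable_funB.
rewrite -lee_fin !ExE//.
rewrite !integral_uniform//; last 4 first.
- by apply/measurable_EFinP; exact: bm_measurable b2.
- by move=> r; rewrite lee_fin mulr_ge0 ?small_ge0.
- by apply/measurable_EFinP; exact: bm_measurable b1.
- by move=> r; rewrite lee_fin.
apply: lee_wpmul2l; first by rewrite lee_fin invr_ge0 subr0 ltW.
pose g r := ((\1_(`[0%R, M] : set R) r * f (r + tau))%:E : \bar R).
have mg : measurable_fun [set: R] g.
  apply/measurable_EFinP; apply: measurable_funM; first exact: measurable_indic.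
  exact: bm_measurable b1.
have g0 r : (0 <= g r)%E by rewrite lee_fin mulr_ge0// indicE.
have -> : (\int[lebesgue_measure]_(r in `[0%R, M]) (f (r + tau))%:E = \int[lebesgue_measure]_r g r)%E.
  rewrite [LHS]integral_mkcond; apply: eq_integral => r _; rewrite /g patchE indicE.
  by case: ifP => _; rewrite ?mul1r ?mul0r.
have := @ge0_integral_shift R (- tau) setT g measurableT mg (fun r _ => g0 r); rewrite preimage_setT => <-.
rewrite [leRHS]integral_mkcond; apply: ge0_le_integral => //.
- apply: (measurableT_comp mg); exact: measurable_funD.
- apply: (measurable_restrictT _ (measurable_itv _)).1.
  by apply: measurable_funTS; apply/measurable_EFinP; exact: bm_measurable b2.
move=> r _; rewrite /g patchE subrK.
have [rM|rM] := pselect (0 <= r < M); last first.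
  by rewrite fs// mulr0; case: ifP => // _; rewrite mul0r.
have /andP[r0 r1] := rM.
rewrite ifT; last by rewrite inE/= in_itv/= r0 ltW.
rewrite lee_fin mulrC ler_wpM2l// indicE /small.
have [|] := boolP (r - tau \in _); last by rewrite ler0n.
by rewrite inE/= in_itv/= => /andP[h1 h2]; rewrite ger0_norm// h2.
Qed.

Lemma Ex_prod (u : X * R -> R) : bm u -> Ex Pr u = E (fun t => Ex UM (fun r => u (t, r))).
Proof.
move=> bu; apply: EFin_inj; rewrite !ExE//; last exact: (@bm_Ex _ _ _ _ _ (Lam R n) UM u bu).
under [RHS]eq_integral => x _ do rewrite (ExE UM (bm_pair bu x)).
by rewrite -(integral12_prod_meas1 (prod_integrable (Lam R n) UM bu)).
Qed.

Lemma Ex_prod' (u : X * R -> R) : bm u -> Ex Pr u = Ex UM (fun r => E (fun t => u (t, r))).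
Proof. by move=> bu; rewrite Ex_prod// (@Ex_Fubini _ _ _ _ _ (Lam R n) UM u bu). Qed.

(** On floor [k] the change of variable by the [k]-th iterate turns [S_k] into the backward sum
    [S' k]. Backward sums grow by at least [c0] with [k], so at most [cnt] floors contribute at a
    given point. *)
Lemma Ex_pull_le N t u : bm u -> (forall p, 0 <= u p) -> (forall p, ~ strip p -> u p = 0) ->
  Ex Pr (pull N t u) <= cnt * Ex Pr u.
Proof.
move=> bu u0 us.
have bk k : bm (fun p : X * R => u (iter k Tc p.1, p.2 + t - S Psi k (rv p.1))) by apply: (bm_comp (measurable_floor k t) bu).
pose A' := invmx A; pose b' := - (b *m map_mx (fun z : int => z%:~R : R) A').
pose T' := Tlift A' b'.
pose S' k x := S Psi k (iter k T' x).
have tS' k : trig_poly (S' k) by apply: tp_iter; exact: tp_bsumT.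
pose v k (p : X * R) := u p * small M (p.2 - (t - S' k (rv p.1))).
pose vk k (p : X * R) := u (iter k Tc p.1, p.2) * small M (p.2 - (t - S Psi k (rv p.1))).
have mrv (f : V -> R) : trig_poly f -> measurable_fun [set: X * R] (fun p : X * R => f (rv p.1)).
  by move=> tf; apply: (@measurableT_comp _ _ _ _ _ _ (f \o @rv R n)) => //; exact: bm_measurable (bm_tp tf).
have bv k : bm (v k).
  apply: bmM => //; apply: bm_small; apply: measurable_funB => //.
  by apply: measurable_funB => //; exact: mrv.
have bvk k : bm (vk k).
  apply: bmM.
    apply: (bm_comp (h := fun p : X * R => (iter k Tc p.1, p.2)) _ bu).
    apply: measurable_fun_pair => //; apply: measurableT_comp => //; exact: measurable_iter_Tcube.
  apply: bm_small; apply: measurable_funB => //; apply: measurable_funB => //.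
  by apply: mrv; exact: tp_bsumT.
have step k : Ex Pr (fun p : X * R => u (iter k Tc p.1, p.2 + t - S Psi k (rv p.1))) <= Ex Pr (v k).
  apply: (@le_trans _ _ (Ex Pr (vk k))).
    rewrite !Ex_prod//; apply: Ex_le; [exact: (@bm_Ex _ _ _ _ _ (Lam R n) UM _ (bk k))|exact: (@bm_Ex _ _ _ _ _ (Lam R n) UM _ (bvk k))|move=> x].
    have -> : (fun r : R => u (iter k Tc (x, r).1, (x, r).2 + t - S Psi k (rv (x, r).1))) =
        (fun r : R => (fun r : R => u (iter k Tc x, r)) (r + (t - S Psi k (rv x)))).
      by apply/funext => r /=; rewrite addrA.
    apply: (Ex_uniform_shift_le (f := fun r : R => u (iter k Tc x, r))) => //.
      exact: (bm_pair bu).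
    by move=> y hy; apply: us.
  rewrite le_eqVlt; apply/orP; left; apply/eqP.
  rewrite (Ex_prod' (bvk k)) (Ex_prod' (bv k)).
  congr (Ex _ _); apply/funext => r.
  rewrite -(Ex_iter_Tcube b Au k (bm_pair' (bv k) r)); congr (Ex _ _); apply/funext => x /=.
  rewrite /vk /v /=; congr (_ * small _ (_ - (_ - _))).
  by rewrite (periodic_Tcube A b k x (tp_periodic (tS' k))) /S' Tlift_invK.
rewrite /pull (Ex_sum Pr); last exact: bk.
apply: (@le_trans _ _ (\sum_(k < N) Ex Pr (v k))); first by apply: ler_sum => k _; exact: step.
rewrite -(Ex_sum Pr); last exact: bv.
rewrite -(ExZ Pr)//; apply: Ex_le; [by apply: bm_sum => k; exact: bv|exact: bmZ|move=> p].
rewrite /v -mulr_sumr mulrC ler_wpM2r//.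
have -> : \sum_(k < N) small M (p.2 - (t - S' k (rv p.1))) = \sum_(k < N) small M ((t - p.2) - S' k (rv p.1)).
  apply: eq_bigr => k _; rewrite /small -normrN.
  by rewrite (_ : - (p.2 - (t - S' k (rv p.1))) = t - p.2 - S' k (rv p.1))//; ring.
apply: (count_small c0p (ltW M0) (s := fun k => S' k (rv p.1))) => k.
rewrite [S' k.+1 _](_ : _ = Psi (iter k.+1 T' (rv p.1)) + S' k (rv p.1)); first by rewrite addrK.
by rewrite /S' [LHS]bsumTS; congr (_ + S Psi k _); rewrite iterS; exact: Tlift_invKV.
Qed.

End pull.

Section kernels.
Variable R : realType.

Lemma cb_compact_support (f : R -> R) M : continuous f -> (forall y, M < `|y| -> f y = 0) -> cb f.
Proof.
move=> cf fM; split=> //; have [be be0 H] := compact_support_bound cf fM; exists be => y.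
by apply: le_trans (H y) _; rewrite ler_piMr// small_le1.
Qed.

Lemma mul_div_le4 (x e : R) : 0 <= x -> 0 <= e -> x * (e / (4 * (x + 1))) <= e / 4.
Proof.
move=> x0 e0; have d0 : 0 < x + 1 by rewrite ltr_wpDl.
rewrite (_ : x * _ = e / 4 * (x / (x + 1))); last by field; rewrite gt_eqF.
by rewrite ler_piMr ?divr_ge0// ler_pdivrMr// mul1r lerDl.
Qed.

Lemma if_lt_pp (x y : R) : (if (x < y)%R then y%:E + (- x)%R%:E else 0)%E = (pp (y - x))%:E.
Proof.
have [lt|ge] := ltP x y; first by rewrite -EFinD ppE// subr_ge0 ltW.
by rewrite pp0// subr_le0.
Qed.

(** The right side is the length of the intersection of [[be, M[] with [[al - tau, M - tau[]. *)
Lemma overlap_length (M al be tau : R) : al <= M -> be <= M ->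
  overlap (M - al) (M - be) (tau - (al - M)) = pp (Num.min M (M - tau) - Num.max be (al - tau)).
Proof.
move=> alM beM.
have -> : Num.min M (M - tau) - Num.max be (al - tau) =
    Num.min (Num.min (M - be) (M - al + tau)) (Num.min (M - be - tau) (M - al)).
  by rewrite oppr_max addr_minl !addr_minr; congr (Num.min _ _); congr (Num.min _ _); ring.
have -> : tau - (al - M) = M - al + tau by ring.
have -> : M - be - tau = (M - al) + (M - be) - (M - al + tau) by ring.
have : 0 <= M - al by rewrite subr_ge0.
have : 0 <= M - be by rewrite subr_ge0.
move: (M - al) (M - be) (_ + tau) => {alM beM} p q y q0 p0; rewrite /overlap.
set m := Num.min (Num.min q y) _.
have mE v : v <= q -> v <= y -> v <= p + q - y -> v <= p -> [\/ v = q, v = y, v = p + q - y | v = p] -> m = v.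
  move=> v1 v2 v3 v4 hv; apply/eqP; rewrite eq_le !le_min v1 v2 v3 v4 !andbT !ge_min.
  by case: hv => ->; rewrite lexx ?orbT.
have [y0|y0] := leP y 0.
  by rewrite [RHS]pp0 /m ?ge_min ?y0 ?orbT// !pp0; [ring|lra..].
have [ypq|ypq] := leP (p + q) y.
  by rewrite [RHS]pp0 /m ?ge_min ?subr_le0 ?ypq ?orbT// !ppE; [ring|lra..].
rewrite (ppE (ltW y0)) [pp (y - p - q)]pp0; last lra.
have [yp|yp] := leP y p; have [yq|yq] := leP y q.
- rewrite (mE y); [|lra..|by constructor 2].
  by rewrite [pp (y - p)]pp0 ?[pp (y - q)]pp0 ?ppE; [ring|lra..].
- rewrite (mE q); [|lra..|by constructor 1].
  by rewrite [pp (y - p)]pp0 ?[pp (y - q)]ppE ?ppE; [ring|lra..].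
- rewrite (mE p); [|lra..|by constructor 4].
  by rewrite [pp (y - p)]ppE ?[pp (y - q)]pp0 ?ppE; [ring|lra..].
- rewrite (mE (p + q - y)); [|lra..|by constructor 3].
  by rewrite [pp (y - p)]ppE ?[pp (y - q)]ppE ?ppE; [ring|lra..].
Qed.

Lemma overlap0 (p q y : R) : 0 <= p -> 0 <= q -> y <= 0 -> overlap p q y = 0.
Proof. by move=> p0 q0 y0; rewrite /overlap !pp0; [ring|lra..]. Qed.

Lemma cb_overlap (p q : R) : 0 <= p -> 0 <= q -> cb (overlap p q).
Proof.
move=> p0 q0; apply: (cb_compact_support (M := p + q) (@continuous_overlap R p q)) => y.
have [y0|y0] := leP 0 y; last by move=> _; rewrite overlap0// ltW.
by rewrite ger0_norm// => yM; rewrite /overlap !ppE; [ring|lra..].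
Qed.

Lemma cb_bump (L : R) : 0 < L -> cb (bump L).
Proof.
move=> L0; apply: (cb_compact_support (M := L) (@continuous_bump R L)) => y yL.
by rewrite bump_tent// tent_out ?mul0r// ltW.
Qed.

Lemma cb_shift (f : R -> R) c : cb f -> cb (fun y => f (y + c)).
Proof.
by move=> cf; apply: cb_comp => // x; apply: cvgD; [exact: cvg_id|exact: cvg_cst].
Qed.

End kernels.

Section rectangles.
Variables (R : realType) (n : nat) (A : 'M[int]_n.+1) (b : 'rV[R]_n.+1).
Hypothesis Au : upper_unipotent A.
Hypothesis irr : irrational_invariants A b.
Hypothesis nil : nu_nilpotent A.
Notation X := (n.+1.-tuple R).
Notation V := 'rV[R]_n.+1.
Notation T := (Tlift A b).
Notation Tc := (Tcube A b).
Notation E := (Ex (Lam R n.+1)).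
Notation S := (bsumT A b).
Variables (D : nat) (Psi Psi0 : V -> R) (a c : nat -> V -> R) (m0 C0 c0 M : R).
Hypothesis tP : trig_poly Psi.
Hypothesis ta : forall q, trig_poly (a q).
Hypothesis tc : forall q, trig_poly (c q).
Hypothesis PsiE : forall x s, Psi (vert x s) = trigp D (Psi0 x) (a ^~ x) (c ^~ x) s.
Hypothesis dev : forall l x, `|S Psi0 l x - l%:R * m0| <= C0.
Hypothesis c0p : 0 < c0.
Hypothesis Psic0 : forall x, c0 <= Psi x.
Hypothesis PsiM : forall x, Psi x <= M.
Hypothesis m0p : 0 < m0.
Hypothesis Psi_avg : unif_avg A b Psi m0.
Hypothesis gH : forall C d, 0 < d -> exists m1, forall m, (m1 <= m)%N ->
  E (fun t => small C (Hn A b D a c m (rv t))) < d.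

Lemma M0 : 0 < M.
Proof. by apply: lt_le_trans (PsiM 0); apply: lt_le_trans (Psic0 0). Qed.

Notation UM := (uniform_prob M0).
Notation Pr := (Lam R n.+1 \x UM)%E.
Notation pull := (pull A b Psi).
Notation cnt := (cnt c0 M).
Notation strip' := (@strip R n.+1 M).

(** From this index on, [S_k >= c0 * k] exceeds every height reached at time [t], so further floors
    contribute nothing. *)
Definition floors t : nat := (Num.truncn ((t + 2 * M) / c0)).+1.

Lemma floors_gt t : t + 2 * M < c0 * (floors t)%:R.
Proof. by have := truncnS_gt ((t + 2 * M) / c0); rewrite ltr_pdivrMr// [_ * c0]mulrC. Qed.

Definition Phi t (u v : X * R -> R) : R := Ex Pr (fun p => v p * pull (floors t) t u p).

Definition ksum N t (g h : V -> R) (K : R -> R) (x : V) := g x * \sum_(k < N) h (iter k T x) * K (t - S Psi k x).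

Lemma bm_ksum N t g h K : trig_poly g -> trig_poly h -> cb K -> bm (fun x : X => ksum N t g h K (rv x)).
Proof.
move=> tg th cK; apply: bmM; first exact: bm_tp.
apply: bm_sum => k; apply: bmM; first exact: (bm_tp (tp_iter A b k th)).
apply: tp_bm_comp => //; apply: measurable_funB => //; exact: bm_measurable (bm_tp (tp_bsumT A b k tP)).
Qed.

(** The shifted overlap kernel is [dkap] plus [p * q] times a wide [bump]. The first has a compactly
    supported primitive and cancels by shearing; the second is a window average. *)
Lemma overlap_limit g h p q z e : trig_poly g -> trig_poly h -> 0 <= p -> 0 <= q -> - z <= 2 * M -> 0 < e ->
  exists t0, forall t, t0 <= t ->
  `|E (fun x => ksum (floors t) t g h (fun y => overlap p q (y - z)) (rv x))
     - p * q * (E (g \o @rv R n.+1) * E (h \o @rv R n.+1) / m0)| <= e.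
Proof.
move=> tg th p0 q0 zM e0.
have [hb hav] := unif_avg_tp irr nil th.
have -> : E (h \o @rv R n.+1) = hb by exact: (Ex_unif_avg Au (tp_periodic th) (bm_tp th) hav).
have [B [B0 gB]] := tp_bounded tg.
have pq0 : 0 <= p * q by exact: mulr_ge0.
have e1p : 0 < e / (2 * (p * q * B + 1)) by rewrite divr_gt0// mulr_gt0// ltr_wpDl// mulr_ge0.
have [L L0 HL] := main_term c0p Psic0 PsiM m0p Psi_avg hav e1p.
pose M' := Num.max L (`|z| + p + q).
have M'0 : 0 <= M' by rewrite le_max (ltW L0).
pose kap y := overlap_prim p q (y - z) - p * q * bump_prim L y.
pose dkap y := overlap p q (y - z) - p * q * bump L y.
have supp y : M' < `|y| -> kap y = 0 /\ dkap y = 0.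
  by apply: overlap_bump_support => //; rewrite le_max lexx// orbT.
have shift (y : R) : is_derive y (1 : R) (fun y : R => y - z) 1.
  by apply: (is_derive_eq (is_deriveB (is_derive_id y 1) (is_derive_cst z y 1))); rewrite subr0.
have dk (y : R) : is_derive y (1 : R) kap (dkap y).
  have d1 : is_derive y (1 : R) (fun y => overlap_prim p q (y - z)) (overlap p q (y - z) * 1).
    exact: (is_d_comp (g := fun y : R => y - z) (is_d_overlap p q _) (shift y)).
  have d2 := is_dZ (p * q) (is_d_bump L y).
  by apply: (is_derive_eq (is_deriveB d1 d2)); rewrite mulr1.
have co : cb (fun y => overlap p q (y - z)) by apply: cb_shift; exact: cb_overlap.
have cbb := cb_bump L0.
have cdk : cb dkap by apply: cbB => //; apply: cbM => //; exact: cb_cst.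
have ck : continuous kap := is_d_continuous dk.
have [be1 be10 H1] := compact_support_bound ck (fun y hy => (supp y hy).1).
have [be2 be20 H2] := compact_support_bound cdk.1 (fun y hy => (supp y hy).2).
have cbk : cb kap := cb_compact_support ck (fun y hy => (supp y hy).1).
have [be kM dkM] : exists2 be, forall y, `|kap y| <= be * small M' y & forall y, `|dkap y| <= be * small M' y.
  exists (be1 + be2) => y; [apply: le_trans (H1 y) _|apply: le_trans (H2 y) _]; rewrite ler_wpM2r ?small_ge0//; lra.
have e20 : 0 < e / 2 by rewrite divr_gt0.
have [t0 Ht0] := shear_cancellation Au irr nil tP ta tc PsiE dev c0p Psic0 m0p dk cbk cdk M'0 kM dkM tg th gH e20.
exists (Num.max t0 L) => t; rewrite ge_max => /andP[tt0 tL].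
(* The window average needs floors up to the height [t + L], possibly beyond [floors t]; the
   additional ones leave the overlap sum unchanged. *)
pose N := maxn (floors t) (Num.truncn ((t + L) / c0)).+1.
have NL : t + L <= c0 * N%:R.
  apply: (@le_trans _ _ (c0 * (Num.truncn ((t + L) / c0)).+1%:R)); last first.
    by rewrite ler_pM2l// ler_nat leq_maxr.
  by have := truncnS_gt ((t + L) / c0); rewrite ltr_pdivrMr// mulrC => /ltW.
have extend x : ksum (floors t) t g h (fun y => overlap p q (y - z)) x = ksum N t g h (fun y => overlap p q (y - z)) x.
  congr (_ * _); symmetry.
  apply: (@sum_ord_tail R (fun k => h (iter k T x) * overlap p q (t - S Psi k x - z))) => k kN.
    rewrite overlap0 ?mulr0//; have := floors_gt t; have := @bsumT_ge R n.+1 A b Psi c0 Psic0 k x.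
    have : c0 * (floors t)%:R <= c0 * k%:R by rewrite ler_pM2l// ler_nat.
    move: zM; lra.
  rewrite overlap0 ?mulr0//; have := floors_gt t; have := @bsumT_ge R n.+1 A b Psi c0 Psic0 k x.
  have : c0 * (floors t)%:R <= c0 * k%:R by rewrite ler_pM2l// ler_nat (leq_trans (leq_maxl _ _) kN).
  move: zM; lra.
have split x : ksum N t g h (fun y => overlap p q (y - z)) x = ksum N t g h dkap x + p * q * ksum N t g h (bump L) x.
  rewrite /ksum mulrCA -mulrDr; congr (_ * _); rewrite mulr_sumr -big_split/=; apply: eq_bigr => k _.
  by rewrite /dkap; ring.
have -> : (fun x : X => ksum (floors t) t g h (fun y => overlap p q (y - z)) (rv x)) =
    fun x => ksum N t g h dkap (rv x) + p * q * ksum N t g h (bump L) (rv x).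
  by apply/funext => x; rewrite extend split.
rewrite ExD; [|exact: bm_ksum|by apply: bmZ; exact: bm_ksum].
rewrite ExZ; last exact: bm_ksum.
have h1 := Ht0 t N tt0; rewrite -[Ex _ _]/(E (fun x => ksum N t g h dkap (rv x))) in h1.
have h2 : `|E (fun x => ksum N t g h (bump L) (rv x)) - E (g \o @rv R n.+1) * hb / m0| <= B * (e / (2 * (p * q * B + 1))).
  rewrite -mulrA [E _ * _]mulrC -ExZ; last exact: bm_tp.
  rewrite -ExB; [|exact: bm_ksum|by apply: bmZ; exact: bm_tp].
  apply: Ex_norm_le; first by apply: bmB; [exact: bm_ksum|apply: bmZ; exact: bm_tp].
  move=> x; rewrite /ksum /= [hb / m0 * _]mulrC -mulrBr normrM ler_pM//.
  exact: HL.
have h3 : p * q * (B * (e / (2 * (p * q * B + 1)))) <= e / 2.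
  have d0 : 0 < p * q * B + 1 by rewrite ltr_wpDl// mulr_ge0.
  rewrite (_ : _ * _ = e / 2 * (p * q * B / (p * q * B + 1))); last by field; rewrite gt_eqF.
  apply: ler_piMr; first exact: ltW.
  by rewrite ler_pdivrMr// mul1r lerDl.
have h4 := ler_wpM2l pq0 h2.
rewrite -[X in X * `|_|](ger0_norm pq0) -normrM mulrBr in h4.
move: h1 (le_trans h4 h3); move: (E _) (E _) => u1 u2.
move: (p * q * (_ / m0)) => w; rewrite !ler_norml; lra.
Qed.

(** Intervals ending at [M] suffice: within the strip they are the traces of rays, which are stable
    under intersection and generate the Borel sets. *)
Definition jind al (r : R) : R := \1_(`[al, M[ : set R) r.

Lemma bm_jind al : bm (jind al).
Proof. by apply: bm_indic; exact: measurable_itv. Qed.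

Lemma jindE al r : jind al r = (al <= r < M)%R%:R.
Proof.
rewrite /jind indicE; have [h|h] := boolP (al <= r < M).
  by rewrite mem_set//= in_itv.
by rewrite memNset//= in_itv/=; exact/negP.
Qed.

Lemma jind_itv al : 0 <= al <= M ->
  Ex UM (jind al) = (M - al) / M.
Proof.
move=> /andP[al0 alM]; apply: EFin_inj; rewrite ExE; last exact: bm_jind.
rewrite integral_uniform//; last 2 first.
- by apply/measurable_EFinP; exact: bm_measurable (bm_jind al).
- by move=> r; rewrite lee_fin jindE.
rewrite subr0 integral_indic//.
rewrite (_ : `[al, M[ `&` `[0, M] = `[al, M[%classic); last first.
  apply/seteqP; split=> r /=; rewrite !in_itv/=; first by case.
  by move=> /andP[h1 h2]; rewrite h1 h2 (le_trans al0 h1) ltW.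
rewrite [X in (_ * X)%E]lebesgue_measure_itv/= lte_fin mulrC EFinM.
have [lt|ge] := ltP al M; first by rewrite -EFinB.
by rewrite (_ : M - al = 0)//; apply/eqP; rewrite subr_eq0 eq_le alM ge.
Qed.

Lemma jind_overlap al be tau : 0 <= al <= M -> 0 <= be <= M ->
  Ex UM (fun r => jind be r * jind al (r + tau)) = overlap (M - al) (M - be) (tau - (al - M)) / M.
Proof.
move=> /andP[al0 alM] /andP[be0 beM].
pose lo := Num.max be (al - tau); pose hi := Num.min M (M - tau).
have e r : jind be r * jind al (r + tau) = \1_(`[lo, hi[ : set R) r.
  rewrite !jindE -natrM mulnb indicE; congr (nat_of_bool _)%:R.
  apply/idP/idP => [|].
    move=> /andP[/andP[h1 h2] /andP[h3 h4]]; rewrite inE/= in_itv/= /lo /hi ge_max lt_min; lra.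
  rewrite inE/= in_itv/= /lo /hi ge_max lt_min; lra.
rewrite (_ : (fun r => _) = \1_(`[lo, hi[ : set R)); last by apply/funext => r; exact: e.
apply: EFin_inj; rewrite ExE; last by apply: bm_indic; exact: measurable_itv.
rewrite integral_uniform//; last first.
  by apply/measurable_EFinP; apply: measurable_indic; exact: measurable_itv.
rewrite subr0 integral_indic//.
rewrite (_ : `[lo, hi[ `&` `[0, M] = `[lo, hi[%classic); last first.
  apply/seteqP; split=> r /=; rewrite !in_itv/=; first by case.
  by rewrite /lo /hi ge_max lt_min; lra.
rewrite [X in (_ * X)%E]lebesgue_measure_itv/= lte_fin mulrC EFinM; congr (_ * _)%E.
rewrite overlap_length//.
exact: if_lt_pp.
Qed.

(** Integrating out the height first turns the two height conditions into an overlap length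
    depending on [t - S_k]. *)
Lemma PhiE t g h al be : trig_poly g -> trig_poly h -> 0 <= al <= M -> 0 <= be <= M ->
  Phi t (fun p => h (rv p.1) * jind al p.2) (fun p => g (rv p.1) * jind be p.2) =
  M^-1 * E (fun x => ksum (floors t) t g h (fun y => overlap (M - al) (M - be) (y - (al - M))) (rv x)).
Proof.
move=> tg th hal hbe.
have bu (f : V -> R) y : trig_poly f -> bm (fun p : X * R => f (rv p.1) * jind y p.2).
  move=> tf; apply: bmM.
    by apply: (bm_comp (T' := (X * R)%type) (h := fst) _ (bm_tp tf)).
  by apply: (bm_comp (T' := (X * R)%type) (h := snd) _ (bm_jind y)).
have bp : bm (fun p : X * R => g (rv p.1) * jind be p.2 * pull (floors t) t (fun p => h (rv p.1) * jind al p.2) p).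
  by apply: bmM; [exact: bu|apply: bm_pull => //; exact: bu].
have co : cb (fun y => overlap (M - al) (M - be) (y - (al - M))).
  by apply: cb_shift; apply: cb_overlap; lra.
rewrite /Phi Ex_prod// -ExZ; last exact: bm_ksum.
congr (Ex _ _); apply/funext => x.
have -> : (fun r : R => g (rv (x, r).1) * jind be (x, r).2 * pull (floors t) t (fun p => h (rv p.1) * jind al p.2) (x, r)) =
    (fun r : R => \sum_(k < floors t) g (rv x) * h (iter k T (rv x)) * (jind be r * jind al (r + (t - S Psi k (rv x))))).
  apply/funext => r; rewrite /pull mulr_sumr; apply: eq_bigr => k _ /=.
  by rewrite (periodic_Tcube A b k x (tp_periodic th)) addrA; ring.
have bk k : bm (fun r : R => jind be r * jind al (r + (t - S Psi k (rv x)))).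
  apply: bmM; first exact: bm_jind.
  by apply: (bm_comp (T' := R) (h := fun r : R => r + (t - S Psi k (rv x))) _ (bm_jind al)); exact: measurable_funD.
rewrite (Ex_sum UM); last by move=> k; exact: (bmZ _ (bk k)).
rewrite /ksum mulrCA !mulr_sumr; apply: eq_bigr => k _.
transitivity (g (rv x) * h (iter k T (rv x)) * Ex UM (fun r => jind be r * jind al (r + (t - S Psi k (rv x))))).
  exact: (ExZ UM _ (bk k)).
rewrite jind_overlap//; ring.
Qed.

Lemma floor_sum_le t u B p : 0 <= B -> (forall p, `|u p| <= B * \1_strip' p) -> `|pull (floors t) t u p| <= B * cnt.
Proof. exact: (@pull_le _ _ A b Psi c0 M c0p Psic0 M0). Qed.

Lemma bm_Phi t u v : bm u -> bm v -> bm (fun p : X * R => v p * pull (floors t) t u p).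
Proof. by move=> bu bv; apply: bmM => //; exact: bm_pull. Qed.

Lemma pullB N t u u' p : pull N t (fun p => u p - u' p) p = pull N t u p - pull N t u' p.
Proof. by rewrite /pull -sumrB. Qed.

Lemma PhiB t u u' v v' : bm u -> bm u' -> bm v -> bm v' ->
  Phi t u v - Phi t u' v' = Phi t (fun p => u p - u' p) v + Phi t u' (fun p => v p - v' p).
Proof.
move=> bu bu' bv bv'; rewrite /Phi.
rewrite -(ExB Pr (bm_Phi t bu bv) (bm_Phi t bu' bv')) -(ExD Pr (bm_Phi t (bmB bu bu') bv) (bm_Phi t bu' (bmB bv bv'))).
by congr (Ex _ _); apply/funext => p; rewrite pullB; ring.
Qed.

(** With [Phi_le_r], continuity in mean in each argument, uniform in [t]: approximations of sets by
    trigonometric polynomials pass to correlations. *)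
Lemma Phi_le_l t u v : bm u -> bm v -> (forall p, ~ strip' p -> u p = 0) -> (forall p, `|v p| <= 1) ->
  `|Phi t u v| <= cnt * Ex Pr (fun p => `|u p|).
Proof.
move=> bu bv us v1; apply: le_trans (Ex_abs Pr (bm_Phi t bu bv)) _.
apply: le_trans (Ex_pull_le b Au tP c0p Psic0 M0 (floors t) t (bm_abs bu) _ _) => [|p|p /us ->]; last 2 first.
- exact: normr_ge0.
- exact: normr0.
apply: Ex_le; [exact: bm_abs (bm_Phi t bu bv)|by apply: bm_pull => //; exact: bm_abs|move=> p].
rewrite normrM -[leRHS]mul1r ler_pM//; first exact: ler_norm_sum.
Qed.

Lemma Phi_le_r t u v B : bm u -> bm v -> 0 <= B -> (forall p, `|u p| <= B * \1_strip' p) ->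
  `|Phi t u v| <= B * cnt * Ex Pr (fun p => `|v p|).
Proof.
move=> bu bv B0 uB; apply: le_trans (Ex_abs Pr (bm_Phi t bu bv)) _.
rewrite -(ExZ Pr _ (bm_abs bv)); apply: Ex_le; [exact: bm_abs (bm_Phi t bu bv)|apply: bmZ; exact: bm_abs|move=> p].
by rewrite normrM mulrC ler_wpM2r//; exact: floor_sum_le.
Qed.

Lemma bm_tensor (f : X -> R) (y : R) : bm f -> bm (fun p : X * R => f p.1 * jind y p.2).
Proof.
move=> bf; apply: bmM; first by apply: (bm_comp (T' := (X * R)%type) (h := fst) _ bf).
by apply: (bm_comp (T' := (X * R)%type) (h := snd) _ (bm_jind y)).
Qed.

Lemma Ex_tensor (f : X -> R) y : bm f -> 0 <= y <= M -> Ex Pr (fun p => f p.1 * jind y p.2) = E f * ((M - y) / M).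
Proof.
move=> bf hy; rewrite (Ex_prod M0 (bm_tensor y bf)) mulrC -ExZ//; congr (Ex _ _); apply/funext => x.
by rewrite /= (ExZ UM _ (bm_jind y)) jind_itv// mulrC.
Qed.

Lemma Ex_abs_tensor (f : X -> R) y : bm f -> 0 <= y <= M -> Ex Pr (fun p => `|f p.1 * jind y p.2|) <= E (fun x => `|f x|).
Proof.
move=> bf hy.
have -> : (fun p : X * R => `|f p.1 * jind y p.2|) = (fun p => (fun x => `|f x|) p.1 * jind y p.2).
  by apply/funext => p; rewrite normrM [`|jind _ _|]ger0_norm// jindE.
rewrite [leLHS](Ex_tensor (bm_abs bf) hy).
have /andP[y0 yM] := hy; rewrite ler_piMr//; first by apply: Ex_ge0.
by rewrite ler_pdivrMr ?M0// mul1r; lra.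
Qed.

Lemma tensor_strip (f : X -> R) y B p : 0 <= y -> (forall x, `|f x| <= B) -> `|f p.1 * jind y p.2| <= B * \1_strip' p.
Proof.
move=> y0 fB; rewrite normrM jindE indicE; have B0 : 0 <= B by apply: le_trans (fB p.1).
have [h|_] := boolP (y <= p.2 < M); last by rewrite normr0 mulr0 mulr_ge0.
rewrite normr1 mulr1 mem_set ?mulr1//; rewrite /strip/=; lra.
Qed.

Lemma tensor_strip0 (f : X -> R) y p : 0 <= y -> ~ strip' p -> f p.1 * jind y p.2 = 0.
Proof.
move=> y0 ns; rewrite jindE; have [h|_] := boolP (y <= p.2 < M); last by rewrite mulr0.
by exfalso; apply: ns; rewrite /strip/=; lra.
Qed.

Lemma rectangle_limit (B B' : set X) al be e : measurable B -> measurable B' -> 0 <= al <= M -> 0 <= be <= M -> 0 < e ->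
  exists t0, forall t, t0 <= t ->
  `|Phi t (fun p => \1_B p.1 * jind al p.2) (fun p => \1_B' p.1 * jind be p.2)
     - M / m0 * (E \1_B * ((M - al) / M)) * (E \1_B' * ((M - be) / M))| <= e.
Proof.
move=> mB mB' hal hbe e0.
have [al0 be0] : 0 <= al /\ 0 <= be by lra.
have Mp := M0.
have cnt0 : 0 <= cnt := cnt_ge0 c0p M0.
pose K := M / m0 * ((M - al) / M) * ((M - be) / M).
have [k1 k2 k3] : [/\ 0 <= M / m0, 0 <= (M - al) / M & 0 <= (M - be) / M].
  have M00 : 0 <= M := ltW Mp; have m00 : 0 <= m0 := ltW m0p.
  have /andP[_ al2] := hal; have /andP[_ be2] := hbe.
  by split; rewrite divr_ge0// subr_ge0.
have K0 : 0 <= K by rewrite /K mulr_ge0// mulr_ge0.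
pose e1 := e / (4 * (cnt + K + 1)).
have CK : 0 < cnt + K + 1 by rewrite ltr_wpDl// addr_ge0.
have e10 : 0 < e1 by rewrite divr_gt0// mulr_gt0.
have [_ /(_ _ e10)[h [th hB]]] := tp_dense mB.
have [Bh [Bh0 HBh]] := tp_bounded th.
(* [g] is chosen after [h], since its accuracy has to compensate the bound [Bh] of [h]. *)
pose e2 := e / (4 * (Bh * cnt + K * Bh + 1)).
have CB : 0 < Bh * cnt + K * Bh + 1 by rewrite ltr_wpDl// addr_ge0// mulr_ge0.
have e20 : 0 < e2 by rewrite divr_gt0// mulr_gt0.
have [_ /(_ _ e20)[g [tg gB]]] := tp_dense mB'.
have e30 : 0 < e / 4 * M by rewrite mulr_gt0// divr_gt0.
have [p0 q0] : 0 <= M - al /\ 0 <= M - be by lra.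
have zM : - (al - M) <= 2 * M by lra.
have [t0 Ht0] := overlap_limit tg th p0 q0 zM e30.
exists t0 => t /Ht0 h1.
have [bB bB'] : bm (\1_B : X -> R) /\ bm (\1_B' : X -> R) by split; exact: bm_indic.
have [bh bg] := (bm_tp th, bm_tp tg).
pose u p : R := \1_B p.1 * jind al p.2; pose v p : R := \1_B' p.1 * jind be p.2.
pose uh (p : X * R) := (h \o @rv R n.+1) p.1 * jind al p.2; pose vg (p : X * R) := (g \o @rv R n.+1) p.1 * jind be p.2.
have [bu bv] : bm (u : X * R -> R) /\ bm (v : X * R -> R) by split; exact: bm_tensor.
have [buh bvg] : bm uh /\ bm vg by split; exact: bm_tensor.
have d1 : `|Phi t (fun p => u p - uh p) v| <= cnt * e1.
  have bb : bm (fun x : X => \1_B x - h (rv x)) by exact: bmB.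
  apply: le_trans (Phi_le_l t (bmB bu buh) bv _ _) _.
  - by move=> p ns; rewrite /u /uh !tensor_strip0// subr0.
  - move=> p; rewrite /v jindE indicE -natrM normr_nat; case: (_ \in _); case: (_ <= _ < _) => //.
  rewrite ler_wpM2l// ltW//; apply: le_lt_trans hB.
  apply: le_trans (Ex_abs_tensor bb hal); rewrite le_eqVlt; apply/orP; left; apply/eqP.
  by congr (Ex _ _); apply/funext => p; rewrite /u /uh mulrBl.
have d2 : `|Phi t uh (fun p => v p - vg p)| <= Bh * cnt * e2.
  have bb : bm (fun x : X => \1_B' x - g (rv x)) by exact: bmB.
  apply: le_trans (Phi_le_r t buh (bmB bv bvg) Bh0 _) _.
    by move=> p; apply: tensor_strip => // x; exact: HBh.
  rewrite ler_wpM2l ?mulr_ge0// ltW//; apply: le_lt_trans gB.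
  apply: le_trans (Ex_abs_tensor bb hbe); rewrite le_eqVlt; apply/orP; left; apply/eqP.
  by congr (Ex _ _); apply/funext => p; rewrite /v /vg mulrBl.
have d3 : `|Phi t uh vg - K * (E (g \o @rv R n.+1) * E (h \o @rv R n.+1))| <= e / 4.
  rewrite (PhiE t tg th hal hbe) -(@ler_pM2l _ M)// [M * (e / 4)]mulrC -[X in X * `|_|](ger0_norm (ltW Mp)) -normrM.
  apply: le_trans h1; rewrite le_eqVlt; apply/orP; left; apply/eqP; congr (`|_|).
  rewrite mulrBr mulVKf ?gt_eqF// /K; congr (_ - _); field; rewrite !gt_eqF//.
have a1 : `|E (h \o @rv R n.+1) - E \1_B| <= e1.
  rewrite -ExB// ltW//; apply: le_lt_trans hB; apply: le_trans (Ex_abs _ _) _; first exact: bmB.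
  by apply: Ex_le; [apply: bm_abs; exact: bmB|apply: bm_abs; exact: bmB|move=> x; rewrite distrC].
have a2 : `|E (g \o @rv R n.+1) - E \1_B'| <= e2.
  rewrite -ExB// ltW//; apply: le_lt_trans gB; apply: le_trans (Ex_abs _ _) _; first exact: bmB.
  by apply: Ex_le; [apply: bm_abs; exact: bmB|apply: bm_abs; exact: bmB|move=> x; rewrite distrC].
have a3 : `|E (h \o @rv R n.+1)| <= Bh by apply: Ex_norm_le => // x; exact: HBh.
have a4 : 0 <= E \1_B' <= 1.
  apply/andP; split; first by apply: Ex_ge0 => x; rewrite indicE.
  by apply: Ex_le_cst => // x; rewrite indicE; case: (_ \in _).
have s1 : cnt * e1 + K * e1 <= e / 4.
  by rewrite -mulrDl; apply: mul_div_le4; [exact: addr_ge0|exact: ltW].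
have s2 : Bh * cnt * e2 + K * Bh * e2 <= e / 4.
  by rewrite -mulrDl; apply: mul_div_le4; [rewrite addr_ge0// mulr_ge0|exact: ltW].
have d12 := PhiB t bu buh bv bvg.
rewrite -[Phi t _ _]/(Phi t u v).
have -> : M / m0 * (E \1_B * ((M - al) / M)) * (E \1_B' * ((M - be) / M)) = K * (E \1_B' * E \1_B) by rewrite /K; ring.
have d4 : `|K * (E (g \o @rv R n.+1) * E (h \o @rv R n.+1)) - K * (E \1_B' * E \1_B)| <= K * e1 + K * Bh * e2.
  rewrite -mulrBr normrM (ger0_norm K0) -mulrA -mulrDr ler_wpM2l//.
  move: a1 a2 a3 a4; move: (E (h \o _)) (E (g \o _)) (E \1_B') (E \1_B) => x1 x2 x3 x4 a1 a2 a3 /andP[a4 a5].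
  rewrite (_ : x2 * x1 - x3 * x4 = (x2 - x3) * x1 + x3 * (x1 - x4)); last by ring.
  apply: le_trans (ler_normD _ _) _; rewrite addrC; apply: lerD; last by rewrite normrM mulrC ler_pM.
  by rewrite normrM (ger0_norm a4) -[leRHS]mul1r ler_pM.
move: d12 d1 d2 d3 d4 s1 s2.
move: (Phi t u v) (Phi t uh vg) (Phi t _ v) (Phi t uh _) (K * (_ * _)) (K * (_ * _)) (cnt * e1) (K * e1) (Bh * cnt * e2) (K * Bh * e2).
by move=> y1 y2 y3 y4 y5 y6 y7 y8 y9 y10; rewrite !ler_norml; lra.
Qed.

End rectangles.

(** * From rectangles to measurable sets *)

Section product_close.
Context d (T : measurableType d) (R : realType) (P : probability T R) (Q : probability (measurableTypeR R) R).
Notation Pr := (P \x Q)%E.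
Variables (phi : R -> set (T * measurableTypeR R) -> R) (psi : set (T * measurableTypeR R) -> R) (C : R).
Hypothesis C0 : 0 <= C.
Hypothesis phiU : forall t A B, measurable A -> measurable B -> A `&` B = set0 -> phi t (A `|` B) = phi t A + phi t B.
Hypothesis psiU : forall A B, measurable A -> measurable B -> A `&` B = set0 -> psi (A `|` B) = psi A + psi B.
Hypothesis phi_le : forall t A, measurable A -> 0 <= phi t A <= C * fine (Pr A).
Hypothesis psi_le : forall A, measurable A -> 0 <= psi A <= C * fine (Pr A).

(** Dynkin's theorem is applied twice: to the height for a fixed base set, then to measurable
    rectangles. *)
Lemma product_close : (forall B x, measurable B -> eventually_close phi psi (B `*` `[x, +oo[)) ->
  (forall B, measurable B -> eventually_close phi psi (B `*` setT)) ->
  forall A, measurable A -> eventually_close phi psi A.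
Proof.
move=> cx cT.
have cJ B J : measurable B -> measurable J -> eventually_close phi psi (B `*` J).
  move=> mB; move: J.
  have XU (J J' : set (measurableTypeR R)) : B `*` (J `|` J') = (B `*` J) `|` (B `*` J').
    by apply/seteqP; split=> [[x y] [/= ? [?|?]]|[x y] [[/= ? ?]|[/= ? ?]]]; [left|right|split=> //; left|split=> //; right].
  have XI (J J' : set (measurableTypeR R)) : J `&` J' = set0 -> (B `*` J) `&` (B `*` J') = set0.
    move=> JJ; apply/seteqP; split=> // -[x y] [[/= _ Jy] [/= _ Jy']].
    by have : set0 y by rewrite -JJ.
  have le J : measurable J -> C * fine (Pr (B `*` J)) <= C * fine (Q J).
    move=> mJ; have mBJ : measurable (B `*` J) by exact: measurableX.
    have le1 : (Pr (B `*` J) <= Q J)%E.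
      rewrite [leLHS](product_measure1E P Q mB mJ) -[leRHS]mul1e lee_wpmul2r//.
      exact: probability_le1.
    have fQ : Q J \is a fin_num by rewrite ge0_fin_numE// (le_lt_trans (probability_le1 Q mJ))// ltry.
    have fP : Pr (B `*` J) \is a fin_num by rewrite ge0_fin_numE// (le_lt_trans le1)// -ge0_fin_numE.
    by rewrite ler_wpM2l// fine_le.
  apply: (@dynkin_close _ _ _ Q (fun t J => phi t (B `*` J)) (fun J => psi (B `*` J)) C _ _ _ _ (@RGenCInfty.G R)).
  - move=> t J J' mJ mJ' JJ; rewrite XU phiU//; [exact: measurableX|exact: measurableX|exact: XI].
  - move=> J J' mJ mJ' JJ; rewrite XU psiU//; [exact: measurableX|exact: measurableX|exact: XI].
  - move=> t J mJ; have /andP[h1 h2] := phi_le t (measurableX mB mJ); rewrite h1/=; exact: le_trans (le _ mJ).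
  - move=> J mJ; have /andP[h1 h2] := psi_le (measurableX mB mJ); rewrite h1/=; exact: le_trans (le _ mJ).
  - exact: RGenCInfty.measurableE.
  - move=> _ _ [x ->] [y ->]; exists (Num.max x y); apply/seteqP; split=> r /=; rewrite !in_itv/= !andbT.
      by move=> [h1 h2]; rewrite ge_max h1.
    by rewrite ge_max => /andP.
  - exact: cT.
  - by move=> _ [x ->]; exact: cx.
apply: (@dynkin_close _ _ _ Pr phi psi C _ _ _ _ _ (measurable_prod_measurableType _ _)) => //.
- move=> _ _ [B1 mB1 [J1 mJ1 <-]] [B2 mB2 [J2 mJ2 <-]].
  by exists (B1 `&` B2); [exact: measurableI|exists (J1 `&` J2); [exact: measurableI|rewrite setXI]].
- by rewrite -setXTT; apply: cT.
- by move=> _ [B mB [J mJ <-]]; exact: cJ.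
Qed.

End product_close.

Section mixing.
Variables (R : realType) (n : nat) (A : 'M[int]_n.+1) (b : 'rV[R]_n.+1).
Hypothesis Au : upper_unipotent A.
Notation X := (n.+1.-tuple R).
Notation V := 'rV[R]_n.+1.
Notation T := (Tlift A b).
Notation Tc := (Tcube A b).
Notation E := (Ex (Lam R n.+1)).
Notation S := (bsumT A b).
Variables (Psi : V -> R) (m0 c0 M : R).
Hypothesis tP : trig_poly Psi.
Hypothesis c0p : 0 < c0.
Hypothesis Psic0 : forall x, c0 <= Psi x.
Hypothesis PsiM : forall x, Psi x <= M.
Hypothesis m0p : 0 < m0.
Notation Mp := (M0 c0p Psic0 PsiM).
Notation UM := (uniform_prob Mp).
Notation Pr := (Lam R n.+1 \x UM)%E.
Notation Phi := (Phi A b c0p Psic0 PsiM).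
Notation pull := (pull A b Psi).
Notation cnt := (cnt c0 M).
Notation strip' := (@strip R n.+1 M).
Notation floors := (floors c0 M).
Notation jind := (jind M).

Hypothesis rectangle : forall (B B' : set X) al be e, measurable B -> measurable B' -> 0 <= al <= M -> 0 <= be <= M ->
  0 < e -> exists t0, forall t, t0 <= t ->
  `|Phi t (fun p => \1_B p.1 * jind al p.2) (fun p => \1_B' p.1 * jind be p.2)
     - M / m0 * (E \1_B * ((M - al) / M)) * (E \1_B' * ((M - be) / M))| <= e.

Definition sind (F : set (X * R)) : X * R -> R := \1_(F `&` strip').

Definition corr t (F G : set (X * R)) : R := Phi t (sind F) (sind G).
(** The invariant probability is [M / m0] times [Pr] on the suspension. [corr] is taken with respect
    to [Pr], so one of the two factors [M / m0] remains here. *)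
Definition corr_lim (F G : set (X * R)) : R := M / m0 * Ex Pr (sind F) * Ex Pr (sind G).

Lemma sindE F p : sind F p = ((p \in F) && (0 <= p.2 < M))%:R.
Proof.
rewrite /sind indicE in_setI; congr (nat_of_bool (_ && _))%:R.
by apply/idP/idP => [|h]; [rewrite inE|apply/mem_set].
Qed.

Lemma bm_sind F : measurable F -> bm (sind F).
Proof. by move=> mF; apply: bm_indic; apply: measurableI => //; exact: measurable_strip. Qed.

Lemma sind_ge0 F p : 0 <= sind F p. Proof. by rewrite sindE. Qed.

Lemma sind_le1 F p : sind F p <= 1. Proof. by rewrite sindE -[leRHS]/(1%:R) ler_nat leq_b1. Qed.

Lemma sindU F G : F `&` G = set0 -> sind (F `|` G) = fun p => sind F p + sind G p.
Proof.
move=> FG; apply/funext => p; rewrite !sindE in_setU.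
have [pF|pF] := boolP (p \in F); have [pG|pG] := boolP (p \in G) => /=; rewrite ?addr0 ?add0r//.
by have /set_mem : p \in F `&` G; [rewrite in_setI pF pG|rewrite FG].
Qed.

Lemma Ex_sind_le F : measurable F -> 0 <= Ex Pr (sind F) <= fine (Pr F).
Proof.
move=> mF; apply/andP; split; first by apply: Ex_ge0 => p; exact: sind_ge0.
rewrite -(Ex_indic Pr mF); apply: Ex_le; [exact: bm_sind|exact: bm_indic|move=> p].
by rewrite sindE indicE -mulnb natrM ler_piMr//; case: (_ <= _ < _).
Qed.

Lemma pullD N t u u' p : pull N t (fun p => u p + u' p) p = pull N t u p + pull N t u' p.
Proof. by rewrite /pull -big_split. Qed.

Lemma corrUl t F F' G : measurable F -> measurable F' -> measurable G -> F `&` F' = set0 ->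
  corr t (F `|` F') G = corr t F G + corr t F' G.
Proof.
move=> mF mF' mG FF; rewrite /corr /Phi (sindU FF).
rewrite -(ExD Pr (bm_Phi A b c0 M tP t (bm_sind mF) (bm_sind mG)) (bm_Phi A b c0 M tP t (bm_sind mF') (bm_sind mG))).
by congr (Ex _ _); apply/funext => p; rewrite pullD mulrDr.
Qed.

Lemma corrUr t F G G' : measurable F -> measurable G -> measurable G' -> G `&` G' = set0 ->
  corr t F (G `|` G') = corr t F G + corr t F G'.
Proof.
move=> mF mG mG' GG; rewrite /corr /Phi (sindU GG).
rewrite -(ExD Pr (bm_Phi A b c0 M tP t (bm_sind mF) (bm_sind mG)) (bm_Phi A b c0 M tP t (bm_sind mF) (bm_sind mG'))).
by congr (Ex _ _); apply/funext => p; rewrite mulrDl.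
Qed.

Lemma corr_ge0 t F G : 0 <= corr t F G.
Proof.
by apply: Ex_ge0 => p; rewrite mulr_ge0 ?sind_ge0//; apply: sumr_ge0 => k _; exact: sind_ge0.
Qed.

Lemma abs_sind F : (fun p => `|sind F p|) = sind F.
Proof. by apply/funext => p; rewrite ger0_norm// sind_ge0. Qed.

Lemma cnt0 : 0 <= cnt. Proof. exact: cnt_ge0 c0p Mp. Qed.

Lemma corr_le_l t F G : measurable F -> measurable G -> corr t F G <= cnt * fine (Pr F).
Proof.
move=> mF mG; apply: le_trans (ler_norm _) _.
apply: le_trans (Phi_le_l b Au tP c0p Psic0 PsiM t (bm_sind mF) (bm_sind mG) _ _) _.
- by move=> p ns; rewrite sindE (_ : (0 <= _ < _) = false) ?andbF//; exact/negP.
- by move=> p; rewrite ger0_norm ?sind_ge0 ?sind_le1.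
by rewrite abs_sind ler_wpM2l ?cnt0//; have /andP[] := Ex_sind_le mF.
Qed.

Lemma corr_le_r t F G : measurable F -> measurable G -> corr t F G <= cnt * fine (Pr G).
Proof.
move=> mF mG; apply: le_trans (ler_norm _) _.
apply: le_trans (Phi_le_r A b tP c0p Psic0 PsiM t (bm_sind mF) (bm_sind mG) ler01 _) _.
  move=> p; rewrite mul1r ger0_norm ?sind_ge0// sindE indicE ler_nat.
  have [h|h] := boolP (0 <= p.2 < M); last by rewrite andbF.
  by rewrite (@mem_set _ strip' p)// leq_b1.
by rewrite mul1r abs_sind ler_wpM2l ?cnt0//; have /andP[] := Ex_sind_le mG.
Qed.

Definition rectangular (F : set (X * R)) := exists B al, [/\ measurable B, 0 <= al <= M &
  sind F = fun p => \1_B p.1 * jind al p.2].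

Lemma rectangular_ray B x : measurable B -> rectangular (B `*` `[x, +oo[).
Proof.
move=> mB; exists B, (Num.min M (Num.max 0 x)); split=> //.
  by have := Mp; rewrite le_min ge_min le_max !lexx/= => /ltW ->.
apply/funext => p; rewrite sindE jindE indicE -natrM mulnb; congr (nat_of_bool _)%:R.
rewrite in_setX; have -> : (p.2 \in `[x, +oo[%classic) = (x <= p.2).
  by apply/idP/idP => [|h]; [rewrite inE/= in_itv/= andbT|apply/mem_set; rewrite /= in_itv/= h].
rewrite -andbA; congr (_ && _); rewrite ge_min ge_max.
have := Mp; lra.
Qed.

Lemma rectangularT B : measurable B -> rectangular (B `*` setT).
Proof.
move=> mB; exists B, 0; split=> //; first by rewrite lexx ltW ?Mp.
apply/funext => p; rewrite sindE jindE indicE -natrM mulnb in_setX; congr (nat_of_bool (_ && _))%:R.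
by rewrite (@in_setT _ p.2) andbT.
Qed.

Lemma rectangular_close F G : rectangular F -> rectangular G -> eventually_close (fun t F => corr t F G) (corr_lim ^~ G) F.
Proof.
move=> [B [al [mB hal eF]]] [B' [be [mB' hbe eG]]] e e0.
have [t0 H] := rectangle mB mB' hal hbe e0; exists t0 => t /H.
rewrite /corr /corr_lim eF eG.
by rewrite !Ex_tensor//; exact: bm_indic.
Qed.

Lemma corr_limUl F F' G : measurable F -> measurable F' -> F `&` F' = set0 ->
  corr_lim (F `|` F') G = corr_lim F G + corr_lim F' G.
Proof.
move=> mF mF' FF; rewrite /corr_lim (sindU FF) (ExD Pr (bm_sind mF) (bm_sind mF')); ring.
Qed.

Lemma corr_limC F G : corr_lim F G = corr_lim G F. Proof. by rewrite /corr_lim mulrAC. Qed.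

Lemma corr_lim_le F G : measurable F -> measurable G -> 0 <= corr_lim F G <= M / m0 * fine (Pr F).
Proof.
move=> mF mG; have /andP[f0 f1] := Ex_sind_le mF; have /andP[g0 g1] := Ex_sind_le mG.
have K0 : 0 <= M / m0 by rewrite divr_ge0 ?ltW ?Mp.
have g2 : Ex Pr (sind G) <= 1 by apply: Ex_le_cst => [|p]; [exact: bm_sind|exact: sind_le1].
apply/andP; split; first by rewrite /corr_lim mulr_ge0// mulr_ge0.
have := ler_pM f0 g0 f1 g2; rewrite mulr1 => h.
by rewrite /corr_lim -[leLHS]mulrA; exact: ler_wpM2l.
Qed.

(** Additivity and the uniform bounds hold in each argument separately, so the extension is made
    first in [F] against rectangular sets, then in [G]. *)
Lemma corr_close F G : measurable F -> measurable G -> eventually_close (fun t F => corr t F G) (corr_lim ^~ G) F.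
Proof.
have K0 : 0 <= M / m0 by rewrite divr_ge0 ?ltW ?Mp.
have CK : 0 <= cnt + M / m0 by rewrite addr_ge0 ?cnt0.
have P0 (H : set (X * R)) : 0 <= fine (Pr H) by exact: fine_ge0.
have main F' G' : rectangular G' -> measurable G' -> measurable F' ->
    eventually_close (fun t F => corr t F G') (corr_lim ^~ G') F'.
  move=> rG mG mF.
  apply: (@product_close _ _ _ (Lam R n.+1) UM (fun t F => corr t F G') (corr_lim ^~ G') (cnt + M / m0)) => //.
  - by move=> t B B' mB mB' BB; exact: corrUl.
  - by move=> B B' mB mB' BB; exact: corr_limUl.
  - by move=> t B mB; rewrite corr_ge0/= (le_trans (corr_le_l t mB mG))// ler_wpM2r// lerDl.
  - move=> B mB; have /andP[h1 h2] := corr_lim_le mB mG; rewrite h1/= (le_trans h2)// ler_wpM2r// lerDr cnt0//.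
  - by move=> B x mB; apply: rectangular_close => //; exact: rectangular_ray.
  - by move=> B mB; apply: rectangular_close => //; exact: rectangularT.
move=> mF mG.
suff : eventually_close (fun t => corr t F) (corr_lim F) G by [].
apply: (@product_close _ _ _ (Lam R n.+1) UM (fun t => corr t F) (corr_lim F) (cnt + M / m0)) => //.
- by move=> t B B' mB mB' BB; exact: corrUr.
- by move=> B B' mB mB' BB; rewrite !(corr_limC F); exact: corr_limUl.
- by move=> t B mB; rewrite corr_ge0/= (le_trans (corr_le_r t mF mB))// ler_wpM2r// lerDl.
- move=> B mB; rewrite corr_limC; have /andP[h1 h2] := corr_lim_le mB mF; rewrite h1/= (le_trans h2)// ler_wpM2r// lerDr cnt0//.
- move=> B x mB; have mBx : measurable (B `*` `[x, +oo[) by apply: measurableX.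
  exact: (main F _ (rectangular_ray x mB) mBx mF).
- move=> B mB; have mBT : measurable (B `*` [set: R]) by apply: measurableX.
  exact: (main F _ (rectangularT mB) mBT mF).
Qed.

Notation PsiX := (Psi \o @rv R n.+1).
Hypothesis m0E : intT PsiX = m0.

Lemma susp_strip : susp PsiX `<=` strip'.
Proof. by move=> p [_ [h1 h2]]; rewrite /strip/= h1 (lt_le_trans h2 (PsiM _)). Qed.

Lemma bsum_bsumT k (x : X) : bsum A b PsiX k x = S Psi k (rv x).
Proof. by apply: eq_bigr => j _ /=; rewrite (periodic_Tcube A b j x (tp_periodic tP)). Qed.

Lemma susp_vol_Pr F : measurable F -> F `<=` strip' -> susp_vol F = (M * Ex Pr (\1_F : X * R -> R))%:E.
Proof.
move=> mF Fs; rewrite /susp_vol iintE; last 2 first.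
- have := @measurable_fun_xsection _ _ X (measurableTypeR R) R (@lebesgue_measure R) F mF.
  by apply: eq_measurable_fun => x _ /=; congr (lebesgue_measure _); rewrite xsectionE.
- by move=> x; exact: measure_ge0.
have bF : bm (\1_F : X * R -> R) by exact: bm_indic.
rewrite EFinM (Ex_prod Mp bF) ExE; last exact: (@bm_Ex _ _ _ _ _ (Lam R n.+1) UM _ bF).
rewrite -ge0_integralZl//; last 3 first.
- apply/measurable_EFinP; exact: bm_measurable (@bm_Ex _ _ _ _ _ (Lam R n.+1) UM _ bF).
- by move=> x _; rewrite lee_fin; apply: Ex_ge0 => r; rewrite indicE.
- by rewrite lee_fin ltW ?Mp.
apply: eq_integral => x _; rewrite ExE; last exact: (bm_pair bF).
have mx : measurable [set r : R | F (x, r)].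
  by have := measurable_xsection x mF; rewrite xsectionE.
rewrite (eq_integral (fun r : measurableTypeR R => (\1_[set r : R | F (x, r)] r)%:E)); last first.
  by move=> r _; rewrite !indicE; congr (_%:R)%:E; congr nat_of_bool; apply/idP/idP; rewrite !inE.
rewrite integral_uniform//; last by apply/measurable_EFinP; exact: measurable_indic.
rewrite integral_indic// muleA -EFinM subr0 mulfV ?gt_eqF ?Mp// mul1e.
congr (lebesgue_measure _); apply/seteqP; split=> [r /= Fr|r [] //].
split=> //; have := Fs _ Fr; rewrite /strip/= in_itv/= => /andP[-> /ltW].
exact.
Qed.

(** Since [F] lies in the suspension, a nonzero term of [pull] forces [S_k <= r + t < S_(k+1)], so
    the only floor that can contribute is the one reached by the flow. *)
Lemma flow_indicator t F p : F `<=` susp PsiX -> susp PsiX p ->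
  (\1_(flow_preimage A b PsiX t F) p : R) = pull (floors t) t (\1_F) p.
Proof.
move=> Fs sp; rewrite /pull.
have Fk k : F (iter k Tc p.1, p.2 + t - S Psi k (rv p.1)) ->
    S Psi k (rv p.1) <= p.2 + t < S Psi k.+1 (rv p.1).
  move=> /Fs[_ [/= h1 h2]]; rewrite (periodic_Tcube A b k p.1 (tp_periodic tP)) in h2.
  rewrite bsumTr; move: h1 h2; lra.
have uniq i j : S Psi i (rv p.1) <= p.2 + t < S Psi i.+1 (rv p.1) -> S Psi j (rv p.1) <= p.2 + t < S Psi j.+1 (rv p.1) -> i = j.
  have lt i' j' : (i' < j')%N -> S Psi i'.+1 (rv p.1) <= S Psi j' (rv p.1) by move=> h; apply: (bsumT_homo A b c0p Psic0).
  move=> hi hj; apply/eqP; rewrite eqn_leq; apply/andP; split; rewrite leqNgt; apply/negP => /lt; lra.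
rewrite indicE; have [h|h] := pselect (flow_preimage A b PsiX t F p).
  rewrite mem_set//; have [_ [k]] := h; rewrite !bsum_bsumT => -[hk FF].
  have kf : (k < floors t)%N.
    rewrite -(ltr_nat R) -(ltr_pM2l c0p); apply: le_lt_trans (floors_gt M c0p t).
    have := @bsumT_ge R n.+1 A b Psi c0 Psic0 k (rv p.1); have := sp.2.2; have := PsiM (rv p.1); have := Mp.
    move: hk; rewrite /=; lra.
  rewrite (bigD1 (Ordinal kf))//= indicE mem_set// big1 ?addr0// => j jk.
  rewrite indicE memNset// => /Fk hj; move/negP: jk; apply; apply/eqP/val_inj => /=.
  exact: uniq hj hk.
rewrite memNset// big1// => k _; rewrite indicE memNset// => FF.
by apply: h; split=> //; exists k; rewrite !bsum_bsumT; split=> //; exact: Fk.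
Qed.

Lemma measurable_flow_preimage t F G : measurable F -> measurable G -> F `<=` susp PsiX -> G `<=` susp PsiX ->
  measurable (flow_preimage A b PsiX t F `&` G).
Proof.
move=> mF mG Fs Gs.
have mp : measurable_fun [set: X * R] (pull (floors t) t (\1_F)).
  by apply: bm_measurable; apply: bm_pull => //; exact: bm_indic.
rewrite (_ : _ `&` _ = G `&` pull (floors t) t (\1_F) @^-1` `]0, +oo[).
  by apply: measurableI => //; rewrite -[X in measurable X]setTI; apply: mp.
apply/seteqP; split=> p /= [h1 h2]; split=> //.
  by rewrite in_itv/= andbT -flow_indicator//; [rewrite indicE mem_set|exact: Gs].
move: h2; rewrite in_itv/= andbT -flow_indicator//; last exact: Gs.
by rewrite indicE; case: (boolP (p \in _)) => [|_]; [rewrite inE|rewrite ltxx].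
Qed.

Lemma mixing_of_rectangles : mixing_susp A b PsiX.
Proof.
move=> F G mF mG Fs Gs.
have sindS H : H `<=` susp PsiX -> sind H = \1_H.
  by move=> Hs; rewrite /sind; congr (\1_ _); apply/setIidl; apply: subset_trans Hs susp_strip.
have muE H : measurable H -> H `<=` susp PsiX -> susp_mu PsiX H = (M / m0 * Ex Pr (\1_H : X * R -> R))%:E.
  move=> mH Hs; rewrite /susp_mu (setIidl Hs) susp_vol_Pr//; last exact: subset_trans Hs susp_strip.
  by rewrite m0E -EFinM; congr EFin; ring.
have flowE t : susp_mu PsiX (flow_preimage A b PsiX t F `&` G) = (M / m0 * corr t F G)%:E.
  rewrite muE; [|exact: measurable_flow_preimage|by move=> p [_ /Gs]].
  congr (_ * Ex _ _)%:E; apply/funext => p; rewrite (sindS _ Fs) (sindS _ Gs) indicI mulrC.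
  rewrite [LHS]/= [\1_G p]indicE; have [|_] := boolP (p \in G); last by rewrite !mulr0.
  by rewrite inE => /Gs sp; rewrite -flow_indicator.
have limE : (susp_mu PsiX F * susp_mu PsiX G)%E = (M / m0 * corr_lim F G)%:E.
  by rewrite !muE// -EFinM /corr_lim (sindS _ Fs) (sindS _ Gs); congr EFin; ring.
rewrite limE; apply: cvg_EFin; first by apply: nearW => t; rewrite flowE.
have -> : fine \o (fun t => susp_mu PsiX (flow_preimage A b PsiX t F `&` G)) = fun t => M / m0 * corr t F G.
  by apply/funext => t /=; rewrite flowE.
apply: cvgM; first exact: cvg_cst.
apply/cvgrPdist_le => e e0; have [t0 H] := corr_close mF mG e0.
by near=> t; rewrite distrC; apply: H; near: t; apply: nbhs_pinfty_ge; exact: num_real.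
Unshelve. all: by end_near.
Qed.

End mixing.

(** * Lower bound for [Psi] and nilpotency on frequencies *)

Section hypotheses.
Variables (R : realType) (n : nat).
Notation V := 'rV[R]_n.+1.

Lemma dot_continuous (m : 'rV[int]_n.+1) : continuous (dot m : V -> R).
Proof.
move=> x; rewrite (_ : dot m = \sum_i (fun x : V => (m 0 i)%:~R * x 0 i)); last first.
  by apply/funext => y; rewrite /dot fct_sumE.
apply: (big_ind (fun f : V -> R => f z @[z --> x] --> f x)) => [|f g hf hg|i _].
- exact: (@cst_continuous V R 0 x).
- exact: (cvgD hf hg).
- exact: (cvgM (cvg_cst _) (@coord_continuous R 1 n.+1 0 i x)).
Qed.

Lemma tp_continuous (f : V -> R) : trig_poly f -> continuous f.
Proof.
move: f; apply: tp_ind => [x|m a c f _ cf x]; first exact: (@cst_continuous V R 0 x).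
have ct (g : R -> R) : continuous g -> (g (2 * pi * dot m z)) @[z --> x] --> g (2 * pi * dot m x).
  move=> cg; apply: (@continuous_comp _ _ _ (fun z : V => 2 * pi * dot m z) g); last exact: cg.
  exact: (cvgM (cvg_cst _) (@dot_continuous m x)).
have cC := ct cos (@continuous_cos R); have cS := ct sin (@continuous_sin R).
exact: (cvgD (cvgD (cvgM (cvg_cst a) cC) (cvgM (cvg_cst c) cS)) (cf x)).
Qed.

Lemma tp_pos_lower_bound (f : V -> R) : trig_poly f -> (forall x, 0 < f x) ->
  exists2 c0, 0 < c0 & forall x, c0 <= f x.
Proof.
(* The reciprocal is continuous and periodic, hence bounded. *)
move=> tf f0; have cf : continuous (fun x => (f x)^-1).
  by move=> x; exact: (cvgV (lt0r_neq0 (f0 x)) (tp_continuous tf (x := x))).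
have [|M [M0 fM]] := continuous_periodic_bounded cf.
  by move=> x z; rewrite tp_periodic.
exists (M + 1)^-1; first by rewrite invr_gt0 ltr_wpDl.
move=> x; rewrite -[leRHS]invrK lef_pV2 ?posrE ?invr_gt0 ?ltr_wpDl//.
by have := le_trans (ler_norm _) (fM x) => /le_trans; apply; rewrite lerDl.
Qed.

Lemma nu_nilpotent_mxN (A : 'M[int]_n.+1) k : mxN R A ^+ k = 0 -> nu_nilpotent A.
Proof.
move=> N0; exists k => m; apply: (@dot_eq0 R) => x.
have H : forall K y, dot (iter K (nu A) m) y = dot m (y *m mxN R A ^+ K).
  elim=> [|K IH] y; first by rewrite expr0 mulmx1.
  by rewrite iterS dot_nu IH exprS -mulmxA.
by rewrite H N0 mulmx0 /dot big1// => i _; rewrite mxE mulr0.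
Qed.

End hypotheses.

(* d = n.+1 with n >= 1, i.e. d >= 2 *)
Theorem theorem2p6 (R : realType) (n : nat) (A : 'M[int]_n.+1)
    (b : 'rV[R]_n.+1) (Psi : 'rV[R]_n.+1 -> R) :
  (1 <= n)%N ->
  upper_unipotent A -> A != 1%:M ->
  uniquely_ergodic A b ->
  (exists k : nat, (1 <= k)%N /\
     let N := map_mx (fun z : int => z%:~R : R) A - 1%:M in
     N ^+ k != 0 /\ N ^+ k.+1 = 0 /\
     [set y *m N ^+ k | y in [set: 'rV[R]_n.+1]] =
       [set c *: @e_ R n.+1 ord_max | c in [set: R]]) ->
  trig_poly Psi -> (forall x, 0 < Psi x) ->
  ~ meas_cohom_const A b (Psi \o @rv R n.+1) ->
  smooth_cohom_const (factor_mat A) (factor_vec b) (fiber_avg Psi) ->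
  mixing_susp A b (Psi \o @rv R n.+1).
Proof.
move=> n1 Au _ ue [k [k1 [_ [Nk im]]]] tP P0 nc sc.
have irr := uniquely_ergodic_irrational Au ue.
have nil : nu_nilpotent A := nu_nilpotent_mxN Nk.
have [w _ wE] : [set y *m mxN R A ^+ k | y in [set: 'rV[R]_n.+1]] (@e_ R n.+1 ord_max).
  by rewrite im; exists 1 => //; rewrite scale1r.
have [D [Psi0 [a [c [tP0 ta tc Psi0v PsiE]]]]] := fibre_decomposition tP.
have [c0 c0p Psic0] := tp_pos_lower_bound tP P0.
have [M [_ PM]] := tp_bounded tP.
have PsiM x : Psi x <= M by apply: le_trans (PM x); exact: ler_norm.
have [C0 dev] := fibre_deviation Au tP tP0 ta tc Psi0v PsiE n1 P0 sc.
have m0E := intT_tp tP (fun x => ltW (P0 x)).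
(* The uniform average, the mean under [Lam] and [intT] are the same constant; each of the lemmas
   applied below asks for one of these forms. *)
have [m0 avg] := unif_avg_tp irr nil tP.
have avgE := Ex_unif_avg Au (tp_periodic tP) (bm_tp tP) avg.
move: m0E; rewrite avgE => m0E; rewrite m0E in dev.
have m0p : 0 < m0.
  apply: lt_le_trans c0p _; rewrite -avgE.
  rewrite -(Ex_cst (Lam R n.+1) c0); apply: Ex_le => [||t]; [exact: bm_cst|exact: bm_tp|exact: Psic0].
have cg C d L0 : 0 < d -> exists2 L, (L0 <= L)%N & L%:R^-1 * \sum_(j < L)
    Ex (Lam R n.+1) (fun t => small C (bsumT A b (fun x => Psi x - m0) j (rv t))) < d.
  move=> d0; have [L LL HL] := cesaro_growth Au irr nil C L0 tP nc d0.
  exists L => //; move: HL; rewrite m0E; congr (_ * _ < _).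
  by apply: eq_bigr => j _; rewrite small_indic.
have gH C d := growth_Hn Au tP tP0 ta tc PsiE k1 Nk wE cg dev C (d := d).
have rect := rectangle_limit Au irr nil tP ta tc PsiE dev c0p Psic0 PsiM m0p avg gH.
exact: (mixing_of_rectangles Au tP m0p (fun B B' al be e => @rect B B' al be e) m0E).
Qed.
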